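(* Let $\mathcal{G}$ be the infinite two-dimensional hexagonal grid (honeycomb) with edges of length $l>0$, and let $2<p<4$. Then, for every $\mu>0$, there exists a ground state of mass $\mu$, i.e. a function $u\in H^1_\mu(\mathcal{G})$ such that $E(u,\mathcal{G})=\mathcal{E}(\mu)$.
   Context: The honeycomb $\mathcal{G}$ is the metric graph given by the vertices and edges of the tiling of the plane $\mathbb{R}^2$ by identical regular hexagons of side length $l>0$. Equivalently: its vertices are $a_{m,n}, b_{m,n}$ with $(m,n)\in\mathbb{Z}^2$, and each $a_{m,n}$ is joined by exactly one edge to each of $b_{m,n}$, $b_{m-1,n}$, $b_{m,n-1}$ (and there are no other edges). Every edge is identified with the interval $[0,l]$ through an arclength coordinate. A (complex-valued) function $u$ on $\mathcal{G}$ is a family of functions $u_e:[0,l]\to\mathbb{C}$, one for each edge $e$; integrals and norms on $\mathcal{G}$ are obtained by summing over edges, e.g. $\int_{\mathcal{G}}|u|^q\,dx=\sum_e\int_0^l|u_e|^q\,dx$ and $\|u\|_{L^q(\mathcal{G})}=(\int_{\mathcal{G}}|u|^q\,dx)^{1/q}$; $u'$ is the edgewise weak derivative. $H^1(\mathcal{G})$ is the space of functions $u$ that are continuous on $\mathcal{G}$ (in particular at vertices) with $u,u'\in L^2(\mathcal{G})$. For $\mu>0$, $H^1_\mu(\mathcal{G}):=\{u\in H^1(\mathcal{G}) : \|u\|_{L^2(\mathcal{G})}^2=\mu\}$. The NLS energy is $$E(u,\mathcal{G})=\frac12\int_{\mathcal{G}}|u'|^2\,dx-\frac1p\int_{\mathcal{G}}|u|^p\,dx,$$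 and $\mathcal{E}(\mu):=\inf_{u\in H^1_\mu(\mathcal{G})}E(u,\mathcal{G})$. A ground state of mass $\mu$ is a minimizer of $E(\cdot,\mathcal{G})$ over $H^1_\mu(\mathcal{G})$. *)

(* Defs.v *)
From HB Require Import structures.
From mathcomp Require Import all_boot all_order all_algebra.
From mathcomp Require Import complex.
From mathcomp Require Import all_classical all_reals all_analysis.
Set Implicit Arguments.
Unset Strict Implicit.
Unset Printing Implicit Defensive.
Import Order.TTheory GRing.Theory Num.Theory.
Import numFieldNormedType.Exports.
Local Open Scope classical_set_scope.
Local Open Scope ring_scope.

(* The honeycomb: [va m n] and [vb m n] are the vertices a_{m,n}, b_{m,n};
   the edge [(m, n, k)] joins a_{m,n} to b_{m,n}, b_{m-1,n}, b_{m,n-1} for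
   k = 0, 1, 2 respectively.  It is parametrised by [0, l], from its a-end
   (coordinate 0) to its b-end (coordinate l). *)
Inductive vertex : Type := va of int & int | vb of int & int.

Definition edge : Type := (int * int * 'I_3)%type.

Definition source (e : edge) : vertex := va e.1.1 e.1.2.

Definition target (e : edge) : vertex :=
  let: (m, n, k) := e in
  match val k with
  | 0%N => vb m n
  | 1%N => vb (m - 1) n
  | _ => vb m (n - 1)
  end.

(* Only the values of [u e] on [0, l] are meaningful. *)
Definition gfun (R : realType) : Type := edge -> R -> complex R.

Definition cabs (R : realType) (z : complex R) : R := ComplexField.Normc.normc z.

Definition cmeasurable (R : realType) (D : set R) (f : R -> complex R) : Prop :=
  measurable_fun D (fun x => complex.Re (f x)) /\
  measurable_fun D (fun x => complex.Im (f x)).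

Definition clocally_integrable (R : realType) (D : set R)
    (f : R -> complex R) : Prop :=
  locally_integrable D (fun x => complex.Re (f x)) /\
  locally_integrable D (fun x => complex.Im (f x)).

Definition cintegral (R : realType) (D : set R) (f : R -> complex R)
    : complex R :=
  Complex (\int[lebesgue_measure]_(x in D) complex.Re (f x))%R
          (\int[lebesgue_measure]_(x in D) complex.Im (f x))%R.

(* Real-valued elements of C_c^oo(]0, l[). *)
Definition test_function (R : realType) (l : R) (phi : R -> R) : Prop :=
  (forall (n : nat) (x : R), derivable (derive1n n phi) x 1) /\
  compact (closure [set x | phi x != 0]) /\
  closure [set x | phi x != 0] `<=` `]0, l[.

Definition is_weak_derivative (R : realType) (l : R) (f g : R -> complex R)
    : Prop :=
  [/\ clocally_integrable `]0, l[ f,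
      clocally_integrable `]0, l[ g &
      forall phi : R -> R, test_function l phi ->
        cintegral `]0, l[ (fun x => f x * real_complex R (derive1 phi x)) =
        - cintegral `]0, l[ (fun x => g x * real_complex R (phi x))].

Definition weakly_differentiable (R : realType) (l : R) (u : gfun R) : Prop :=
  forall e, exists g, is_weak_derivative l (u e) g.

(* The weak derivative is unique up to a null set; one representative is
   chosen, with default 0 when there is none. *)
Definition weak_derivative (R : realType) (l : R) (u : gfun R) : gfun R :=
  fun e => xget (fun=> 0) [set g | is_weak_derivative l (u e) g].

(* Values of [u e] at the ends of all edges meeting at [v] agree with [w v]. *)
Definition gcontinuous (R : realType) (l : R) (u : gfun R) : Prop :=
  (forall e, {within `[0, l],
     continuous (u e : R -> GRing.regular (complex R))}) /\
  exists w : vertex -> complex R,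
    forall e, u e 0 = w (source e) /\ u e l = w (target e).

Local Open Scope ereal_scope.

Definition gintegral (R : realType) (l : R) (h : edge -> R -> R) : \bar R :=
  \esum_(e in [set: edge])
    \int[lebesgue_measure]_(x in `[0%R, l]) (h e x)%:E.

Definition gpow_integral (R : realType) (l q : R) (u : gfun R) : \bar R :=
  gintegral l (fun e x => powR (cabs (u e x)) q).

Definition graph_norm (R : realType) (l q : R) (u : gfun R) : \bar R :=
  poweR (gpow_integral l q u) q^-1%R.

Definition in_Lq (R : realType) (l q : R) (u : gfun R) : Prop :=
  (forall e, cmeasurable `[0%R, l] (u e)) /\ graph_norm l q u < +oo.

Definition sobolevH1 (R : realType) (l : R) : set (gfun R) :=
  [set u | [/\ gcontinuous l u, in_Lq l 2 u, weakly_differentiable l u &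
               in_Lq l 2 (weak_derivative l u)]].

Definition sobolevH1mass (R : realType) (l mu : R) : set (gfun R) :=
  [set u | sobolevH1 l u /\ graph_norm l 2 u ^+ 2 = mu%:E].

(* On [sobolevH1 l] both integrals are finite when 2 < p. *)
Definition energy (R : realType) (l p : R) (u : gfun R) : \bar R :=
  (2^-1)%:E * gpow_integral l 2 (weak_derivative l u) -
  (p^-1)%:E * gpow_integral l p u.

Definition energy_level (R : realType) (l p mu : R) : \bar R :=
  ereal_inf [set energy l p u | u in sobolevH1mass l mu].

Definition is_ground_state (R : realType) (l p mu : R) (u : gfun R) : Prop :=
  sobolevH1mass l mu u /\ energy l p u = energy_level l p mu.

(* Main.v *)
(** For p < 4 the Gagliardo-Nirenberg inequality makes the energy coercive, and
    wide tents show that the infimum I over the mass mu is negative: a tent of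
    width N and mass mu has kinetic energy of order N^(-2) and potential of
    order N^(2 - p).  Because I < 0 a minimizing sequence cannot vanish,
    so after translation it keeps a fixed mass on the edges of one cell; let v
    be its pointwise limit along an ultrafilter.  The Brezis-Lieb splitting of
    mass, kinetic energy and potential, combined with the nonnegativity of the
    defect E - (I / mu) M on functions of mass at most mu, excludes dichotomy:
    v has mass mu and energy I.

    The minimization is carried out over nonnegative quantities attached to
    continuous real functions, the kinetic energy of an edge being the supremum
    of its energies on dyadic subdivisions.  This avoids weak compactness in
    H^1.  The passage back is that |u| is a competitor with no larger energy for
    every complex u in H^1, and that a minimizer, tested against hats, has
    second differences O(h^2), hence is C^1 on every edge. *)

Require Import Defs.
From HB Require Import structures.
From mathcomp Require Import all_boot all_order all_algebra finmap.
From mathcomp Require Import complex.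
From mathcomp Require Import all_classical all_reals all_analysis.
From mathcomp Require Import measurable_realfun.
From mathcomp Require Import ring lra zify.
Set Implicit Arguments.
Unset Strict Implicit.
Unset Printing Implicit Defensive.
Import Order.TTheory GRing.Theory Num.Theory.
Import numFieldNormedType.Exports.
Local Open Scope classical_set_scope.
Local Open Scope ring_scope.

(** The splitting argument rests on one elementary inequality, (1 - t) y^2 <= (x + y)^2 + (1/t - 1)
    x^2. Refining a dyadic subdivision changes the energy by a sum of squares of linear functionals
    of the function, so the kinetic energy is a sum over pairs (edge, level) of the same type as the
    mass, and one lemma on indexed families splits both. The cross terms of the potential are
    reduced to the mass as well. The same structure makes the kinetic energy lower semicontinuous
    under pointwise limits, and a hat at level k changes only finitely many of its terms, so the
    variation along a hat is an exact finite expression. The ultrafilter replaces the extraction of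
    subsequences: it gives a limit at every point of every edge at once. The price is paid at the
    two ends. Starting from H^1, increments must be recovered from the weak derivative by smooth
    test functions, which are built by hand. Returning to H^1, the weak derivative is an arbitrary
    choice among representatives and has to be identified with the classical derivative almost
    everywhere. *)

(** * Smooth functions on the line and bumps *)

Section SmoothFunctions.
Context {R : realType}.
Implicit Types (f g : R -> R).

(** The function is differentiated first and the recursion continues in its derivative, whereas
    [derive1n] differentiates last. Closure under sums, products and affine substitution then
    follows by induction with the functions generalized. *)
Fixpoint derivable_upto (n : nat) f : Prop :=
  if n is n'.+1 then (forall x, derivable f x 1) /\ derivable_upto n' (derive1 f)
  else True.

Definition smooth f := forall n, derivable_upto n f.

Lemma derive1nSr (n : nat) f : derive1n n.+1 f = derive1n n (derive1 f).
Proof. by elim: n => // n IHn; rewrite derive1nS IHn -derive1nS. Qed.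

Lemma smooth_derivable_derive1n f n x : smooth f -> derivable (derive1n n f) x 1.
Proof.
move=> /(_ n.+1); elim: n f => [|n IHn] f /=; first by case.
by case=> df sf; rewrite -derive1nS derive1nSr; exact: IHn.
Qed.

Lemma derivable_uptoW n f : derivable_upto n.+1 f -> derivable_upto n f.
Proof. by elim: n f => // n IHn f [df] /IHn. Qed.

Lemma derivable_uptoD n f g :
  derivable_upto n f -> derivable_upto n g -> derivable_upto n (f + g).
Proof.
elim: n f g => // n IHn f g [df sf] [dg sg]; split.
  by move=> x; apply: derivableD.
have -> : derive1 (f + g) = derive1 f + derive1 g.
  by apply/funext => x; rewrite derive1E deriveD; [rewrite -!derive1E|exact: df|exact: dg].
exact: IHn.
Qed.

Lemma derivable_uptoM n f g :
  derivable_upto n f -> derivable_upto n g -> derivable_upto n (f * g).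
Proof.
elim: n f g => // n IHn f g [df sf] [dg sg]; split.
  by move=> x; apply: derivableM.
have -> : derive1 (f * g) = f * derive1 g + g * derive1 f.
  by apply/funext => x; rewrite derive1E deriveM; [rewrite -!derive1E|exact: df|exact: dg].
by apply: derivable_uptoD; apply: IHn => //; apply: derivable_uptoW.
Qed.

Lemma smoothM f g : smooth f -> smooth g -> smooth (f * g).
Proof. by move=> sf sg n; apply: derivable_uptoM. Qed.

Lemma smooth_primitive f F : (forall x : R, is_derive x (1 : R) F (f x)) -> smooth f ->
  smooth F.
Proof.
move=> dF sf [|n] //=; split; first by move=> x; have [] := dF x.
have -> // : derive1 F = f.
by apply/funext => x; rewrite derive1E; apply: derive_val.
Qed.

Lemma is_derive_affine (a b x : R) :
  is_derive x (1 : R) (fun y => a * y + b) a.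
Proof.
have -> : (fun y => a * y + b) = horner (a%:P * 'X + b%:P).
  by apply/funext => y; rewrite !hornerE.
apply: is_derive_eq (is_derive_poly _ _) _.
by rewrite derivD derivC derivM derivC derivX mul0r add0r mulr1 addr0 hornerC.
Qed.

Lemma smooth_affine f a b : smooth f -> smooth (fun x => f (a * x + b)).
Proof.
move=> sf n; elim: n f sf => // n IHn f sf; split.
  move=> x; apply: ex_derive.
  apply: (@is_derive1_comp _ f (fun y => a * y + b) x (derive1 f (a * x + b)) a).
    by rewrite derive1E; apply/derivableP; case: (sf 1%N).
  exact: is_derive_affine.
have -> : derive1 (fun x => f (a * x + b)) = cst a * (fun x => derive1 f (a * x + b)).
  apply/funext => x; rewrite derive1E [LHS](@derive_val _ _ _ x 1 _
    (derive1 f (a * x + b) * a)); first by rewrite mulrC.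
  apply: (@is_derive1_comp _ f (fun y => a * y + b) x (derive1 f (a * x + b)) a).
    by rewrite derive1E; apply/derivableP; case: (sf 1%N).
  exact: is_derive_affine.
apply: derivable_uptoM; last by apply: IHn => k; case: (sf k.+1).
elim: n {IHn} a => // n IHn a; split; first by move=> x; apply: derivable_cst.
have -> : derive1 (cst a : R -> R) = cst 0.
  by apply/funext => x; rewrite derive1E derive_cst.
exact: IHn.
Qed.

(* The smooth function germs at [0+] stable under differentiation:
   [(p(1/x) exp(-1/x))' = ('X^2 (p - p'))(1/x) exp(-1/x)]. *)
Definition flat (p : {poly R}) (x : R) : R :=
  if 0 < x then p.[x^-1] * expR (- x^-1) else 0.

(** The exponential dominates y^(i+1)/(i+1)!, one power more than is needed; the spare power is the
    factor 1/y. Used at y = 1/x, it gives a bound linear in x. *)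
Lemma expn_expRN_le (i : nat) (y : R) : 0 < y ->
  y ^+ i * expR (- y) <= (i.+1)`!%:R / y.
Proof.
move=> y0; rewrite expRN ler_pdivrMr ?expR_gt0// ?divr_gt0 ?expR_gt0 //.
have := expR_ge1Dxn i (ltW y0); set F := (i.+1)`!%:R.
have F0 : 0 < F by rewrite ltr0n fact_gt0.
move=> h.
have : y ^+ i.+1 / F <= expR y by apply: le_trans h; rewrite lerDr.
rewrite ler_pdivrMr// exprS => h2.
rewrite [leRHS](_ : _ = y^-1 * (expR y * F)); last by ring.
rewrite ler_pdivlMl//.
Qed.

Lemma flat_linear_bound (p : {poly R}) :
  exists2 C, 0 <= C & forall x, `|flat p x| <= C * `|x|.
Proof.
exists (\sum_(i < size p) `|p`_i| * (i.+1)`!%:R).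
  by apply: sumr_ge0 => i _; rewrite mulr_ge0.
move=> x; rewrite /flat; case: ifPn => [x0|_]; last first.
  by rewrite normr0 mulr_ge0 ?sumr_ge0// => i _; rewrite mulr_ge0.
rewrite horner_coef mulr_suml mulr_suml (le_trans (ler_norm_sum _ _ _))//.
apply: ler_sum => i _; rewrite -mulrA normrM -mulrA ler_wpM2l//.
rewrite ger0_norm; last by rewrite mulr_ge0 ?exprn_ge0 ?invr_ge0 ?ltW ?expR_gt0.
rewrite (le_trans (expn_expRN_le _ _)) ?invr_gt0// invrK gtr0_norm//.
Qed.

Lemma is_derive_flat (p : {poly R}) (x : R) :
  is_derive x (1 : R) (flat p) (flat ('X^2 * (p - p^`())) x).
Proof.
have [x0|x0|x0] := ltgtP x 0.
- rewrite {2}/flat (lt_gtF x0).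
  apply: (@near_eq_is_derive _ _ _ (cst 0)).
  near=> y; rewrite /flat ifF//=; apply/negbTE; rewrite -leNgt ltW//.
  by near: y; exact: lt_nbhsl.
- rewrite {2}/flat x0.
  apply: (@near_eq_is_derive _ _ _ ((fun y : R => p.[y^-1]) * (fun y : R => expR (- y^-1)))).
    near=> y; rewrite /flat ifT//; near: y; exact: lt_nbhsr.
  have dV : is_derive x 1 (fun y : R => y^-1) (- x ^- 2 *: 1).
    by apply: (@is_deriveV _ id); rewrite ?gt_eqF.
  have dN : is_derive x 1 (fun y : R => - y^-1) (- (- x ^- 2 *: 1)).
    exact: is_deriveN.
  have d1 := @is_derive1_comp _ (horner p) _ x _ _ (is_derive_poly p x^-1) dV.
  have d2 := @is_derive1_comp _ expR _ x _ _ (is_derive_expR (- x^-1)) dN.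
  have d3 := @is_deriveM _ _ _ _ x 1 _ _ d1 d2.
  apply: is_derive_eq d3 _; rewrite /= !hornerE /=.
  rewrite /GRing.scale /=; rewrite -exprVn. ring.
(* At 0 the difference quotient of [flat p] is [flat ('X * p)], which the linear bound sends to
   0. *)
- subst x.
  have -> : flat ('X^2 * (p - p^`())) 0 = 0 by rewrite /flat ltxx.
  have [C C0 Cb] := flat_linear_bound ('X * p).
  suff cv : h^-1 *: ((flat p \o shift 0) (h *: 1) - flat p 0) @[h --> (0:R)^'] --> (0:R).
    apply: DeriveDef; first by apply/cvg_ex; exists 0.
    exact: cvg_lim cv.
  apply/cvgr0Pnorm_lt => e e0; near=> h.
  have -> : h^-1 *: ((flat p \o shift 0) (h *: 1) - flat p 0) = flat ('X * p) h.
    rewrite /= {2}/flat ltxx subr0 addr0 /GRing.scale /= mulr1 /flat.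
    case: ifP => // _; last by rewrite mulr0.
    rewrite !hornerE /=. ring.
  apply: (le_lt_trans (Cb h)).
  apply: (@le_lt_trans _ _ ((C + 1) * `|h|)); first by rewrite ler_wpM2r// lerDl.
  rewrite -ltr_pdivlMl ?ltr_wpDl//.
  near: h; apply: dnbhs0_lt.
  by rewrite mulr_gt0// invr_gt0 ltr_wpDl.
Unshelve. all: by end_near.
Qed.

Lemma smooth_flat p : smooth (flat p).
Proof.
move=> n; elim: n p => //= n IHn p; split.
  by move=> x; apply: ex_derive; exact: is_derive_flat.
have -> // : derive1 (flat p) = flat ('X^2 * (p - p^`())).
apply/funext => x; rewrite derive1E.
exact: (@derive_val _ _ _ _ _ _ _ (is_derive_flat p x)).
Qed.

Lemma smooth_continuous f : smooth f -> continuous f.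
Proof.
move=> /(_ 1%N)[df _] x; apply: differentiable_continuous.
exact/derivable1_diffP.
Qed.

(** The usual bump exp(-1/(x - a)) exp(-1/(b - x)) on ]a, b[, extended by 0. *)
Definition cutoff (a b x : R) : R := flat 1 (x - a) * flat 1 (b - x).

Lemma smooth_cutoff a b : smooth (cutoff a b).
Proof.
have -> : cutoff a b = (fun x => flat 1 (1 * x + - a)) * (fun x => flat 1 (-1 * x + b)).
  apply/funext => x; rewrite /cutoff fctE; congr (flat 1 _ * flat 1 _); ring.
by apply: smoothM; apply: smooth_affine; exact: smooth_flat.
Qed.

Lemma cutoff_ge0 a b x : 0 <= cutoff a b x.
Proof.
rewrite /cutoff /flat; case: ifP => _; case: ifP => _; rewrite ?mul0r ?mulr0//.
by rewrite !mulr_ge0 ?expR_ge0 ?hornerE.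
Qed.

Lemma cutoff_gt0 a b x : a < x -> x < b -> 0 < cutoff a b x.
Proof.
move=> ax xb; rewrite /cutoff /flat !subr_gt0 ax xb !hornerE.
by rewrite !mulr_gt0 ?expR_gt0.
Qed.

Lemma cutoff_eq0 a b x : ~~ (a < x < b) -> cutoff a b x = 0.
Proof.
rewrite negb_and /cutoff /flat !subr_gt0 => /orP[|] /negbTE ->.
  by rewrite mul0r.
by rewrite mulr0.
Qed.

End SmoothFunctions.

(** * Integrals over intervals *)

Section IntervalIntegrals.
Context {R : realType}.
Implicit Types (f g : R -> R).
Notation mu := (@lebesgue_measure R).

Lemma Rintegral_subset (A B : set R) f : A `<=` B ->
  (forall x, B x -> ~ A x -> f x = 0) ->
  (\int[mu]_(x in B) f x = \int[mu]_(x in A) f x)%R.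
Proof.
move=> AB f0; rewrite -[in RHS](setIidr AB) Rintegral_mkcondr.
apply: eq_Rintegral => x /[!inE] Bx; rewrite patchE; case: ifPn => // /negP.
by rewrite inE => /f0 ->.
Qed.

Lemma continuous_integrable f (a b : R) : continuous f ->
  mu.-integrable `[a, b] (EFin \o f).
Proof.
move=> cf; apply: continuous_compact_integrable; first exact: segment_compact.
exact: continuous_subspaceT.
Qed.

Lemma is_derive_MVT f (df : R -> R) (a b : R) :
  (forall x : R, is_derive x (1 : R) f (df x)) -> a < b ->
  exists2 c, c \in `]a, b[ & f b - f a = df c * (b - a).
Proof.
move=> dF ab; apply: MVT => //.
apply: continuous_subspaceT => x; apply: differentiable_continuous.
by apply/derivable1_diffP; have [] := dF x.
Qed.

Lemma Rintegral_is_derive f (df : R -> R) (a b : R) : a < b ->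
  (forall x : R, is_derive x (1 : R) f (df x)) -> continuous df ->
  (\int[mu]_(x in `[a, b]) df x = f b - f a)%R.
Proof.
move=> ab dF cdf.
have cf : continuous f.
  move=> x; apply: differentiable_continuous.
  by apply/derivable1_diffP; have [] := dF x.
have := @continuous_FTC2 R df f a b ab; rewrite /Rintegral => -> //.
- exact: continuous_subspaceT.
- split; first by move=> x _; have [] := dF x.
    exact/cvg_at_right_filter/cf.
  exact/cvg_at_left_filter/cf.
- by move=> x _; rewrite derive1E; apply: derive_val.
Qed.

End IntervalIntegrals.

(** * Smooth steps *)

Section TestFunctions.
Context {R : realType}.
Notation mu := (@lebesgue_measure R).

(** [Phi] is the primitive of a bump divided by its total mass. The density [beta] serves as a
    mollifier on [a, b], and differences of two steps serve as plateau test functions. *)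
Lemma smooth_step (a b : R) : a < b -> exists Phi beta : R -> R,
  [/\ smooth Phi, (forall x : R, is_derive x (1 : R) Phi (beta x)) /\ continuous beta,
      (forall x, 0 <= beta x) /\ (forall x, ~~ (a < x < b) -> beta x = 0),
      forall x, x <= a -> Phi x = 0 & forall x, b <= x -> Phi x = 1].
Proof.
move=> ab.
have cb : continuous (cutoff a b) by apply: smooth_continuous; exact: smooth_cutoff.
(* The primitive is taken from minus infinity, which makes it differentiable at every real point;
   this asks for integrability on the whole line. *)
have ib : mu.-integrable setT (EFin \o cutoff a b).
  have -> : EFin \o cutoff a b = (EFin \o cutoff a b) \_ `[a, b].
    apply/funext => x; rewrite patchE; case: ifPn => //= /negP xab.
    rewrite cutoff_eq0//; apply/negP => /andP[ax xb]; apply: xab.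
    by rewrite inE/= in_itv/= !ltW.
  apply/integrable_restrict => //; rewrite setTI; exact: continuous_integrable.
pose F x := (\int[mu]_(t in `]-oo, x]) cutoff a b t)%R.
have dF (x : R) : is_derive x (1 : R) F (cutoff a b x).
  have [h1 h2] : derivable F x 1 /\ derive1 F x = cutoff a b x.
    apply: (@continuous_FTC1 R (cutoff a b) -oo%O x (x + 1)).
    - by rewrite ltrDl.
    - by apply: integrableS ib.
    - by rewrite ltNyr.
    - exact: cb.
  apply: DeriveDef; first exact: h1.
  by rewrite -derive1E.
have F0 x : x <= a -> F x = 0.
  move=> xa; rewrite /F (@Rintegral_subset _ set0)// ?Rintegral_set0// => t /=.
  rewrite in_itv/= => tx _; apply: cutoff_eq0.
  by rewrite negb_and -leNgt (le_trans tx xa).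
have Fb : 0 < F b.
  have [c] := is_derive_MVT dF ab; rewrite in_itv/= => /andP[ac cb'].
  by rewrite (F0 a)// subr0 => ->; rewrite mulr_gt0 ?subr_gt0 ?cutoff_gt0.
exists (fun x => F x / F b), (fun x => cutoff a b x / F b).
have dP (x : R) : is_derive x (1 : R) (fun x => F x / F b) (cutoff a b x / F b).
  have -> : (fun x => F x / F b) = ((F b)^-1 \*: F).
    by apply/funext => y; rewrite mulrC.
  by rewrite mulrC; apply: is_deriveZ.
have sm : smooth (fun x => cutoff a b x / F b).
  move=> n; rewrite (_ : (fun x => cutoff a b x / F b) = cutoff a b * cst (F b)^-1)//.
  apply: derivable_uptoM; first exact: smooth_cutoff.
  have := @smooth_affine R (flat 0) 0 0.
  elim: n (F b)^-1 => // n IHn c _; split; first by move=> x; apply: derivable_cst.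
  rewrite (_ : derive1 _ = cst 0); first by apply: IHn; apply: smooth_affine.
  by apply/funext => x; rewrite derive1E derive_cst.
split.
- exact: smooth_primitive dP sm.
- by split => //; exact: smooth_continuous.
- split=> x; first by rewrite divr_ge0 ?cutoff_ge0// ltW.
  by move=> /cutoff_eq0 ->; rewrite mul0r.
- by move=> x /F0 ->; rewrite mul0r.
- move=> x; rewrite le_eqVlt => /orP[/eqP<-|bx]; first by rewrite divff ?gt_eqF.
  have [c] := is_derive_MVT dF bx; rewrite in_itv/= => /andP[bc cx].
  rewrite cutoff_eq0; last by rewrite negb_and -!leNgt (ltW bc) orbT.
  by rewrite mul0r => /eqP; rewrite subr_eq0 => /eqP ->; rewrite divff ?gt_eqF.
Qed.

Lemma step_itv (a b : R) (Phi beta : R -> R) : a < b ->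
  (forall x : R, is_derive x (1 : R) Phi (beta x)) -> (forall x, 0 <= beta x) ->
  (forall x, x <= a -> Phi x = 0) -> (forall x, b <= x -> Phi x = 1) ->
  forall x, 0 <= Phi x <= 1.
Proof.
move=> ab dP b0 P0 P1 x.
have nd u v : u <= v -> Phi u <= Phi v.
  rewrite le_eqVlt => /orP[/eqP->//|uv].
  by have [c _ h] := is_derive_MVT dP uv; rewrite -subr_ge0 h mulr_ge0// subr_ge0 ltW.
apply/andP; split.
  by rewrite -(P0 (Num.min a x)) ?ge_min ?lexx//; apply: nd; rewrite ge_min lexx orbT.
by rewrite -(P1 (Num.max b x)) ?le_max ?lexx//; apply: nd; rewrite le_max lexx orbT.
Qed.

End TestFunctions.

(** * The fundamental theorem for weak derivatives *)

Section WeakFTC.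
Context {R : realType}.
Notation mu := (@lebesgue_measure R).

Lemma continuous_eps (a : R -> R) (x d : R) : continuous a -> 0 < d ->
  exists2 r, 0 < r & forall t, `|t - x| < r -> `|a t - a x| <= d.
Proof.
move=> ca d0; have /cvgrPdist_le/(_ _ d0)[r /= r0 hr] := ca x.
by exists r => // t tx; rewrite distrC; apply: hr; rewrite /= distrC.
Qed.

(** The integral is an average of [a]: the weight [beta] is nonnegative, lives on [c, d], and has
    total mass [Phi d - Phi c = 1]. *)
Lemma mollify_close (a Phi beta : R -> R) (l c d z delta : R) :
  0 < c -> c < d -> d < l -> continuous a -> continuous beta ->
  (forall x : R, is_derive x (1 : R) Phi (beta x)) ->
  (forall x, 0 <= beta x) -> (forall x, ~~ (c < x < d) -> beta x = 0) ->
  Phi c = 0 -> Phi d = 1 -> (forall t, c <= t <= d -> `|a t - z| <= delta) ->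
  `|(\int[mu]_(x in `]0, l[) (a x * beta x))%R - z| <= delta.
Proof.
move=> c0 cd dl ca cb dP b0 b1 P0 P1 az.
rewrite (@Rintegral_subset _ `[c, d]); last 2 first.
- move=> t /=; rewrite !in_itv/= => /andP[ct td].
  by rewrite (lt_le_trans c0)//= (le_lt_trans td).
- move=> t _; rewrite /= in_itv/= => tcd; rewrite b1 ?mulr0//.
  by apply/negP => /andP[? ?]; apply: tcd; rewrite !ltW.
have ib1 : (\int[mu]_(x in `[c, d]) beta x = 1)%R.
  by rewrite (Rintegral_is_derive cd dP cb) P1 P0 subr0.
have iab : continuous (fun x => a x * beta x).
  by move=> x; apply: cvgM; [exact: ca|exact: cb].
have izb : continuous (fun x => z * beta x).
  by move=> x; apply: cvgM; [exact: cvg_cst|exact: cb].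
have -> : z = (\int[mu]_(x in `[c, d]) (z * beta x))%R.
  by rewrite RintegralZl ?ib1 ?mulr1//; exact: continuous_integrable.
rewrite -RintegralB//; [|exact: continuous_integrable..].
have id : continuous (fun x => a x * beta x - z * beta x).
  by move=> x; apply: cvgB; [exact: iab|exact: izb].
apply: le_trans (le_normr_Rintegral _ _) _ => //; first exact: continuous_integrable.
have -> : delta = (\int[mu]_(x in `[c, d]) (delta * beta x))%R.
  by rewrite RintegralZl ?ib1 ?mulr1//; exact: continuous_integrable.
apply: le_Rintegral => //.
- by apply: continuous_integrable => x; apply: cvg_norm; exact: id.
- apply: continuous_integrable => x; apply: cvgM; [exact: cvg_cst|exact: cb].
- move=> t /=; rewrite in_itv/= => tcd.
  by rewrite -mulrBl normrM (ger0_norm (b0 t)) ler_wpM2r// az.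
Qed.

(** The relation is tested against plateaus that rise just after x and fall just before y. Their
    derivatives approximate a Dirac mass at x minus one at y, while the plateaus themselves tend to
    the indicator of ]x, y[. *)
Lemma weak_FTC (l x y : R) (a b : R -> R) : 0 < x -> x < y -> y < l ->
  continuous a -> locally_integrable `]0, l[ b ->
  (forall phi : R -> R, test_function l phi ->
     (\int[mu]_(t in `]0%R, l[) (a t * derive1 phi t))%R =
     - (\int[mu]_(t in `]0%R, l[) (b t * phi t))%R) ->
  (\int[mu]_(t in `[x, y]) b t)%R = a y - a x.
Proof.
move=> x0 xy yl ca [mb _ ib] rel.
(* The factor 1/2 keeps the two ramps from overlapping, already for n = 0. *)
pose e (n : nat) : R := (y - x) / 2 / n.+1%:R.
have e0 n : 0 < e n by rewrite !divr_gt0// subr_gt0.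
have e2 n : e n <= (y - x) / 2.
  by rewrite /e ler_pdivrMr// ler_peMr ?ler1n// divr_ge0// subr_ge0 ltW.
have ecv : e n @[n --> \oo] --> (0 : R).
  rewrite -(mulr0 ((y - x) / 2)); apply: cvgM; first exact: cvg_cst.
  exact: cvg_harmonic.
have step1 n := @smooth_step R x (x + e n) (ltac:(by rewrite ltrDl)).
have step2 n := @smooth_step R (y - e n) y (ltac:(by rewrite ltrBlDr ltrDl)).
have [P1 /choice[B1 H1]] := choice step1.
have [P2 /choice[B2 H2]] := choice step2.
pose phi n t := P1 n t - P2 n t.
have xe n : x + e n <= y - e n by have := e2 n; lra.
have P1b n t : 0 <= P1 n t <= 1.
  have [_ [d _] [b0 _] p0 p1] := H1 n.
  by apply: step_itv d b0 p0 p1 t; rewrite ltrDl.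
have P2b n t : 0 <= P2 n t <= 1.
  have [_ [d _] [b0 _] p0 p1] := H2 n.
  by apply: step_itv d b0 p0 p1 t; rewrite ltrBlDr ltrDl.
have phib n t : 0 <= phi n t <= 1.
  have := P1b n t; have := P2b n t; rewrite /phi => /andP[h1 h2] /andP[h3 h4].
  have [ty|ty] := leP t (y - e n).
    by have [_ _ _ p0 _] := H2 n; rewrite p0// subr0 h3 h4.
  have [_ _ _ _ p1] := H1 n; rewrite p1; last by have := xe n; lra.
  by apply/andP; split; lra.
have phi0 n t : ~~ (x < t < y) -> phi n t = 0.
  rewrite negb_and -!leNgt /phi => /orP[tx|yt].
    have [_ _ _ p0 _] := H1 n; have [_ _ _ q0 _] := H2 n.
    by rewrite p0// q0 ?subr0//; have := xe n; have := e0 n; lra.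
  have [_ _ _ _ p1] := H1 n; have [_ _ _ _ q1] := H2 n.
  by rewrite p1 ?q1 ?subrr//; have := xe n; have := e0 n; lra.
have dphi n (t : R) : is_derive t (1 : R) (phi n) (B1 n t - B2 n t).
  have [_ [d1 _] _ _ _] := H1 n; have [_ [d2 _] _ _ _] := H2 n.
  exact: is_deriveB.
have sphi n : smooth (phi n).
  have [s1 _ _ _ _] := H1 n; have [s2 _ _ _ _] := H2 n.
  have -> : phi n = P1 n + (fun t => 0 * t + -1) * P2 n.
    by apply/funext => t; rewrite /phi !fctE; ring.
  move=> k; apply: derivable_uptoD => //; apply: derivable_uptoM => //.
  have := @smooth_affine R (horner 'X) 0 (-1).
  have sX : smooth (horner ('X : {poly R})).
    have sc : forall c : R, smooth (horner c%:P).
      move=> c j; elim: j c => // j IHj c; split.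
        by move=> z; apply: ex_derive; exact: is_derive_poly.
      have -> : derive1 (horner c%:P) = horner 0%:P.
        apply/funext => z; rewrite derive1E (@derive_val _ _ _ _ _ _ _ (is_derive_poly _ _)).
        by rewrite derivC.
      exact: IHj.
    apply: (@smooth_primitive _ (horner 1%:P)); last exact: sc.
    by move=> z; apply: is_derive_eq (is_derive_poly _ _) _; rewrite derivX.
  move=> /(_ sX k); congr derivable_upto.
  by apply/funext => t; rewrite hornerX.
have supp n : closure [set t | phi n t != 0] `<=` `[x, y].
  have cl : closed (`[x, y]%classic : set R) by exact: itv_closed.
  rewrite [X in _ `<=` X]((closure_id _).1 cl).
  apply: closure_subset => t /= pt; rewrite in_itv/=; apply/negP => ht.
  move/eqP: pt; apply; apply: phi0; apply/negP => /andP[? ?]; apply: ht.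
  by rewrite !ltW.
have tphi n : test_function l (phi n).
  split; first by move=> k t; exact: smooth_derivable_derive1n.
  split; last first.
    apply: (subset_trans (supp n)) => t /=; rewrite !in_itv/= => /andP[xt ty].
    by rewrite (lt_le_trans x0)//= (le_lt_trans ty).
  by apply: subclosed_compact (supp n); [exact: closed_closure|exact: segment_compact].
have ibxy : mu.-integrable `[x, y] (EFin \o b).
  apply/integrableP; split.
    apply/measurable_EFinP; apply: measurable_funS mb => // t /=.
    rewrite !in_itv/= => /andP[xt ty].
    by rewrite (lt_le_trans x0)//= (le_lt_trans ty).
  apply: (ib `[x, y]%classic).
    move=> t /=; rewrite !in_itv/= => /andP[xt ty].
    by rewrite (lt_le_trans x0)//= (le_lt_trans ty).
  exact: segment_compact.
have cvL : (\int[mu]_(t in `]0%R, l[) (a t * derive1 (phi n) t))%R @[n --> \oo]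
    --> a x - a y.
  have -> : (fun n => (\int[mu]_(t in `]0%R, l[) (a t * derive1 (phi n) t))%R) =
    (fun n => (\int[mu]_(t in `]0%R, l[) (a t * B1 n t))%R -
       (\int[mu]_(t in `]0%R, l[) (a t * B2 n t))%R).
    apply/funext => n; have [_ [d1 c1] [b1 z1] _ _] := H1 n.
    have [_ [d2 c2] [b2 z2] _ _] := H2 n.
    have ii (B : R -> R) : continuous B ->
        mu.-integrable `]0, l[ (EFin \o (fun t => a t * B t)).
      move=> cB.
      have ic : mu.-integrable `[0, l] (EFin \o (fun t => a t * B t)).
        by apply: continuous_integrable => t; apply: cvgM; [exact: ca|exact: cB].
      by apply: integrableS ic => //; exact: subset_itv_oo_cc.
    rewrite -RintegralB//; [|exact: ii..].
    apply: eq_Rintegral => t _; rewrite derive1E.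
    by rewrite (@derive_val _ _ _ _ _ _ _ (dphi n t)) mulrBr.
  apply: cvgB.
    apply/cvgrPdist_le => d d0; have [r r0 hr] := continuous_eps x ca d0.
    near=> n; rewrite distrC.
    have [_ [d1 c1] [b1 z1] p0 p1] := H1 n.
    apply: (@mollify_close _ (P1 n) _ _ x (x + e n)) => //.
    - by rewrite ltrDl.
    - by apply: le_lt_trans yl; have := xe n; have := e0 n; lra.
    - exact: p0.
    - exact: p1.
    move=> t /andP[xt te]; apply: hr; rewrite ltr_distl.
    suff : e n < r by move=> er; apply/andP; split; lra.
    by near: n; apply: (cvgr_lt _ ecv).
  apply/cvgrPdist_le => d d0; have [r r0 hr] := continuous_eps y ca d0.
  near=> n; rewrite distrC.
  have [_ [d1 c1] [b1 z1] p0 p1] := H2 n.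
  apply: (@mollify_close _ (P2 n) _ _ (y - e n) y) => //.
  - by apply: lt_trans x0 _; have := xe n; have := e0 n; lra.
  - by rewrite ltrBlDr ltrDl.
  - exact: p0.
  - exact: p1.
  move=> t /andP[xt te]; apply: hr; rewrite ltr_distl.
  suff : e n < r by move=> er; apply/andP; split; lra.
  by near: n; apply: (cvgr_lt _ ecv).
have ibo : mu.-integrable `]x, y[ (EFin \o b).
  by apply: integrableS ibxy => //; exact: subset_itv_oo_cc.
(* Dominated convergence with bound [|b|]: at a fixed t in ]x, y[ the plateau equals 1 once both
   ramps are shorter than the distances from t to x and to y. *)
have cvR : (\int[mu]_(t in `]0%R, l[) (b t * phi n t))%R @[n --> \oo]
    --> (\int[mu]_(t in `]x, y[) b t)%R.
  have -> : (fun n => (\int[mu]_(t in `]0%R, l[) (b t * phi n t))%R) =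
    (fun n => (\int[mu]_(t in `]x, y[) (b t * phi n t))%R).
    apply/funext => n; apply: Rintegral_subset.
      move=> t /=; rewrite !in_itv/= => /andP[xt ty].
      by rewrite (lt_trans x0)//= (lt_trans ty).
    by move=> t _ /= /negP; rewrite in_itv/= => h; rewrite phi0 ?mulr0.
  have mo : measurable_fun `]x, y[ b.
    by move/integrableP : ibo => [/measurable_EFinP].
  have := @dominated_cvg _ _ R mu `]x, y[%classic (measurable_itv _)
    (fun n t => (b t * phi n t)%:E) (EFin \o b) (fun t => `|b t|%:E).
  move=> DC; apply: fine_cvg; rewrite /Rintegral fineK; last first.
    exact: integrable_fin_num.
  apply: DC => //.
  - move=> n; apply/measurable_EFinP; apply: measurable_funM => //.
    apply: measurable_funTS; apply: continuous_measurable_fun.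
    exact: smooth_continuous.
  - move=> t /=; rewrite in_itv/= => /andP[xt ty].
    apply: cvg_EFin; first by apply: nearW.
    apply: cvg_near_cst; near=> n.
    have [_ _ _ _ p1] := H1 n; have [_ _ _ q0 _] := H2 n.
    have e1 : e n < t - x by near: n; apply: (cvgr_lt _ ecv); rewrite subr_gt0.
    have e3 : e n < y - t by near: n; apply: (cvgr_lt _ ecv); rewrite subr_gt0.
    by rewrite /= /phi p1 ?q0 ?subr0 ?mulr1//; lra.
  - by move/integrable_abse : ibo.
  - move=> n t _; rewrite abse_EFin lee_fin normrM ler_piMr//.
    by have /andP[h1 h2] := phib n t; rewrite ger0_norm.
have cu : a x - a y = - (\int[mu]_(t in `]x, y[) b t)%R.
  rewrite -(cvg_lim (@Rhausdorff R) cvL); apply: cvg_lim; first exact: Rhausdorff.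
  under eq_fun do rewrite rel//.
  exact: cvgN cvR.
have -> : (\int[mu]_(t in `[x, y]) b t = \int[mu]_(t in `]x, y[) b t)%R.
  rewrite -Rintegral_itv_obnd_cbnd; last first.
    by apply: integrableS ibxy => //; apply: subset_itvr; rewrite bnd_simp.
  rewrite -Rintegral_itv_bndo_bndc//.
by rewrite -[LHS]opprK -cu opprB.
Unshelve. all: by end_near.
Qed.

End WeakFTC.

(** * Sums of nonnegative families *)

Section Sums.
Context {R : realType} {J : choiceType}.
Implicit Types (f g : J -> R) (A : {fset J}).

Definition summable_ge0 f : Prop :=
  (forall j, 0 <= f j) /\ (\esum_(j in [set: J]) (f j)%:E < +oo)%E.

(** [fine] sends a divergent sum to 0, so the value is meaningful only together with
    [summable_ge0]. *)
Definition tsum f : R := fine (\esum_(j in [set: J]) (f j)%:E).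

Lemma esum_tsum f : summable_ge0 f -> (\esum_(j in [set: J]) (f j)%:E)%E = (tsum f)%:E.
Proof.
move=> [f0 fb]; rewrite fineK// ge0_fin_numE//.
by apply: esum_ge0 => j _; rewrite lee_fin.
Qed.

Lemma tsum_ge0 f : (forall j, 0 <= f j) -> 0 <= tsum f.
Proof. by move=> f0; rewrite fine_ge0// esum_ge0// => j _; rewrite lee_fin. Qed.

Lemma fsum_le_tsum f A : summable_ge0 f -> \sum_(j <- A) f j <= tsum f.
Proof.
move=> sf; rewrite -lee_fin -esum_tsum// -sumEFin.
apply: esum_ge; exists [set` A]; first by split => //; exact: finite_fset.
by rewrite fsbig_finite//= set_fsetK.
Qed.

Lemma tsum_bound f (C : R) : (forall j, 0 <= f j) ->
  (forall A, \sum_(j <- A) f j <= C) -> summable_ge0 f /\ tsum f <= C.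
Proof.
move=> f0 fC.
have h : (\esum_(j in [set: J]) (f j)%:E <= C%:E)%E.
  apply: ge_ereal_sup => _ [X [finX _] <-].
  by rewrite fsbig_finite//= sumEFin lee_fin.
have sf : summable_ge0 f by split=> //; apply: le_lt_trans h _; rewrite ltry.
by split=> //; rewrite -lee_fin -esum_tsum.
Qed.

Lemma le_tsum f g : (forall j, 0 <= f j <= g j) -> summable_ge0 g ->
  summable_ge0 f /\ tsum f <= tsum g.
Proof.
move=> fg sg; apply: tsum_bound; first by move=> j; case/andP: (fg j).
move=> A; apply: le_trans (fsum_le_tsum A sg).
by apply: ler_sum => j _; case/andP: (fg j).
Qed.

Lemma tsumD f g : summable_ge0 f -> summable_ge0 g ->
  summable_ge0 (fun j => f j + g j) /\ tsum (fun j => f j + g j) = tsum f + tsum g.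
Proof.
move=> sf sg; have [f0 fb] := sf; have [g0 gb] := sg.
have e : (\esum_(j in [set: J]) (f j + g j)%:E = (tsum f + tsum g)%:E)%E.
  under eq_esum do rewrite EFinD.
  by rewrite esumD ?(esum_tsum sf) ?(esum_tsum sg)// => j _; rewrite lee_fin.
split; last by rewrite /tsum e.
by split; [move=> j; exact: addr_ge0|rewrite e ltry].
Qed.

Lemma tsumZ (c : R) f : 0 <= c -> summable_ge0 f ->
  summable_ge0 (fun j => c * f j) /\ tsum (fun j => c * f j) = c * tsum f.
Proof.
move=> c0 sf; have [f0 _] := sf.
have [sZ hZ] : summable_ge0 (fun j => c * f j) /\ tsum (fun j => c * f j) <= c * tsum f.
  apply: tsum_bound => [j|A]; first exact: mulr_ge0.
  by rewrite -mulr_sumr ler_wpM2l// fsum_le_tsum.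
split=> //; apply/eqP; rewrite eq_le hZ/=.
have [->|cN0] := eqVneq c 0.
  by rewrite mul0r tsum_ge0// => j; rewrite mul0r.
have {}c0 : 0 < c by rewrite lt_def cN0.
rewrite -ler_pdivlMl//; apply: (tsum_bound f0 _).2 => A.
by rewrite ler_pdivlMl// mulr_sumr fsum_le_tsum.
Qed.

Definition fset_out A f : J -> R := fun j => if j \in A then 0 else f j.

Lemma tsum_split A f : summable_ge0 f -> summable_ge0 (fset_out A f) /\
  tsum f = \sum_(j <- A) f j + tsum (fset_out A f).
Proof.
move=> sf; have [f0 _] := sf.
have oA j : 0 <= fset_out A f j <= f j.
  by rewrite /fset_out; case: ifP; rewrite ?lexx ?f0.
have [sA hA] := le_tsum oA sf; split => //.
have i0 j : 0 <= (if j \in A then f j else 0) <= f j.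
  by case: ifP; rewrite ?lexx ?f0.
have [sI hI] := le_tsum i0 sf.
have := (tsumD sI sA).2; rewrite (_ : (fun _ => _) = f); last first.
  by apply/funext => j; rewrite /fset_out; case: ifP; rewrite ?addr0 ?add0r.
move=> ->; congr (_ + _); apply/eqP; rewrite eq_le; apply/andP; split.
  apply: (tsum_bound _ _).2 => [j|B]; first by case/andP: (i0 j).
  rewrite -big_mkcond/= -big_filter -[leRHS]big_filter.
  rewrite [leRHS](bigID (mem B))/=.
  rewrite [X in _ <= X + _](_ : _ = \sum_(i <- [seq i <- B | i \in A]) f i).
    by rewrite lerDl sumr_ge0.
  rewrite -[LHS]big_filter; apply: perm_big; apply: uniq_perm.
  - by rewrite !filter_uniq ?fset_uniq.
  - by rewrite filter_uniq ?fset_uniq.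
  - by move=> j; rewrite !mem_filter/= andbC.
rewrite -[X in X <= _](_ : \sum_(j <- A) (if j \in A then f j else 0) = _).
  exact: fsum_le_tsum.
by rewrite big_seq_cond [RHS]big_seq_cond; apply: eq_bigr => j; rewrite andbT => ->.
Qed.

(** If every tail exceeded e, all finite sums would be at most [tsum f - e], and so would their
    supremum [tsum f]. *)
Lemma tsum_tail f (e : R) : summable_ge0 f -> 0 < e ->
  exists A, tsum (fset_out A f) <= e.
Proof.
move=> sf e0; apply: contrapT => /forallNP h.
have [f0 _] := sf.
suff : tsum f <= tsum f - e by rewrite leNgt ltrBlDr ltrDl e0.
apply: (tsum_bound f0 _).2 => A.
rewrite (tsum_split A sf).2 -addrA lerDl subr_ge0 ltW// ltNge; exact/negP.
Qed.

Lemma fset_out_le A f j : 0 <= f j -> 0 <= fset_out A f j <= f j.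
Proof. by rewrite /fset_out; case: ifP; rewrite ?lexx// => _ ->. Qed.

Lemma tsum_fin A f : (forall j, 0 <= f j) -> (forall j, j \notin A -> f j = 0) ->
  summable_ge0 f /\ tsum f = \sum_(j <- A) f j.
Proof.
move=> f0 fA.
have sf : summable_ge0 f.
  apply: (@tsum_bound f (\sum_(j <- A) f j) f0 _).1 => B.
  rewrite (bigID (mem A))/= [X in _ + X]big1 ?addr0; last by move=> j /fA.
  rewrite [leRHS](bigID (mem B))/=.
  rewrite [X in _ <= X + _](_ : _ = \sum_(i <- B | i \in A) f i).
    by rewrite lerDl sumr_ge0.
  rewrite -big_filter -[RHS]big_filter; apply: perm_big; apply: uniq_perm.
  - by rewrite !filter_uniq ?fset_uniq.
  - by rewrite filter_uniq ?fset_uniq.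
  - by move=> j; rewrite !mem_filter/= andbC.
split=> //; rewrite (tsum_split A sf).2 [X in _ + X](_ : _ = 0) ?addr0//.
rewrite /tsum esum1// => j _; rewrite /fset_out; case: ifPn => // /fA ->//.
Qed.

End Sums.

Lemma tsum_reindex (R : realType) (J K : choiceType) (s : K -> J) (f : J -> R) :
  set_bij setT setT s -> summable_ge0 f ->
  summable_ge0 (f \o s) /\ tsum (f \o s) = tsum f.
Proof.
move=> bs [f0 fb].
have e : (\esum_(j in [set: J]) (f j)%:E = \esum_(k in [set: K]) ((f \o s) k)%:E)%E.
  exact: (reindex_esum setT setT s).
by split; [split; [by move=> k; exact: f0|rewrite -e]|rewrite /tsum -e].
Qed.

(* Fatou-type splitting: the cross terms between a fixed summable family and
   families tending to [0] pointwise are negligible. *)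
Lemma tsum_brezis_lieb (R : realType) (J : choiceType) (T : Type)
    (U : set_system T) (a : J -> R) (b c : T -> J -> R) (C e : R) :
  ProperFilter U -> summable_ge0 a ->
  (forall n, summable_ge0 (b n)) -> (forall n, tsum (b n) <= C) ->
  (forall n, summable_ge0 (c n)) ->
  (forall t n j, 0 < t -> t < 1 -> (1 - t) * b n j <= c n j + (t^-1 - 1) * a j) ->
  (forall j, c n j @[n --> U] --> a j) -> (forall j, b n j @[n --> U] --> (0 : R)) ->
  0 < e -> \forall n \near U, tsum a + tsum (b n) <= tsum (c n) + e.
Proof.
move=> PU sa sb bC sc young ca b0 e0.
pose C' := Num.max C 0 + 1.
have C'0 : 0 < C' by rewrite ltr_wpDl// le_max lexx orbT.
have bC' n : tsum (b n) <= C'.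
  by apply: le_trans (bC n) _; rewrite /C' ler_wpDr// le_max lexx.
(* The Young inequality loses [t * tsum (b n)]; this choice makes the loss at most e/4 uniformly in
   n, thanks to the common bound on the sums. *)
pose t := Num.min (2^-1) (e / 4 / C').
have t0 : 0 < t by rewrite lt_min invr_gt0 ltr0n !divr_gt0.
have t1 : t < 1 by rewrite gt_min invf_lt1 ?ltr1n.
have tC : t * C' <= e / 4 by rewrite -ler_pdivlMr// ge_min lexx orbT.
(* The tail of [a] will be divided by [t], hence the tolerance t e/4. *)
have [A hA] := tsum_tail sa (mulr_gt0 t0 (divr_gt0 e0 (ltr0n _ 4))).
pose N : R := (size A)%:R + 1.
have N0 : 0 < N by rewrite ltr_wpDl.
pose d := e / 8 / N.
have d0 : 0 < d by rewrite !divr_gt0.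
(* On the finite set [A] pointwise convergence decides, with total error at most 2 d |A| <= e/4; off
   [A] the hypothesis of Young type does. *)
have : \forall n \near U, forall j, j \in A -> a j + b n j <= c n j + 2 * d.
  apply: (@filter_bigI _ _ A (fun j => [set n | a j + b n j <= c n j + 2 * d])
    U) => j jA.
  have /cvgrPdist_le/(_ _ d0) h1 := ca j.
  have /cvgrPdist_le/(_ _ d0) h2 := b0 j.
  near=> n => /=.
  have g1 : `|a j - c n j| <= d by near: n.
  have g2 : `|0 - b n j| <= d by near: n.
  move: g1 g2; rewrite !ler_norml => /andP[? ?] /andP[? ?]; lra.
apply: filterS => n hn.
rewrite (tsum_split A sa).2 (tsum_split A (sb n)).2 (tsum_split A (sc n)).2.
have H1 : \sum_(j <- A) a j + \sum_(j <- A) b n j <= \sum_(j <- A) c n j + e / 4.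
  rewrite -big_split/=.
  apply: (@le_trans _ _ (\sum_(j <- A) (c n j + 2 * d))).
    by rewrite big_seq [leRHS]big_seq; apply: ler_sum => j; exact: hn.
  rewrite big_split/= lerD2l big_const_seq count_predT iter_addr_0 -mulr_natr.
  rewrite /d /N; set m := (size A)%:R : R.
  have m0 : 0 <= m by [].
  rewrite [leLHS](_ : _ = e / 4 * (m / (m + 1))); last by field; rewrite gt_eqF// ltr_wpDl.
  by rewrite ler_piMr ?divr_ge0 ?(ltW e0)// ler_pdivrMr ?ltr_wpDl// mul1r lerDl.
have [sa' _] := tsum_split A sa; have [sb' _] := tsum_split A (sb n).
have [sc' _] := tsum_split A (sc n).
have tt : 0 <= t^-1 - 1 by rewrite subr_ge0 invf_ge1// ltW.
have [sza ea] := tsumZ tt sa'; have [szb eb] := tsumZ (ltW t0) sb'.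
have [s1 e1] := tsumD sc' sza; have [s2 e2] := tsumD s1 szb.
have H2 : tsum (fset_out A (b n)) <= tsum (fset_out A (c n)) +
    (t^-1 - 1) * tsum (fset_out A a) + t * tsum (fset_out A (b n)).
  rewrite -ea -eb -e1 -e2; apply: (le_tsum _ s2).2 => j.
  rewrite /fset_out; case: ifP => _; first by rewrite !mulr0 !addr0 lexx.
  have [b0' _] := sb n; rewrite b0'/=.
  have := young t n j t0 t1; rewrite mulrBl mul1r lerBlDr => h.
  lra.
have H3 : tsum (fset_out A (b n)) <= C'.
  apply: le_trans (bC' n); apply: (le_tsum _ (sb n)).2 => j.
  by apply: fset_out_le; have [] := sb n.
have H4 : t^-1 * tsum (fset_out A a) <= e / 4 by rewrite ler_pdivrMl.
have H5 : t * tsum (fset_out A (b n)) <= e / 4.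
  by apply: le_trans tC; rewrite ler_wpM2l// ltW.
rewrite mulrBl mul1r in H2.
lra.
Unshelve. all: by end_near.
Qed.

(** * Dyadic energies and Hölder continuity *)

Lemma sum_pairs (V : nmodType) (F : nat -> V) (n : nat) :
  \sum_(0 <= i < n.*2) F i = \sum_(0 <= i < n) (F i.*2 + F i.*2.+1).
Proof.
elim: n => [|n IHn]; first by rewrite !big_nil.
by rewrite doubleS 2?big_nat_recr//= big_nat_recr//= IHn addrA.
Qed.

Lemma sqr_sum_le (R : realFieldType) (a : nat -> R) (n : nat) :
  (\sum_(0 <= i < n) a i) ^+ 2 <= n%:R * \sum_(0 <= i < n) a i ^+ 2.
Proof.
elim: n => [|n IHn]; first by rewrite !big_nil expr0n mulr0.
rewrite !big_nat_recr//=; move: IHn.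
set S := \sum_(0 <= i < n) a i; set Q := \sum_(0 <= i < n) a i ^+ 2.
have Q0 : 0 <= Q by apply: sumr_ge0 => i _; rewrite sqr_ge0.
case: n @S @Q Q0 => [|n] S Q Q0 h.
  have -> : S = 0 by rewrite /S big_nil.
  by rewrite add0r mul1r lerDr.
have n0 : (0 : R) < n.+1%:R by rewrite ltr0n.
rewrite -natr1; set N := n.+1%:R in h n0 *.
have : 2 * S * a n.+1 <= Q + N * a n.+1 ^+ 2.
  rewrite -(ler_pM2l n0).
  have := sqr_ge0 (S - N * a n.+1); nra.
nra.
Qed.

Section Dyadic.
Context {R : realType}.
Implicit Types (l : R) (f g : R -> R) (k i j : nat).

Definition dyadic l k i : R := l * i%:R / 2 ^+ k.

(** This is the integral of the squared derivative of the piecewise affine interpolant of [f] with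
    mesh l / 2^k. *)
Definition dyadic_energy l k f : R :=
  \sum_(0 <= i < 2 ^ k)
    (f (dyadic l k i.+1) - f (dyadic l k i)) ^+ 2 * (2 ^+ k / l).

(* The increment of [dyadic_energy] from one dyadic level to the next. *)
Definition dyadic_incr l k f : R :=
  if k is k'.+1 then
    \sum_(0 <= i < 2 ^ k')
      (2 * f (dyadic l k'.+1 i.*2.+1) - f (dyadic l k' i) -
       f (dyadic l k' i.+1)) ^+ 2 * (2 ^+ k' / l)
  else (f l - f 0) ^+ 2 / l.

Lemma dyadic0 l k : dyadic l k 0 = 0.
Proof. by rewrite /dyadic mulr0 mul0r. Qed.

Lemma dyadic_max l k : dyadic l k (2 ^ k) = l.
Proof. by rewrite /dyadic natrX mulfK// expf_neq0// pnatr_eq0. Qed.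

Lemma dyadic_double l k i : dyadic l k.+1 i.*2 = dyadic l k i.
Proof.
rewrite /dyadic -muln2 natrM exprS; field.
by rewrite expf_neq0// pnatr_eq0.
Qed.

Lemma dyadicS l k i : dyadic l k i.+1 = dyadic l k i + l / 2 ^+ k.
Proof. by rewrite /dyadic -natr1; ring. Qed.

Lemma le_dyadic l k i j : 0 <= l -> (i <= j)%N -> dyadic l k i <= dyadic l k j.
Proof.
move=> l0 ij; rewrite /dyadic ler_wpM2r ?invr_ge0 ?exprn_ge0//.
by rewrite ler_wpM2l// ler_nat.
Qed.

Lemma dyadic_bounds l k i : 0 <= l -> (i <= 2 ^ k)%N -> 0 <= dyadic l k i <= l.
Proof.
move=> l0 ik; rewrite -{1}(dyadic0 l k) le_dyadic//=.
by rewrite -[leRHS](dyadic_max l k) le_dyadic.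
Qed.

Lemma dyadic_incr_ge0 l k f : 0 < l -> 0 <= dyadic_incr l k f.
Proof.
move=> l0; case: k => [|k] /=; first by rewrite mulr_ge0 ?sqr_ge0 ?invr_ge0 ?ltW.
by apply: sumr_ge0 => i _; rewrite mulr_ge0 ?sqr_ge0// divr_ge0 ?exprn_ge0// ltW.
Qed.

(** Parallelogram law on each cell: with x and y the increments of [f] over the two halves, 2 x^2 +
    2 y^2 - (x + y)^2 = (x - y)^2, and x - y is the second difference at the midpoint. Hence the
    energy grows with k by squares of linear functionals. *)
Lemma dyadic_energyE l k f : 0 < l ->
  dyadic_energy l k f = \sum_(0 <= j < k.+1) dyadic_incr l j f.
Proof.
move=> l0; elim: k => [|k IHk].
  by rewrite big_nat1 /dyadic_energy big_nat1 dyadic0 -{1}(expn0 2) dyadic_max expr0 mul1r.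
rewrite big_nat_recr//= -IHk /dyadic_energy expnS mul2n sum_pairs -big_split/=.
apply: eq_bigr => i _; rewrite -doubleS !dyadic_double (exprS (2 : R)); field.
by rewrite gt_eqF.
Qed.

Lemma dyadic_incrZ l k (c : R) f :
  dyadic_incr l k (fun x => c * f x) = c ^+ 2 * dyadic_incr l k f.
Proof.
case: k => [|k] /=; first by ring.
by rewrite mulr_sumr; apply: eq_bigr => i _; ring.
Qed.

(** The difference of the two sides is the square t^-1 (x + t y)^2. Summed or integrated, this is
    the hypothesis of the splitting lemma. *)
Lemma young_sqr (t x y : R) : 0 < t ->
  (1 - t) * y ^+ 2 <= (x + y) ^+ 2 + (t^-1 - 1) * x ^+ 2.
Proof.
move=> t0; rewrite -subr_ge0.
rewrite [leRHS](_ : _ = t^-1 * (x + t * y) ^+ 2); last by field; rewrite gt_eqF.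
by rewrite mulr_ge0 ?sqr_ge0// invr_ge0 ltW.
Qed.

Lemma young_sqrZ (t c x y z : R) : 0 < t -> 0 <= c -> z = x + y ->
  (1 - t) * (y ^+ 2 * c) <= z ^+ 2 * c + (t^-1 - 1) * (x ^+ 2 * c).
Proof.
move=> t0 c0 ->; rewrite [leLHS]mulrA [X in _ <= _ + X]mulrA -mulrDl.
by apply: ler_wpM2r => //; exact: young_sqr.
Qed.

Lemma dyadic_incr_young l k (t : R) f g : 0 < l -> 0 < t ->
  (1 - t) * dyadic_incr l k g <=
  dyadic_incr l k (fun x => f x + g x) + (t^-1 - 1) * dyadic_incr l k f.
Proof.
move=> l0 t0; case: k => [|k] /=.
  by apply: young_sqrZ; rewrite ?invr_ge0 ?ltW//; ring.
rewrite 2!mulr_sumr -big_split/=; apply: ler_sum => i _.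
by apply: young_sqrZ => //; [rewrite divr_ge0 ?exprn_ge0// ltW|ring].
Qed.

Lemma dyadic_incr_cvg l k (T : Type) (U : set_system T) (F : T -> R -> R) f :
  Filter U -> (forall x, F n x @[n --> U] --> f x) ->
  dyadic_incr l k (F n) @[n --> U] --> dyadic_incr l k f.
Proof.
move=> FU cv; have cs (G : T -> R) (x c : R) : G n @[n --> U] --> x ->
    G n ^+ 2 * c @[n --> U] --> x ^+ 2 * c.
  by move=> h; apply: cvgM; [apply: cvgM|exact: cvg_cst].
case: k => [|k]; first by apply: cs; apply: cvgB.
apply: cvg_big => [|i _]; first exact: add_continuous.
by apply: cs; apply: cvgB => //; apply: cvgB => //; apply: cvgM => //; exact: cvg_cst.
Qed.

Lemma eq_dyadic_incr l k f g : 0 < l ->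
  (forall x : R, 0 <= x <= l -> f x = g x) -> dyadic_incr l k f = dyadic_incr l k g.
Proof.
move=> l0 fg; case: k => [|k] /=.
  by rewrite !fg ?lexx ?ltW.
rewrite !big_mkord; apply: eq_bigr => i _.
rewrite !fg ?dyadic_bounds// ?ltW//; first by rewrite ltnW.
by rewrite expnS mul2n; have := ltn_ord i; lia.
Qed.

(** Hölder continuity of exponent 1/2 on the edge, squared, so that [C] can be a kinetic energy and
    no square root appears. *)
Definition hoelder_half l (C : R) f := forall x y : R,
  0 <= x <= l -> 0 <= y <= l -> (f x - f y) ^+ 2 <= C * `|x - y|.

(** Cauchy-Schwarz over the j - i cells between the two points; the remaining cells only add
    nonnegative energy. *)
Lemma dyadic_energy_chord l k (C : R) f i j : 0 < l -> dyadic_energy l k f <= C ->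
  (i <= j <= 2 ^ k)%N ->
  (f (dyadic l k j) - f (dyadic l k i)) ^+ 2 <= C * (dyadic l k j - dyadic l k i).
Proof.
move=> l0 hC /andP[ij jk].
have -> : f (dyadic l k j) - f (dyadic l k i) =
    \sum_(0 <= m < j - i) (f (dyadic l k (m + i).+1) - f (dyadic l k (m + i))).
  rewrite -(@telescope_sumr _ i j (f \o dyadic l k))//.
  by rewrite -{1}(add0n i) big_addn.
apply: le_trans (sqr_sum_le _ _) _.
have -> : dyadic l k j - dyadic l k i = (j - i)%:R * (l / 2 ^+ k).
  by rewrite natrB// /dyadic; ring.
rewrite mulrCA ler_wpM2l//.
have h0 : 0 < 2 ^+ k / l by rewrite divr_gt0// exprn_gt0.
rewrite -[l / _]invf_div ler_pdivlMr// mulr_suml.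
apply: le_trans hC; rewrite /dyadic_energy.
rewrite (@big_cat_nat _ _ _ i 0 (2 ^ k))//=; last exact: leq_trans jk.
rewrite (@big_cat_nat _ _ _ j i (2 ^ k))//=.
have -> (G : nat -> R) : \sum_(i <= m < j) G m = \sum_(0 <= m < j - i) G (m + i)%N.
  by rewrite -{1}(add0n i) big_addn.
have s0 a b : 0 <= \sum_(a <= m < b)
    (f (dyadic l k m.+1) - f (dyadic l k m)) ^+ 2 * (2 ^+ k / l).
  by apply: sumr_ge0 => m _; rewrite mulr_ge0 ?sqr_ge0// ltW.
rewrite addrCA lerDl addr_ge0//.
Qed.

Lemma geometric_half_cvg (c : R) : c / 2 ^+ k @[k --> \oo] --> 0.
Proof.
have -> : (fun k => c / 2 ^+ k) = geometric c (2^-1 : R).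
  by apply/funext => k; rewrite /geometric/= exprVn.
by apply: cvg_geometric; rewrite ger0_norm ?invr_ge0// invf_lt1 ?ltr1n.
Qed.

(** Approximation from below by truncation. At x = l the index is 2^k, one past the last cell, so
    the bound on the index is not strict. *)
Lemma dyadic_floor_cvg l (x : R) : 0 < l -> 0 <= x <= l -> exists i : nat -> nat,
  (forall k, (i k <= 2 ^ k)%N /\ dyadic l k (i k) <= x < dyadic l k (i k).+1) /\
  dyadic l k (i k) @[k --> \oo] --> x.
Proof.
move=> l0 /andP[x0 xl]; pose i k := Num.truncn (x * 2 ^+ k / l).
have y0 k : 0 <= x * 2 ^+ k / l by rewrite divr_ge0 ?mulr_ge0 ?exprn_ge0// ltW.
have h k : dyadic l k (i k) <= x < dyadic l k (i k).+1.
  have p0 : (0 : R) < 2 ^+ k by rewrite exprn_gt0.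
  have /andP[h1 h2] := truncn_itv (y0 k).
  rewrite /dyadic ler_pdivrMr// ltr_pdivlMr// ![l * _]mulrC.
  by rewrite -ler_pdivlMr// -ltr_pdivrMr// h1 h2.
exists i; split.
  move=> k; split=> //; rewrite -ltnS -(ltr_nat R).
  have /andP[h1 _] := truncn_itv (y0 k); apply: le_lt_trans h1 _.
  rewrite ltr_pdivrMr// -(@natr1 R (2 ^ k)%N) natrX mulrDl mul1r [_ * l]mulrC.
  apply: (@le_lt_trans _ _ (l * 2 ^+ k)); first by rewrite ler_wpM2r ?exprn_ge0.
  by rewrite ltrDl.
apply: (@squeeze_cvgr _ _ _ _ (fun k => x - l / 2 ^+ k) (fun=> x)).
- near=> k; have /andP[h1 h2] := h k; rewrite h1 andbT.
  by move: h2; rewrite dyadicS; lra.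
- rewrite -[X in _ --> X]subr0; apply: cvgB; [exact: cvg_cst|].
  exact: geometric_half_cvg.
- exact: cvg_cst.
Unshelve. all: by end_near.
Qed.

(** Discrete form of the embedding of H^1 into Hölder functions: the chord estimate between dyadic
    points passes to the limit by continuity. *)
Lemma dyadic_energy_hoelder l (C : R) f : 0 < l -> continuous f ->
  (forall k, dyadic_energy l k f <= C) -> hoelder_half l C f.
Proof.
move=> l0 cf hC x y.
wlog xy : x y / x <= y.
  move=> W hx hy; have [xy|/ltW yx] := leP x y; first exact: W.
  by rewrite -sqrrN opprB distrC; apply: W.
move=> hx hy; have [i [hi ci]] := dyadic_floor_cvg l0 hx.
have [j [hj cj]] := dyadic_floor_cvg l0 hy.
rewrite distrC ger0_norm ?subr_ge0// -sqrrN opprB.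
have cl : (f (dyadic l k (j k)) - f (dyadic l k (i k))) ^+ 2 @[k --> \oo] -->
    (f y - f x) ^+ 2.
  have cvf (u : nat -> R) z : u k @[k --> \oo] --> z -> f (u k) @[k --> \oo] --> f z.
    by move=> h; apply: continuous_cvg h; exact: cf.
  by apply: cvgM; apply: cvgB; exact: cvf.
have cr : C * (dyadic l k (j k) - dyadic l k (i k)) @[k --> \oo] --> C * (y - x).
  by apply: cvgM; [exact: cvg_cst|exact: cvgB].
apply: (ler_cvg_to cl cr); near=> k; apply: dyadic_energy_chord => //.
have [jk /andP[_ yj]] := hj k; have [_ /andP[ix _]] := hi k.
rewrite jk andbT -ltnS; have := le_lt_trans ix (le_lt_trans xy yj).
by rewrite ltNge; apply: contraNT; rewrite -leqNgt => ?; rewrite le_dyadic// ltW.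
Unshelve. all: by end_near.
Qed.

End Dyadic.

(** * Power inequalities *)

Section PowerInequalities.
Context {R : realType}.
Implicit Types (a b S p : R).

Lemma powR_split p a : 0 <= a -> 2 < p -> a `^ p = a `^ (p - 2) * a ^+ 2.
Proof.
move=> a0 p2; rewrite -powR_mulrn// -powRD; first by rewrite subrK.
by rewrite subrK; apply/implyP => /eqP p0; rewrite p0 ltNge ler0n in p2.
Qed.

Lemma le_powR p a b : 0 <= p -> 0 <= a -> a <= b -> a `^ p <= b `^ p.
Proof.
by move=> p0 a0 ab; apply: ge0_ler_powR; rewrite ?nnegrE// (le_trans a0).
Qed.

Lemma powR_le_sqr p a S : 2 < p -> 0 <= a -> a <= S -> a `^ p <= S `^ (p - 2) * a ^+ 2.
Proof.
move=> p2 a0 aS; rewrite powR_split// ler_wpM2r ?sqr_ge0//.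
by apply: le_powR => //; rewrite subr_ge0 ltW.
Qed.

(* For [b <= a], [(1 + b/a)^p <= (1 + b/a)^4 <= 1 + 15 b/a]. *)
Lemma powR_add_le p a b S : 2 < p -> p < 4 -> 0 <= a -> 0 <= b -> a <= S -> b <= S ->
  (a + b) `^ p <= a `^ p + b `^ p + 15 * S `^ (p - 2) * (a * b).
Proof.
move=> p2 p4; wlog ba : a b / b <= a.
  move=> W a0 b0 aS bS; have [ba|/ltW ab] := leP b a; first exact: W.
  by rewrite (addrC a) (addrC (a `^ p)) (mulrC a); apply: W.
move=> a0 b0 aS bS; have [->|aN0] := eqVneq a 0.
  rewrite add0r powR0 ?gt_eqF//; last by apply: lt_trans p2.
  by rewrite mul0r mulr0 addr0 add0r.
have a1 : 0 < a by rewrite lt_def aN0.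
have -> : a + b = a * (1 + b / a) by rewrite mulrDr mulr1 mulrCA divff// mulr1.
set s := b / a; have s0 : 0 <= s by rewrite divr_ge0.
have s1 : s <= 1 by rewrite ler_pdivrMr// mul1r.
rewrite powRM// ?addr_ge0//.
have h : (1 + s) `^ p <= 1 + 15 * s.
  apply: (@le_trans _ _ ((1 + s) `^ 4%:R)); first by apply: ler_powR; rewrite ?lerDl// ltW.
  rewrite powR_mulrn ?addr_ge0//.
  have s2 : s ^+ 2 <= s by rewrite expr2 ler_piMr.
  have s3 : s ^+ 3 <= s by rewrite exprS ler_piMr// expr_le1.
  have s4 : s ^+ 4 <= s by rewrite exprS ler_piMr// expr_le1.
  have -> : (1 + s) ^+ 4 = 1 + 4 * s + 6 * s ^+ 2 + 4 * s ^+ 3 + s ^+ 4 by ring.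
  lra.
apply: (@le_trans _ _ (a `^ p * (1 + 15 * s))); first by rewrite ler_wpM2l// powR_ge0.
rewrite mulrDr mulr1 -addrA lerD2l.
apply: (@le_trans _ _ (15 * S `^ (p - 2) * (a * b))); last by rewrite lerDr powR_ge0.
rewrite powR_split// (_ : _ * (15 * s) = 15 * a `^ (p - 2) * (a * b)); last first.
  by rewrite /s; field.
rewrite ler_wpM2r ?mulr_ge0// ler_wpM2l//.
by apply: le_powR => //; rewrite subr_ge0 ltW.
Qed.

End PowerInequalities.

(** * Mass and potential of one edge *)

Section EdgeIntegral.
Context {R : realType} (l : R) (l0 : 0 < l).
Notation mu := (@lebesgue_measure R).
Implicit Types (f g : R -> R).

Definition edge_int f : R := (\int[mu]_(x in `[0%R, l]) f x)%R.
Definition edge_integrable f := mu.-integrable `[0, l] (EFin \o f).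

Lemma edge_intD f g : edge_integrable f -> edge_integrable g ->
  edge_int (fun x => f x + g x) = edge_int f + edge_int g.
Proof. by move=> *; apply: RintegralD. Qed.

Lemma edge_intZ (c : R) f : edge_integrable f ->
  edge_int (fun x => c * f x) = c * edge_int f.
Proof. by move=> *; apply: RintegralZl. Qed.

Lemma le_edge_int f g : edge_integrable f -> edge_integrable g ->
  (forall x : R, 0 <= x <= l -> f x <= g x) -> edge_int f <= edge_int g.
Proof.
by move=> fi gi fg; apply: le_Rintegral => // x /=; rewrite in_itv/= => /fg.
Qed.

Lemma eq_edge_int f g :
  (forall x : R, 0 <= x <= l -> f x = g x) -> edge_int f = edge_int g.
Proof.
by move=> fg; apply: eq_Rintegral => x /[!inE]/=; rewrite in_itv/= => /fg.
Qed.

Lemma edge_int_ge0 f : (forall x : R, 0 <= x <= l -> 0 <= f x) -> 0 <= edge_int f.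
Proof. by move=> f0; apply: Rintegral_ge0 => x /=; rewrite in_itv/= => /f0. Qed.

Lemma edge_int_cst (c : R) : edge_int (fun=> c) = c * l.
Proof.
rewrite /edge_int Rintegral_cst//= lebesgue_measure_itv/= lte_fin l0.
by rewrite -EFinD/= oppr0 addr0.
Qed.

Lemma edge_integrableD f g : edge_integrable f -> edge_integrable g ->
  edge_integrable (fun x => f x + g x).
Proof.
move=> fi gi; rewrite /edge_integrable.
by rewrite (_ : EFin \o _ = (EFin \o f) \+ (EFin \o g))//; apply: integrableD.
Qed.

Lemma edge_integrableZ (c : R) f : edge_integrable f -> edge_integrable (fun x => c * f x).
Proof.
move=> fi; rewrite /edge_integrable.
by rewrite (_ : EFin \o _ = (fun x => c%:E * (EFin \o f) x)%E)//; apply: integrableZl.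
Qed.

Lemma edge_integrable_cont f : continuous f -> edge_integrable f.
Proof. exact: continuous_integrable. Qed.

Lemma continuous_sqr f : continuous f -> continuous (fun x => f x ^+ 2).
Proof. by move=> cf x; apply: cvgM; exact: cf. Qed.

Lemma continuous_norm f : continuous f -> continuous (fun x => `|f x|).
Proof. by move=> cf x; apply: cvg_norm; exact: cf. Qed.

Lemma continuousMr f g : continuous f -> continuous g -> continuous (fun x => f x * g x).
Proof. by move=> cf cg x; apply: cvgM; [exact: cf|exact: cg]. Qed.

Lemma continuousDr f g : continuous f -> continuous g -> continuous (fun x => f x + g x).
Proof. by move=> cf cg x; apply: cvgD; [exact: cf|exact: cg]. Qed.

Lemma continuousBr f g : continuous f -> continuous g -> continuous (fun x => f x - g x).
Proof. by move=> cf cg x; apply: cvgB; [exact: cf|exact: cg]. Qed.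

Lemma continuous_scale (c : R) f : continuous f -> continuous (fun x => c * f x).
Proof. by move=> cf x; apply: cvgM; [exact: cvg_cst|exact: cf]. Qed.

Lemma edge_bounded f : continuous f ->
  exists2 B : R, 0 <= B & forall x : R, 0 <= x <= l -> `|f x| <= B.
Proof.
move=> cf; have cn : {within `[0, l], continuous (fun x => `|f x|)}.
  by apply: continuous_subspaceT; exact: continuous_norm.
have [c _ hc] := EVT_max (ltW l0) cn.
by exists `|f c| => // x hx; apply: hc; rewrite in_itv.
Qed.

Lemma edge_integrable_pow f (p : R) : continuous f -> 0 <= p ->
  edge_integrable (fun x => `|f x| `^ p).
Proof.
move=> cf p0; apply: measurable_bounded_integrable => //=.
- by rewrite lebesgue_measure_itv/= lte_fin l0 -EFinB ltry.
- apply: measurable_funTS; apply: (measurableT_comp (measurable_powR p)).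
  by apply: continuous_measurable_fun; exact: continuous_norm.
- have [B B0 hB] := edge_bounded cf.
  exists (B `^ p); split; first exact: num_real.
  move=> r Br x /=; rewrite in_itv/= => hx.
  rewrite ger0_norm ?powR_ge0//; apply: le_trans (ltW Br).
  by apply: le_powR => //; exact: hB.
Qed.

Definition edge_mass f := edge_int (fun x => f x ^+ 2).
Definition edge_pot (p : R) f := edge_int (fun x => `|f x| `^ p).

Lemma edge_mass_ge0 f : 0 <= edge_mass f.
Proof. by apply: edge_int_ge0 => x _; exact: sqr_ge0. Qed.

Lemma edge_pot_ge0 p f : 0 <= edge_pot p f.
Proof. by apply: edge_int_ge0 => x _; exact: powR_ge0. Qed.

Lemma edge_massZ (c : R) f : continuous f ->
  edge_mass (fun x => c * f x) = c ^+ 2 * edge_mass f.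
Proof.
move=> cf; rewrite -edge_intZ; last exact/edge_integrable_cont/continuous_sqr.
by apply: eq_edge_int => x _; rewrite exprMn.
Qed.

Lemma edge_potZ p (c : R) f : continuous f -> 0 <= p ->
  edge_pot p (fun x => c * f x) = `|c| `^ p * edge_pot p f.
Proof.
move=> cf p0; rewrite -edge_intZ; last exact: edge_integrable_pow.
by apply: eq_edge_int => x _; rewrite normrM powRM.
Qed.

Lemma edge_mass_young (t : R) f g : 0 < t -> continuous f -> continuous g ->
  (1 - t) * edge_mass g <= edge_mass (fun x => f x + g x) + (t^-1 - 1) * edge_mass f.
Proof.
move=> t0 cf cg.
have sf := edge_integrable_cont (continuous_sqr cf).
have sg := edge_integrable_cont (continuous_sqr cg).
have sfg := edge_integrable_cont (continuous_sqr (continuousDr cf cg)).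
rewrite /edge_mass -!edge_intZ// -edge_intD//; last exact: edge_integrableZ.
apply: le_edge_int; [exact: edge_integrableZ| |move=> x _; exact: young_sqr].
by apply: edge_integrableD => //; exact: edge_integrableZ.
Qed.

Lemma edge_pot_le p f (S : R) : 2 < p -> continuous f ->
  (forall x : R, 0 <= x <= l -> `|f x| <= S) ->
  edge_pot p f <= S `^ (p - 2) * edge_mass f.
Proof.
move=> p2 cf fS; rewrite -edge_intZ; last exact/edge_integrable_cont/continuous_sqr.
apply: le_edge_int.
- by apply: edge_integrable_pow => //; apply: le_trans (ltW p2).
- exact/edge_integrableZ/edge_integrable_cont/continuous_sqr.
- move=> x hx; rewrite -[f x ^+ 2]real_normK ?num_real//.
  by apply: powR_le_sqr => //; exact: fS.
Qed.

(** Average over y, in a window of length t around x, the inequality f(x)^2 <= 2 f(y)^2 + 2 (f(x) -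
    f(y))^2. The free length t trades mass against kinetic energy and plays the role of the
    interpolation in Gagliardo-Nirenberg. *)
Lemma edge_sup_bound f (C t x : R) : continuous f -> hoelder_half l C f ->
  0 < t -> t <= l -> 0 <= x <= l ->
  f x ^+ 2 <= 2 / t * edge_mass f + 2 * t * C.
Proof.
move=> cf hC t0 tl /andP[x0 xl].
have hx : 0 <= x <= l by rewrite x0.
(* Left end of the window: it starts at x unless it would leave [0, l], in which case it is pushed
   back against l. *)
pose c := if x + t <= l then x else l - t.
have [c0 [ct [cx xc]]] : 0 <= c /\ c + t <= l /\ c <= x /\ x <= c + t.
  rewrite /c; case: (leP (x + t) l) => h.
    by split; [lra|split; [lra|split; lra]].
  by split; [lra|split; [lra|split; lra]].
have C0 : 0 <= C.
  have := hC 0 l; rewrite !lexx ltW// => /(_ isT isT).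
  rewrite sub0r normrN (gtr0_norm l0) => /(le_trans (sqr_ge0 _)).
  by rewrite pmulr_lge0.
have sq := continuous_sqr cf.
have h : t * f x ^+ 2 <= 2 * edge_mass f + 2 * t * C * t.
  have -> : t * f x ^+ 2 = (\int[mu]_(y in `[c, (c + t)%R]) (f x ^+ 2))%R.
    rewrite Rintegral_cst//= lebesgue_measure_itv/= lte_fin ltrDl t0/=.
    by rewrite mulrC; congr (_ * _); ring.
  apply: (@le_trans _ _ (\int[mu]_(y in `[c, (c + t)%R]) (2 * f y ^+ 2 + 2 * t * C))%R).
    apply: le_Rintegral => //.
    - by apply: continuous_integrable; exact: cst_continuous.
    - apply: continuous_integrable; apply: continuousDr; last exact: cst_continuous.
      exact: continuous_scale.
    - move=> y /=; rewrite in_itv/= => /andP[cy yc].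
      have /hC : 0 <= x <= l by [].
      have hy : 0 <= y <= l by apply/andP; split; lra.
      move=> /(_ y hy) hxy.
      have : C * `|x - y| <= t * C.
        by rewrite mulrC ler_wpM2r// ler_norml; apply/andP; split; lra.
      have := sqr_ge0 (f x - 2 * f y); nra.
  rewrite RintegralD//; last 2 first.
  - by apply: continuous_integrable; exact: continuous_scale.
  - by apply: continuous_integrable; exact: cst_continuous.
  rewrite RintegralZl//; last exact: continuous_integrable.
  rewrite Rintegral_cst//= lebesgue_measure_itv/= lte_fin ltrDl t0/=.
  rewrite [X in _ * _ + _ * X <= _](_ : _ = t); last by ring.
  rewrite lerD2r ler_wpM2l// /edge_mass /edge_int /Rintegral fine_le//.
  - by apply: integrable_fin_num => //; exact: continuous_integrable.
  - by apply: integrable_fin_num => //; exact: continuous_integrable.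
  - apply: ge0_subset_integral => //=.
    + apply/measurable_EFinP; apply: measurable_funTS.
      exact: continuous_measurable_fun.
    + by move=> y _; rewrite lee_fin sqr_ge0.
    + move=> y /=; rewrite !in_itv/= => /andP[cy yc].
      by apply/andP; split; lra.
rewrite -(ler_pM2l t0); apply: le_trans h _.
by rewrite le_eqVlt; apply/orP; left; apply/eqP; field; rewrite gt_eqF.
Qed.

End EdgeIntegral.

(** * Admissible functions, coercivity and nonvanishing *)

Section Admissible.
Context {R : realType} (l p : R) (l0 : 0 < l) (p2 : 2 < p).
Implicit Types (v w : edge -> R -> R) (e : edge).

Let p0 : 0 <= p. Proof. by apply: le_trans (ltW p2). Qed.
Let ppos : 0 < p. Proof. by apply: lt_trans p2. Qed.

Definition vertex_compatible v :=
  exists w : vertex -> R, forall e, v e 0 = w (source e) /\ v e l = w (target e).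

Definition mass_family v e := edge_mass l (v e).
Definition pot_family v e := edge_pot l p (v e).
(* The kinetic energy of an edge is the sum over [k] of its dyadic increments
   (the supremum of the dyadic energies); no derivative is involved, and each
   term is continuous for pointwise convergence. *)
Definition kin_family v (q : edge * nat) := dyadic_incr l q.2 (v q.1).

(** Continuity is required on the whole line although only [0, l] matters; it is achieved by
    composing with the projection onto [0, l], and it spares continuity relative to a subset in all
    the integrals. *)
Definition admissible v := [/\ forall e, continuous (v e), vertex_compatible v,
  summable_ge0 (mass_family v) & summable_ge0 (kin_family v)].

Definition gmass v := tsum (mass_family v).
Definition gpot v := tsum (pot_family v).
Definition gkin v := tsum (kin_family v).
Definition renergy v := gkin v / 2 - gpot v / p.

Lemma gmass_ge0 v : 0 <= gmass v.
Proof. by apply: tsum_ge0 => e; exact: edge_mass_ge0. Qed.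

Lemma gkin_ge0 v : 0 <= gkin v.
Proof. by apply: tsum_ge0 => q; exact: dyadic_incr_ge0. Qed.

Lemma gpot_ge0 v : 0 <= gpot v.
Proof. by apply: tsum_ge0 => e; exact: edge_pot_ge0. Qed.

Lemma edge_mass_le_gmass v e : admissible v -> edge_mass l (v e) <= gmass v.
Proof.
move=> [_ _ sm _]; have := fsum_le_tsum [fset e]%fset sm.
by rewrite big_seq_fset1.
Qed.

Lemma dyadic_energy_le_gkin v e k : admissible v -> dyadic_energy l k (v e) <= gkin v.
Proof.
move=> [_ _ _ sk]; rewrite dyadic_energyE//.
have := fsum_le_tsum [fset (e, val j) | j in 'I_k.+1]%fset sk.
rewrite big_imfset/=; last by move=> i j _ _ [] /val_inj.
by rewrite big_enum/= big_mkord.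
Qed.

Lemma adm_hoelder v e : admissible v -> hoelder_half l (gkin v) (v e).
Proof.
move=> av; apply: dyadic_energy_hoelder => //; first by case: av.
by move=> k; exact: dyadic_energy_le_gkin.
Qed.

Lemma adm_sup v e (t x : R) : admissible v -> 0 < t -> t <= l -> 0 <= x <= l ->
  v e x ^+ 2 <= 2 / t * edge_mass l (v e) + 2 * t * gkin v.
Proof.
move=> av; apply: edge_sup_bound => //; first by case: av.
exact: adm_hoelder.
Qed.

Lemma adm_bounded v : admissible v ->
  exists2 B : R, 0 <= B & forall e (x : R), 0 <= x <= l -> `|v e x| <= B.
Proof.
move=> av; exists (Num.sqrt (2 / l * gmass v + 2 * l * gkin v)) => [|e x hx].
  exact: sqrtr_ge0.
rewrite -sqrtr_sqr ler_sqrt; last first.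
  by rewrite addr_ge0// mulr_ge0 ?gmass_ge0 ?gkin_ge0 ?divr_ge0 ?mulr_ge0 ?ltW.
apply: le_trans (adm_sup e av l0 (lexx l) hx) _; rewrite lerD2r ler_wpM2l//.
  by rewrite divr_ge0// ltW.
exact: edge_mass_le_gmass.
Qed.

Lemma gpot_bound v (S : R) : admissible v ->
  (forall e (x : R), 0 <= x <= l -> `|v e x| <= S) ->
  summable_ge0 (pot_family v) /\ gpot v <= S `^ (p - 2) * gmass v.
Proof.
move=> [cv _ sm _] hS.
have [sZ eZ] := tsumZ (powR_ge0 S (p - 2)) sm.
rewrite -[X in _ /\ _ <= X]eZ; apply: le_tsum sZ => e.
by rewrite edge_pot_ge0/=; apply: edge_pot_le => //; exact: hS.
Qed.

Lemma adm_pot v : admissible v -> summable_ge0 (pot_family v).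
Proof.
by move=> av; have [B _ hB] := adm_bounded av; have [] := gpot_bound av hB.
Qed.

Lemma admZ (c : R) v : admissible v -> [/\ admissible (fun e x => c * v e x),
  gmass (fun e x => c * v e x) = c ^+ 2 * gmass v,
  gkin (fun e x => c * v e x) = c ^+ 2 * gkin v &
  gpot (fun e x => c * v e x) = `|c| `^ p * gpot v].
Proof.
move=> av; have [cv [w hw] sm sk] := av.
have [s1 e1] := tsumZ (sqr_ge0 c) sm; have [s2 e2] := tsumZ (sqr_ge0 c) sk.
have [s3 e3] := tsumZ (powR_ge0 `|c| p) (adm_pot av).
have m1 : mass_family (fun e x => c * v e x) = fun e => c ^+ 2 * mass_family v e.
  by apply/funext => e; rewrite /mass_family edge_massZ.
have m2 : kin_family (fun e x => c * v e x) = fun q => c ^+ 2 * kin_family v q.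
  by apply/funext => q; rewrite /kin_family dyadic_incrZ.
have m3 : pot_family (fun e x => c * v e x) = fun e => `|c| `^ p * pot_family v e.
  by apply/funext => e; rewrite /pot_family edge_potZ.
split; rewrite /gmass /gkin /gpot ?m1 ?m2 ?m3//.
split; rewrite ?m1 ?m2//; first by move=> e; exact: continuous_scale.
by exists (fun z => c * w z) => e; have [-> ->] := hw e.
Qed.

(** Young's inequality with t = 1/2 is applied to -v and v + w, whose sum is w: each term of v + w
    is at most twice that of -v plus twice that of w. *)
Lemma admD v w : admissible v -> admissible w -> admissible (fun e x => v e x + w e x).
Proof.
move=> av aw; have [cv [f hf] smv skv] := av; have [cw [g hg] smw skw] := aw.
have [an _ _ _] := admZ (-1) av; have [cn _ smn skn] := an.
have h12 : (0 : R) < 2^-1 by rewrite invr_gt0.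
have n2 : (0 : R) <= 2 by [].
split.
- by move=> e; exact: continuousDr.
- by exists (fun z => f z + g z) => e; have [-> ->] := hf e; have [-> ->] := hg e.
- have [s1 _] := tsumD (tsumZ n2 smn).1 (tsumZ n2 smw).1.
  apply: (le_tsum _ s1).1 => e; rewrite edge_mass_ge0/=.
  have := edge_mass_young l h12 (cn e) (continuousDr (cv e) (cw e)).
  rewrite invrK /mass_family.
  have -> : edge_mass l (fun x => -1 * v e x + (v e x + w e x)) = edge_mass l (w e).
    by apply: eq_edge_int => x _; ring.
  lra.
- have [s1 _] := tsumD (tsumZ n2 skn).1 (tsumZ n2 skw).1.
  apply: (le_tsum _ s1).1 => q; rewrite dyadic_incr_ge0//=.
  have := dyadic_incr_young q.2 (fun x => -1 * v q.1 x)
    (fun x => v q.1 x + w q.1 x) l0 h12.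
  rewrite invrK /kin_family.
  have -> : (fun x => -1 * v q.1 x + (v q.1 x + w q.1 x)) = w q.1.
    by apply/funext => x; ring.
  lra.
Qed.

Lemma admB v w : admissible v -> admissible w -> admissible (fun e x => v e x - w e x).
Proof.
move=> av aw; have [an _ _ _] := admZ (-1) aw; have := admD av an.
by congr admissible; apply/funext => e; apply/funext => x; rewrite mulN1r.
Qed.

Lemma powR_sub2_le (s : R) : p < 4 -> 0 <= s -> s `^ (p - 2) <= 1 + s ^+ 2.
Proof.
move=> p4 s0; have [s1|s1] := leP s 1.
  apply: (@le_trans _ _ 1); last by rewrite lerDl sqr_ge0.
  have e1 : 1 `^ (p - 2) = 1 :> R by rewrite powR1.
  rewrite -[leRHS]e1; apply: le_powR => //.
  by rewrite subr_ge0 ltW.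
apply: (@le_trans _ _ (s ^+ 2)); last by rewrite lerDr.
rewrite -powR_mulrn//; apply: ler_powR; first exact: ltW.
lra.
Qed.

(** As p - 2 < 2, the power S^(p-2) of a bound S for |v| is at most 1 + S^2, so the potential is at
    most affine in the kinetic energy, with a slope proportional to the window length t. *)
Lemma coercive (mu : R) : p < 4 -> 0 < mu ->
  exists C : R, forall v, admissible v -> gmass v <= mu -> gkin v / 4 - C <= renergy v.
Proof.
(* With 8 mu t <= p the slope 2 t mu / p is at most 1/4, which leaves a quarter of the kinetic
   energy. *)
move=> p4 mu0; pose t := Num.min l (p / (8 * mu)).
have t0 : 0 < t by rewrite lt_min l0 divr_gt0 ?mulr_gt0.
have tl : t <= l by rewrite ge_min lexx.
have tm : 8 * mu * t <= p.
  by rewrite mulrC -ler_pdivlMr ?mulr_gt0// ge_min lexx orbT.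
exists ((mu * (1 + 2 / t * mu)) / p) => v av mv.
pose B := 2 / t * mu + 2 * t * gkin v.
have B0 : 0 <= B.
  by rewrite addr_ge0// mulr_ge0 ?gkin_ge0// ?divr_ge0 ?mulr_ge0 ?ltW.
have hS e x : 0 <= x <= l -> `|v e x| <= Num.sqrt B.
  move=> hx; rewrite -sqrtr_sqr ler_sqrt//.
  apply: le_trans (adm_sup e av t0 tl hx) _; rewrite lerD2r ler_wpM2l//.
    by rewrite divr_ge0// ltW.
  by apply: le_trans mv; exact: edge_mass_le_gmass.
have [_ hP] := gpot_bound av hS.
have hP2 : gpot v <= (1 + B) * mu.
  apply: le_trans hP _; apply: ler_pM; rewrite ?powR_ge0 ?gmass_ge0//.
  apply: le_trans (powR_sub2_le p4 (sqrtr_ge0 B)) _.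
  by rewrite sqr_sqrtr.
rewrite /renergy lerBrDr.
have -> : gkin v / 4 - mu * (1 + 2 / t * mu) / p + gpot v / p =
  gkin v / 4 + (gpot v - mu * (1 + 2 / t * mu)) / p by field; rewrite !gt_eqF.
have -> : gkin v / 2 = gkin v / 4 + gkin v / 4 by field.
rewrite lerD2l ler_pdivrMr//.
apply: (@le_trans _ _ (2 * t * gkin v * mu)).
  by rewrite lerBlDr; apply: le_trans hP2 _; rewrite /B; lra.
have := ler_wpM2l (gkin_ge0 v) tm; lra.
Qed.

(** If every edge carried little mass, the kinetic bound would make |v| uniformly small, and the
    potential, at most sup |v|^(p-2) times the mass, would fall below [delta]. *)
Lemma nonvanishing (mu K delta : R) : 0 < delta ->
  exists2 m : R, 0 < m & forall v, admissible v -> gmass v <= mu -> gkin v <= K ->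
    delta <= gpot v -> exists e, m <= edge_mass l (v e).
Proof.
move=> d0; pose mu' := Num.max mu 0 + 1; pose K' := Num.max K 0 + 1.
have mu0 : 0 < mu' by rewrite ltr_wpDl// le_max lexx orbT.
have K0 : 0 < K' by rewrite ltr_wpDl// le_max lexx orbT.
have q0 : 0 < p - 2 by rewrite subr_gt0.
(* A bound |v| <= s leaves a potential of at most delta/2. The window [t] and the threshold t s^2/4
   make each of the two terms of the sup bound at most s^2/2. *)
pose s := (delta / (2 * mu')) `^ (p - 2)^-1.
have s0 : 0 < s by rewrite powR_gt0// divr_gt0// mulr_gt0.
pose t := Num.min l (s ^+ 2 / (4 * K')).
have t0 : 0 < t by rewrite lt_min l0 divr_gt0 ?mulr_gt0 ?exprn_gt0.
have tl : t <= l by rewrite ge_min lexx.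
have tK : 4 * K' * t <= s ^+ 2.
  by rewrite mulrC -ler_pdivlMr ?mulr_gt0// ge_min lexx orbT.
exists (t * s ^+ 2 / 4); first by rewrite divr_gt0// mulr_gt0// exprn_gt0.
move=> v av mv kv pv; apply: contrapT => /forallNP hm.
have hS e x : 0 <= x <= l -> `|v e x| <= s.
  move=> hx; rewrite -(ger0_norm (ltW s0)) -ler_sqr ?nnegrE// !real_normK ?num_real//.
  apply: le_trans (adm_sup e av t0 tl hx) _.
  have h1 : edge_mass l (v e) <= t * s ^+ 2 / 4.
    by rewrite ltW// ltNge; exact/negP.
  have h2 : 2 / t * edge_mass l (v e) <= s ^+ 2 / 2.
    rewrite mulrAC ler_pdivrMr//; lra.
  have h3 : t * gkin v <= t * K'.
    rewrite ler_wpM2l ?ltW//; apply: (le_lt_trans kv).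
    by rewrite /K' ltr_pwDr// le_max lexx.
  lra.
have [_] := gpot_bound av hS; apply/negP; rewrite -ltNge.
apply: lt_le_trans pv; rewrite /s -powRrM mulVf ?gt_eqF// powRr1; last first.
  by rewrite divr_ge0// ltW// mulr_gt0.
rewrite mulrAC ltr_pdivrMr ?mulr_gt0// ltr_pM2l//.
have : mu < mu' by rewrite /mu' ltr_pwDr// le_max lexx.
have := gmass_ge0 v; lra.
Qed.

End Admissible.

(** * Limits along an ultrafilter *)

(** By compactness of [-B, B] the image filter has a cluster point, and for an ultrafilter a cluster
    point is a limit. *)
Lemma ultra_bounded_cvg (R : realType) (T : Type) (U : set_system T) (f : T -> R) (B : R) :
  UltraFilter U -> (forall n, `|f n| <= B) -> exists c : R, f n @[n --> U] --> c.
Proof.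
move=> UU fB; have PU : ProperFilter U by exact: ultra_proper.
have h : (f @ U) `[- B, B]%classic.
  by apply: (@filterE _ U) => n /=; rewrite in_itv/= -ler_norml.
have [c [_ cc]] := @segment_compact R (- B) B (f @ U) (fmap_proper_filter f PU) h.
exists c => N cN; have [//|UC] := in_ultra_setVsetC (f @^-1` N) UU.
by have [x [/= nN xN]] := cc (~` N) N UC cN.
Qed.

Lemma cvg_le_cst (R : realType) (U : set_system nat) (f : nat -> R) (a c : R) :
  ProperFilter U -> f n @[n --> U] --> a -> (forall n, f n <= c) -> a <= c.
Proof.
move=> PU fa fc; have c2 : (fun=> c) @ U --> c by exact: cvg_cst.
have fc' : \forall n \near U, f n <= c by exact: filterE.
exact: ler_cvg_to fa c2 fc'.
Qed.

(** Projection onto [0, l]: composing with it turns continuity on the edge into continuity on the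
    line and keeps the values on the edge. *)
Definition clamp (R : realType) (l x : R) : R := Num.max 0 (Num.min x l).

Lemma clamp_id (R : realType) (l x : R) : 0 <= x <= l -> clamp l x = x.
Proof. by move=> /andP[x0 xl]; rewrite /clamp (min_idPl xl) (max_idPr x0). Qed.

Lemma clamp_itv (R : realType) (l x : R) : 0 < l -> 0 <= clamp l x <= l.
Proof.
by move=> l0; rewrite /clamp le_max lexx/= ge_max (ltW l0) ge_min lexx orbT.
Qed.

Lemma dyadic_incr_cvg_itv (R : realType) (l : R) (k : nat) (T : Type)
    (U : set_system T) (F : T -> R -> R) (f : R -> R) : 0 < l -> Filter U ->
  (forall x : R, 0 <= x <= l -> F n x @[n --> U] --> f x) ->
  dyadic_incr l k (F n) @[n --> U] --> dyadic_incr l k f.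
Proof.
move=> l0 FU cv.
have E g : dyadic_incr l k g = dyadic_incr l k (g \o clamp l).
  by apply: eq_dyadic_incr => // x hx /=; rewrite clamp_id.
rewrite E; under eq_fun do rewrite E.
by apply: dyadic_incr_cvg => x /=; apply: cv; exact: clamp_itv.
Qed.

Section UniformConvergence.
Context {R : realType} (l : R) (l0 : 0 < l).
Context (U : set_system nat) {PU : ProperFilter U}.

Definition unif_cvg (F : nat -> R -> R) (f : R -> R) := forall e : R, 0 < e ->
  \forall n \near U, forall x : R, 0 <= x <= l -> `|F n x - f x| <= e.

(** The Arzelà-Ascoli argument: on a dyadic mesh so fine that the common Hölder bound allows
    oscillations of at most e/3, convergence at finitely many nodes suffices. *)
Lemma hoelder_unif_cvg (K : R) (F : nat -> R -> R) (f : R -> R) :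
  (forall n, hoelder_half l K (F n)) ->
  (forall x : R, 0 <= x <= l -> F n x @[n --> U] --> f x) ->
  hoelder_half l K f /\ unif_cvg F f.
Proof.
move=> hF cv.
have hf : hoelder_half l K f.
  move=> x y hx hy; have c2 : (F n x - F n y) ^+ 2 @[n --> U] --> (f x - f y) ^+ 2.
    by apply: cvgM; apply: cvgB; exact: cv.
  by apply: cvg_le_cst c2 _ => n; exact: hF.
split=> // e e0.
have K0 : 0 <= K.
  have := hf 0 l; rewrite !lexx ltW// => /(_ isT isT).
  rewrite sub0r normrN (gtr0_norm l0) => /(le_trans (sqr_ge0 _)).
  by rewrite pmulr_lge0.
have [k hk] : exists k, K * (l / 2 ^+ k) <= (e / 3) ^+ 2.
  have c0 : K * (l / 2 ^+ k) @[k --> \oo] --> (0 : R).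
    rewrite -(mulr0 K); apply: cvgM; first exact: cvg_cst.
    exact: geometric_half_cvg.
  have e3 : 0 < (e / 3) ^+ 2 by rewrite exprn_gt0// divr_gt0.
  have /cvgrPdist_le/(_ _ e3)[k _ hk] := c0.
  exists k; have := hk k (leqnn k); rewrite sub0r normrN ger0_norm//.
  by rewrite mulr_ge0// divr_ge0 ?exprn_ge0// ltW.
have e3 : 0 < e / 3 by rewrite divr_gt0.
have : \forall n \near U, forall i : 'I_(2 ^ k).+1,
    `|F n (dyadic l k i) - f (dyadic l k i)| <= e / 3.
  apply: filter_forall => i.
  have hi : 0 <= dyadic l k i <= l.
    by apply: (@dyadic_bounds R l k i (ltW l0)); have := ltn_ord i.
  have /cvgrPdist_le/(_ _ e3) := cv _ hi.
  by apply: filterS => n; rewrite distrC.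
apply: filterS => n hn x hx.
have [i [hi _]] := dyadic_floor_cvg l0 hx.
have [ik /andP[ix xi]] := hi k; set y := dyadic l k (i k) in ix *.
have hy : 0 <= y <= l by apply: dyadic_bounds => //; exact: ltW.
have xy : `|x - y| <= l / 2 ^+ k.
  by rewrite ger0_norm ?subr_ge0//; move: xi; rewrite dyadicS -/y; lra.
have sm (g : R -> R) : hoelder_half l K g -> `|g x - g y| <= e / 3.
  move=> hg; rewrite -(ger0_norm (ltW e3)) -ler_sqr ?nnegrE// !real_normK ?num_real//.
  apply: le_trans (hg _ _ hx hy) _; apply: le_trans hk.
  by rewrite ler_wpM2l.
have ik' : (i k < (2 ^ k).+1)%N by rewrite ltnS.
have h1 : `|F n y - f y| <= e / 3 by have := hn (Ordinal ik').
have h2 := sm (F n) (hF n); have h3 := sm f hf.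
have -> : F n x - f x = (F n x - F n y) + ((F n y - f y) - (f x - f y)) by ring.
apply: le_trans (ler_normD _ _) _.
have := ler_normB (F n y - f y) (f x - f y); lra.
Qed.

Lemma unif_cvg_edge_mass (F : nat -> R -> R) (f : R -> R) :
  (forall n, continuous (F n)) -> continuous f -> unif_cvg F f ->
  edge_mass l (F n) @[n --> U] --> edge_mass l f.
Proof.
move=> cF cf uF; have [B B0 hB] := edge_bounded l0 cf.
apply/cvgrPdist_le => e e0.
have B1 : 0 < l * (2 * B + 1) by rewrite mulr_gt0// ltr_wpDl ?mulr_ge0.
pose d := Num.min 1 (e / (l * (2 * B + 1))).
have d0 : 0 < d by rewrite lt_min ltr01 divr_gt0.
have d1 : d <= 1 by rewrite ge_min lexx.
have de : d * (2 * B + 1) * l <= e.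
  by rewrite -mulrA (mulrC _ l) -ler_pdivlMr// ge_min lexx orbT.
have := uF _ d0; apply: filterS => n hn.
have cst_i (c : R) : edge_integrable l (fun=> c).
  by apply: edge_integrable_cont; exact: cst_continuous.
have iF := edge_integrable_cont l (continuous_sqr (cF n)).
have i_f := edge_integrable_cont l (continuous_sqr cf).
have key x : 0 <= x <= l -> `|F n x ^+ 2 - f x ^+ 2| <= d * (2 * B + 1).
  move=> hx; rewrite subr_sqr normrM; apply: ler_pM => //; first exact: hn.
  have -> : F n x + f x = (F n x - f x) + 2 * f x by ring.
  apply: le_trans (ler_normD _ _) _; rewrite normrM (ger0_norm (_ : 0 <= 2))//.
  by have := hn x hx; have := hB x hx; lra.
have h1 : edge_mass l (F n) <= edge_mass l f + e.
  apply: (@le_trans _ _ (edge_mass l f + d * (2 * B + 1) * l)); last by rewrite lerD2l.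
  rewrite -(edge_int_cst l0) -edge_intD//; apply: le_edge_int => //.
    exact: edge_integrableD.
  by move=> x /key; rewrite ler_norml => /andP[_]; lra.
have h2 : edge_mass l f <= edge_mass l (F n) + e.
  apply: (@le_trans _ _ (edge_mass l (F n) + d * (2 * B + 1) * l)); last by rewrite lerD2l.
  rewrite -(edge_int_cst l0) -edge_intD//; apply: le_edge_int => //.
    exact: edge_integrableD.
  by move=> x /key; rewrite ler_norml => /andP[+ _]; lra.
by rewrite ler_norml; apply/andP; split; lra.
Qed.

End UniformConvergence.

(** * Splitting of mass, kinetic energy and potential *)

Lemma energy_le_combine (R : realType) (a b c d e f g : R) : a + b <= c + e ->
  d <= f + g + e / 2 -> a / 2 - f + (b / 2 - g) <= c / 2 - d + e.
Proof. lra. Qed.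

Section Splitting.
Context {R : realType} (l p : R) (l0 : 0 < l) (p2 : 2 < p) (p4 : p < 4).
Context (U : set_system nat) {PU : ProperFilter U}.
Context (mu K : R) (v : edge -> R -> R) (vn : nat -> edge -> R -> R).
Hypothesis cv : forall e, continuous (v e).
Hypothesis an : forall n, admissible l (vn n).
Hypothesis mn : forall n, gmass l (vn n) <= mu.
Hypothesis kn : forall n, gkin l (vn n) <= K.
Hypothesis cvn : forall e (x : R), 0 <= x <= l -> vn n e x @[n --> U] --> v e x.

Let hn n e : hoelder_half l K (vn n e).
Proof.
move=> x y hx hy; apply: le_trans (adm_hoelder l0 e (an n) hx hy) _.
by rewrite ler_wpM2r// kn.
Qed.

Let hv e : hoelder_half l K (v e) /\ unif_cvg l U (fun n => vn n e) (v e).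
Proof.
by apply: hoelder_unif_cvg => // x hx; exact: cvn.
Qed.

Let mcv e : edge_mass l (vn n e) @[n --> U] --> edge_mass l (v e).
Proof.
apply: unif_cvg_edge_mass => //; last by have [] := hv e.
by move=> n; case: (an n).
Qed.

Let kcv q : kin_family l (vn n) q @[n --> U] --> kin_family l v q.
Proof.
by apply: dyadic_incr_cvg_itv => // x hx; exact: cvn.
Qed.

(** Every finite sum of edge masses or of dyadic increments converges, so the bounds survive in the
    limit, as in Fatou's lemma. *)
Lemma limit_admissible : admissible l v /\ gmass l v <= mu /\ gkin l v <= K.
Proof.
have [sm lm] : summable_ge0 (mass_family l v) /\ gmass l v <= mu.
  apply: tsum_bound => [e|A]; first exact: edge_mass_ge0.
  have c1 : \sum_(e <- A) mass_family l (vn n) e @[n --> U] -->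
      \sum_(e <- A) mass_family l v e.
    by apply: cvg_big => [|e _]; [exact: add_continuous|exact: mcv].
  apply: cvg_le_cst c1 _ => n; apply: le_trans (mn n).
  by apply: fsum_le_tsum; case: (an n).
have [sk lk] : summable_ge0 (kin_family l v) /\ gkin l v <= K.
  apply: tsum_bound => [e|A]; first exact: dyadic_incr_ge0.
  have c1 : \sum_(e <- A) kin_family l (vn n) e @[n --> U] -->
      \sum_(e <- A) kin_family l v e.
    by apply: cvg_big => [|e _]; [exact: add_continuous|exact: kcv].
  apply: cvg_le_cst c1 _ => n; apply: le_trans (kn n).
  by apply: fsum_le_tsum; case: (an n).
split=> //; split=> //.
have h0 : 0 <= (0 : R) <= l by rewrite lexx ltW.
have hl : 0 <= l <= l by rewrite lexx ltW.
(* The edges of type 0 meet every vertex exactly once, since (m, n, 0) joins a_{m,n} to b_{m,n}; the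
   vertex values of the limit are read off on them. *)
pose k0 : 'I_3 := ord0.
exists (fun z => match z with va m n => v (m, n, k0) 0 | vb m n => v (m, n, k0) l end).
move=> e; split.
  rewrite /source -(cvg_lim (@Rhausdorff R) (@cvn e _ h0)).
  rewrite -(cvg_lim (@Rhausdorff R) (@cvn (e.1.1, e.1.2, k0) _ h0)).
  congr (lim (_ @ U)); apply/funext => n; have [_ [w hw] _ _] := an n.
  by rewrite !(hw _).1.
case: e => -[a b] k.
have [c [d tE]] : exists c d, target (a, b, k) = vb c d.
  by rewrite /target; case: (val k) => [|[|?]]; do 2 eexists.
rewrite tE -(cvg_lim (@Rhausdorff R) (@cvn (a, b, k) _ hl)).
rewrite -(cvg_lim (@Rhausdorff R) (@cvn (c, d, k0) _ hl)).
congr (lim (_ @ U)); apply/funext => n; have [_ [w hw] _ _] := an n.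
by rewrite !(hw _).2 tE.
Qed.

(** On finitely many edges the mass converges to that of the limit; this is how nonvanishing is
    inherited by [v]. *)
Lemma mass_limit_ge (A : {fset edge}) (d : R) :
  (forall n, d <= \sum_(e <- A) edge_mass l (vn n e)) -> d <= gmass l v.
Proof.
move=> hd; have [[_ _ sm _] _] := limit_admissible.
apply: le_trans (fsum_le_tsum A sm).
have c1 : \sum_(e <- A) edge_mass l (vn n e) @[n --> U] -->
    \sum_(e <- A) mass_family l v e.
  by apply: cvg_big => [|e _]; [exact: add_continuous|exact: mcv].
rewrite -lerN2; apply: (cvg_le_cst _ (cvgN c1)) => n /=; rewrite lerN2; exact: hd.
Qed.

Let wn n e x := vn n e x - v e x.

Let av : admissible l v := limit_admissible.1.

Let aw n : admissible l (wn n). Proof. exact: (admB l0 p2 (an n) av). Qed.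

Let vnE n e : vn n e = (fun x => v e x + wn n e x).
Proof. by apply/funext => x; rewrite /wn; ring. Qed.

Let K0 : 0 <= K. Proof. by apply: le_trans limit_admissible.2.2; exact: gkin_ge0. Qed.
Let mu0 : 0 <= mu. Proof. by apply: le_trans limit_admissible.2.1; exact: gmass_ge0. Qed.

Let wn_cvg e (x : R) : 0 <= x <= l -> wn n e x @[n --> U] --> (0 : R).
Proof.
move=> hx; rewrite -(subrr (v e x)); apply: cvgB; [exact: cvn|exact: cvg_cst].
Qed.

Let hw n e : hoelder_half l (4 * K) (wn n e).
Proof.
move=> x y hx hy; have h1 := @hn n e x y hx hy; have h2 := (hv e).1 x y hx hy.
rewrite /wn; have := sqr_ge0 ((vn n e x - vn n e y) + (v e x - v e y)); nra.
Qed.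

Let wn_unif e : unif_cvg l U (fun n => wn n e) (fun=> 0).
Proof.
by apply: (hoelder_unif_cvg l0 _ _).2 => [n|x hx]; [exact: hw|exact: wn_cvg].
Qed.

Let cw n e : continuous (wn n e). Proof. by case: (aw n). Qed.

Let wmass0 e : edge_mass l (wn n e) @[n --> U] --> (0 : R).
Proof.
have -> : 0 = edge_mass l (fun=> 0 : R).
  by rewrite /edge_mass edge_int_cst// expr0n mul0r.
apply: unif_cvg_edge_mass => //; exact: cst_continuous.
Qed.

Let wmass_le n : gmass l (wn n) <= 4 * mu.
Proof.
have := limit_admissible.2.1; have [_ _ sv _] := av; have [_ _ svn _] := an n.
have [s1 e1] := tsumZ (ler0n R 2) sv; have [s2 e2] := tsumZ (ler0n R 2) svn.
have [s3 e3] := tsumD s1 s2; move: (mn n).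
suff : gmass l (wn n) <= 2 * gmass l v + 2 * gmass l (vn n) by lra.
rewrite -[X in _ <= X + _]e1 -[X in _ <= _ + X]e2 -e3.
apply: (le_tsum _ s3).2 => e; rewrite edge_mass_ge0/=.
have h12 : (0 : R) < 2^-1 by rewrite invr_gt0.
have := edge_mass_young l h12 (@cv e) (@cw n e); rewrite -vnE invrK /mass_family; lra.
Qed.

Let wkin_le n : gkin l (wn n) <= 4 * K.
Proof.
have := limit_admissible.2.2; have [_ _ _ sv] := av; have [_ _ _ svn] := an n.
have [s1 e1] := tsumZ (ler0n R 2) sv; have [s2 e2] := tsumZ (ler0n R 2) svn.
have [s3 e3] := tsumD s1 s2; move: (kn n).
suff : gkin l (wn n) <= 2 * gkin l v + 2 * gkin l (vn n) by lra.
rewrite -[X in _ <= X + _]e1 -[X in _ <= _ + X]e2 -e3.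
apply: (le_tsum _ s3).2 => q; rewrite dyadic_incr_ge0//=.
have h12 : (0 : R) < 2^-1 by rewrite invr_gt0.
have := dyadic_incr_young q.2 (v q.1) (wn n q.1) l0 h12.
rewrite -vnE invrK /kin_family; lra.
Qed.

Let wkin0 q : kin_family l (wn n) q @[n --> U] --> (0 : R).
Proof.
have -> : 0 = dyadic_incr l q.2 (fun=> 0 : R).
  by have := dyadic_incrZ l q.2 0 (fun=> 0 : R); rewrite expr2 !mul0r => ->.
by apply: dyadic_incr_cvg_itv => // x hx; exact: wn_cvg.
Qed.

Lemma mass_split (e : R) : 0 < e ->
  \forall n \near U, gmass l v + gmass l (wn n) <= gmass l (vn n) + e.
Proof.
have [_ _ sv _] := av.
apply: (tsum_brezis_lieb (C := 4 * mu)) => //.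
- by move=> n; case: (aw n).
- by move=> n; case: (an n).
- move=> t n f t0 _; rewrite /mass_family vnE; exact: edge_mass_young.
Qed.

Lemma kin_split (e : R) : 0 < e ->
  \forall n \near U, gkin l v + gkin l (wn n) <= gkin l (vn n) + e.
Proof.
have [_ _ _ sv] := av.
apply: (tsum_brezis_lieb (C := 4 * K)) => //.
- by move=> n; case: (aw n).
- by move=> n; case: (an n).
- move=> t n q t0 _; rewrite /kin_family vnE; exact: dyadic_incr_young.
Qed.

Let cross n e := edge_int l (fun x => `|v e x| * `|wn n e x|).

Let ccross n e : continuous (fun x => `|v e x| * `|wn n e x|).
Proof. by apply: continuousMr; exact: continuous_norm. Qed.

Let cross_mass n e : edge_mass l (fun x => `|v e x| - `|wn n e x|) + 2 * cross n e =
  edge_mass l (v e) + edge_mass l (wn n e).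
Proof.
rewrite /cross -edge_intZ; last exact: edge_integrable_cont.
rewrite -!edge_intD; first 1 last.
- exact/edge_integrable_cont/continuous_sqr.
- exact/edge_integrable_cont/continuous_sqr.
- apply/edge_integrable_cont/continuous_sqr/continuousBr; exact: continuous_norm.
- exact/edge_integrable_cont/continuous_scale.
apply: eq_edge_int => x _; rewrite -[v e x ^+ 2]real_normK ?num_real//.
by rewrite -[wn n e x ^+ 2]real_normK ?num_real//; ring.
Qed.

Let cross_ge0 n e : 0 <= cross n e.
Proof. by apply: edge_int_ge0 => x _; rewrite mulr_ge0. Qed.

Let cross_small n : summable_ge0 (cross n).
Proof.
have [_ _ sv _] := av; have [_ _ sw _] := aw n.
have [s1 _] := tsumD sv sw; apply: (le_tsum _ s1).1 => e; rewrite cross_ge0/=.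
rewrite /mass_family -cross_mass.
have := edge_mass_ge0 l (fun x => `|v e x| - `|wn n e x|); have := cross_ge0 n e; lra.
Qed.

(** The splitting lemma is applied to |v| - |w_n|. Its mass is the sum of the masses of v and w_n
    minus twice the cross term, so the lower bound given by the splitting forces the cross term to
    0. *)
Let cross_cvg (e : R) : 0 < e -> \forall n \near U, tsum (cross n) <= e.
Proof.
move=> e0; pose c n f := edge_mass l (fun x => `|v f x| - `|wn n f x|).
have [_ _ sv _] := av.
have sw n : summable_ge0 (mass_family l (wn n)) by case: (aw n).
have cE n f : c n f + 2 * cross n f = mass_family l v f + mass_family l (wn n) f.
  exact: cross_mass.
have sc n : summable_ge0 (c n).
  have [s1 _] := tsumD sv (sw n); apply: (le_tsum _ s1).1 => f.
  by rewrite edge_mass_ge0/= -cE lerDl mulr_ge0.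
have tE n : tsum (c n) + 2 * tsum (cross n) = gmass l v + gmass l (wn n).
  have [s2 e2] := tsumZ (ler0n R 2) (cross_small n).
  rewrite -e2 -(tsumD (sc n) s2).2 -(tsumD sv (sw n)).2; congr tsum.
  by apply/funext => f; exact: cE.
have e2 : 0 < 2 * e by rewrite mulr_gt0.
have : \forall n \near U, gmass l v + gmass l (wn n) <= tsum (c n) + 2 * e.
  apply: (tsum_brezis_lieb (C := 4 * mu)) => //.
  - move=> t n f t0 _; rewrite /mass_family /c.
    have -> : edge_mass l (wn n f) = edge_mass l (fun x => - `|wn n f x|).
      by apply: eq_edge_int => x _; rewrite sqrrN real_normK ?num_real.
    have -> : edge_mass l (v f) = edge_mass l (fun x => `|v f x|).
      by apply: eq_edge_int => x _; rewrite real_normK ?num_real.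
    apply: edge_mass_young => //; first exact: continuous_norm.
    by move=> x; apply: cvgN; exact: continuous_norm.
  - move=> f; rewrite /mass_family.
    have -> : edge_mass l (v f) = edge_mass l (fun x => `|v f x|).
      by apply: eq_edge_int => x _; rewrite real_normK ?num_real.
    apply: unif_cvg_edge_mass => //.
    + by move=> n; apply: continuousBr; exact: continuous_norm.
    + exact: continuous_norm.
    move=> d d0; have := wn_unif f d0; apply: filterS => n h x hx.
    have -> : `|v f x| - `|wn n f x| - `|v f x| = - `|wn n f x| by ring.
    by rewrite normrN normr_id; have := h x hx; rewrite subr0.
by apply: filterS => n; rewrite -tE lerD2l ler_pM2l.
Qed.

(** The potential enters the energy with a minus sign, so only an upper bound is wanted. The error
    of the power inequality is a constant times the cross term, uniformly in n thanks to a common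
    sup bound. *)
Lemma pot_split (e : R) : 0 < e ->
  \forall n \near U, gpot l p (vn n) <= gpot l p v + gpot l p (wn n) + e.
Proof.
(* [S] bounds both [v] and all remainders, whose mass and kinetic energy are at most 4 mu and 4
   K. *)
move=> e0; pose S := Num.sqrt (2 / l * (4 * mu) + 2 * l * (4 * K)).
have hS u : admissible l u -> gmass l u <= 4 * mu -> gkin l u <= 4 * K ->
    forall f x, 0 <= x <= l -> `|u f x| <= S.
  move=> au mu_ ku f x hx; rewrite -sqrtr_sqr ler_sqrt; last first.
    by apply: addr_ge0; apply: mulr_ge0; rewrite ?divr_ge0 ?mulr_ge0 ?(ltW l0).
  apply: le_trans (adm_sup l0 f au l0 (lexx l) hx) _; apply: lerD.
    apply: ler_wpM2l; first by rewrite divr_ge0// ltW.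
    by apply: le_trans mu_; exact: edge_mass_le_gmass.
  by rewrite ler_wpM2l// mulr_ge0// ltW.
have vS := hS v av; have wS n := hS (wn n) (aw n) (wmass_le n) (wkin_le n).
have {}vS f x : 0 <= x <= l -> `|v f x| <= S.
  apply: vS.
    by apply: le_trans limit_admissible.2.1 _; rewrite ler_peMl// ler1n.
  by apply: le_trans limit_admissible.2.2 _; rewrite ler_peMl// ler1n.
pose c := 15 * S `^ (p - 2).
have c0 : 0 <= c by rewrite mulr_ge0// powR_ge0.
have c10 : 0 < c + 1 by rewrite ltr_wpDl.
have := cross_cvg (divr_gt0 e0 c10); apply: filterS => n hcr.
have sv := adm_pot l0 p2 av; have sw := adm_pot l0 p2 (aw n).
have [s1 e1] := tsumD sv sw; have [s2 e2] := tsumZ c0 (cross_small n).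
have [s3 e3] := tsumD s1 s2.
apply: (@le_trans _ _ (gpot l p v + gpot l p (wn n) + c * tsum (cross n))); last first.
  rewrite lerD2l; apply: (@le_trans _ _ (c * (e / (c + 1)))); first by rewrite ler_wpM2l.
  by rewrite mulrA ler_pdivrMr// mulrDr mulr1 mulrC lerDl ltW.
rewrite -e2 -[X in _ <= X + _]e1 -e3; apply: (le_tsum _ s3).2 => f.
rewrite edge_pot_ge0/= /pot_family /cross.
have p0 : 0 <= p by apply: le_trans (ltW p2).
rewrite -edge_intZ; last exact: edge_integrable_cont.
have i1 := edge_integrable_pow l0 (@cv f) p0.
have i2 := edge_integrable_pow l0 (@cw n f) p0.
have i3 := edge_integrable_cont l (continuous_scale (c := c) (@ccross n f)).
have i12 := edge_integrableD i1 i2.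
rewrite /edge_pot -edge_intD// -edge_intD//; apply: le_edge_int.
- by apply: edge_integrable_pow => //; case: (an n).
- exact: edge_integrableD.
move=> x hx; apply: (@le_trans _ _ ((`|v f x| + `|wn n f x|) `^ p)).
  by apply: le_powR => //; rewrite vnE; exact: ler_normD.
by apply: powR_add_le => //; [exact: vS|exact: wS].
Qed.

Lemma renergy_split (e : R) : 0 < e -> \forall n \near U,
  renergy l p v + renergy l p (wn n) <= renergy l p (vn n) + e.
Proof.
move=> e0; have p0 : 0 < p by apply: lt_trans p2.
have h1 := kin_split e0; have h2 := pot_split (mulr_gt0 p0 (divr_gt0 e0 (ltr0n _ 2))).
near=> n; have g1 : gkin l v + gkin l (wn n) <= gkin l (vn n) + e by near: n.
have g2 : gpot l p (vn n) <= gpot l p v + gpot l p (wn n) + p * (e / 2) by near: n.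
have : gpot l p (vn n) / p <= gpot l p v / p + gpot l p (wn n) / p + e / 2.
  have pV : 0 <= p^-1 by rewrite invr_ge0 ltW.
  by have := ler_wpM2r pV g2; rewrite 2!mulrDl (mulrC p) mulfK ?gt_eqF.
exact: energy_le_combine.
Unshelve. all: by end_near.
Qed.

End Splitting.

Lemma hoelder_continuous (R : realType) (f : R -> R) (K : R) :
  (forall x y : R, (f x - f y) ^+ 2 <= K * `|x - y|) -> continuous f.
Proof.
move=> hK x; apply/cvgrPdist_lt => e e0.
pose K' := Num.max K 0 + 1.
have K0 : 0 < K' by rewrite ltr_wpDl// le_max lexx orbT.
have d0 : 0 < e ^+ 2 / K' by rewrite divr_gt0// exprn_gt0.
near=> y.
rewrite -(ger0_norm (ltW e0)) -ltr_sqr ?nnegrE// !real_normK ?num_real//.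
apply: (le_lt_trans (hK x y)); apply: (@le_lt_trans _ _ (K' * `|x - y|)).
  by rewrite ler_wpM2r// /K' ler_wpDr// le_max lexx.
rewrite mulrC -ltr_pdivlMr//; near: y.
Unshelve. all: by end_near.
Qed.

(** * Translations of the honeycomb *)

Lemma cancel_set_bij (T T' : Type) (f : T -> T') (g : T' -> T) :
  cancel f g -> cancel g f -> set_bij setT setT f.
Proof.
move=> fK gK; split=> //; first by move=> x y _ _; exact: (can_inj fK).
by move=> y _; exists (g y).
Qed.

Section Translation.
Context {R : realType} (l p : R) (l0 : 0 < l) (p2 : 2 < p).

Definition shift_edge (a b : int) (e : edge) : edge := (e.1.1 + a, e.1.2 + b, e.2).

Lemma shift_edge_bij a b : set_bij setT setT (shift_edge a b).
Proof.
apply: (@cancel_set_bij _ _ _ (shift_edge (- a) (- b))).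
  by move=> -[[m n] k]; rewrite /shift_edge/= !addrK.
by move=> -[[m n] k]; rewrite /shift_edge/= !subrK.
Qed.

Definition translate (a b : int) (v : edge -> R -> R) := fun e => v (shift_edge a b e).

Lemma translate_admissible a b v : admissible l v ->
  [/\ admissible l (translate a b v), gmass l (translate a b v) = gmass l v,
      gkin l (translate a b v) = gkin l v & gpot l p (translate a b v) = gpot l p v].
Proof.
move=> av; have [cv [w hw] sm sk] := av.
have bs : set_bij setT setT (fun q : edge * nat => (shift_edge a b q.1, q.2)).
  apply: (@cancel_set_bij _ _ _ (fun q => (shift_edge (- a) (- b) q.1, q.2))).
    by move=> -[[[m n] k] j]; rewrite /shift_edge/= !addrK.
  by move=> -[[[m n] k] j]; rewrite /shift_edge/= !subrK.
have [s1 e1] := tsum_reindex (shift_edge_bij a b) sm.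
have [s2 e2] := tsum_reindex (shift_edge_bij a b) (adm_pot l0 p2 av).
have [s3 e3] := tsum_reindex bs sk.
split; [split; [by move=> e; exact: cv| |exact: s1|exact: s3]|exact: e1|exact: e3|exact: e2].
exists (fun z => match z with va m n => w (va (m + a) (n + b))
                            | vb m n => w (vb (m + a) (n + b)) end).
move=> -[[m n] k]; rewrite /translate; have [-> ->] := hw (shift_edge a b (m, n, k)).
split; first exact: erefl.
rewrite /shift_edge /target/=; case: (val k) => [|[|_]]; first exact: erefl.
  by rewrite addrAC.
by rewrite (addrAC n).
Qed.

End Translation.

Lemma clamp_lipschitz (R : realType) (l x y : R) : 0 < l ->
  `|clamp l x - clamp l y| <= `|x - y|.
Proof.
move=> l0; have h1 := ler_norm (x - y); have h2 := ler_norm (y - x).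
rewrite distrC in h2; rewrite ler_norml /clamp /Num.max /Num.min.
case: (ltP x l) => xl; case: (ltP y l) => yl; rewrite ?l0.
- by case: (ltP 0 x) => ?; case: (ltP 0 y) => ?; apply/andP; split; lra.
- by case: (ltP 0 x) => ?; apply/andP; split; lra.
- by case: (ltP 0 y) => ?; apply/andP; split; lra.
- by apply/andP; split; lra.
Qed.

(** * The defect, and existence of a minimizer *)

(** Here a, b, c are the energies of v, w_n, v_n; x and y are the masses of v and w_n; s is the
    tolerance on the energy of v_n, d the splitting error, and t = I / mu. *)
Lemma defect_arith (R : realType) (a b c d e I mu s t x y : R) :
  a + b <= c + d -> c < I + s -> s <= d -> x + y <= mu + d -> 0 <= b - t * y ->
  t * mu = I -> 0 <= - t -> d * (2 - t) <= e -> a - t * x <= e.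
Proof. by move=> h1 h2 h3 h4 h5 h6 h7 h8; have := ler_wpM2l h7 h4; lra. Qed.

Section Minimizer.
Context {R : realType} (l p : R) (l0 : 0 < l) (p2 : 2 < p) (p4 : p < 4).
Context (mu I : R) (mu0 : 0 < mu).
Hypothesis I_lb : forall v, admissible l v -> gmass l v = mu -> I <= renergy l p v.

Let p0 : 0 < p. Proof. by apply: lt_trans p2. Qed.

(** Multiplication by the square root of r brings the mass to [mu], where [I] is a lower bound. *)
Lemma energy_scaling w r : admissible l w -> 0 < gmass l w -> r = mu / gmass l w ->
  I <= r * gkin l w / 2 - r `^ (p / 2) * gpot l p w / p.
Proof.
move=> aw m0 rE; have r0 : 0 < r by rewrite rE divr_gt0.
have [a1 e1 e2 e3] := admZ l0 p2 (Num.sqrt r) aw.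
have rm : r * gmass l w = mu by rewrite rE divfK ?gt_eqF.
have := I_lb a1; rewrite /renergy e1 e2 e3 sqr_sqrtr ?(ltW r0)// rm => /(_ erefl).
by rewrite ger0_norm ?sqrtr_ge0// -powR12_sqrt ?(ltW r0)// -powRrM (mulrC _ p).
Qed.

(* When [I <= 0], since [p > 2], rescaling [w] to mass [mu] shows that the
   defect is nonnegative as soon as [gmass l w <= mu]. *)
Definition defect w := renergy l p w - I / mu * gmass l w.

(** The scaling inequality divided by r, where [I / r] is [I / mu * gmass l w]. It holds for r on
    both sides of 1: r >= 1 gives the sign of the defect, r near 1 gives the Euler-Lagrange
    inequality. *)
Lemma energy_scaling_sub w r : admissible l w -> 0 < gmass l w ->
  r = mu / gmass l w -> (r `^ (p / 2 - 1) - 1) * gpot l p w / p <= defect w.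
Proof.
move=> aw m0 rE; have r0 : 0 < r by rewrite rE divr_gt0.
have := energy_scaling aw m0 rE.
have -> : r `^ (p / 2) = r * r `^ (p / 2 - 1).
  by rewrite mulr_powRB1 ?ltW// divr_gt0.
set t := r `^ _ => h; rewrite /defect /renergy.
have -> : I / mu * gmass l w = I / r by rewrite rE; field; rewrite !gt_eqF.
rewrite lerBrDr.
have -> : (t - 1) * gpot l p w / p + I / r =
  r^-1 * (I + r * ((t - 1) * gpot l p w / p)) by field; rewrite !gt_eqF.
rewrite ler_pdivrMl//.
have -> : r * (gkin l w / 2 - gpot l p w / p) =
  (r * gkin l w / 2 - r * t * gpot l p w / p) + r * ((t - 1) * gpot l p w / p).
  by field; rewrite gt_eqF.
by rewrite lerD2r.
Qed.

Lemma defect_ge0 w : I <= 0 -> admissible l w -> gmass l w <= mu -> 0 <= defect w.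
Proof.
move=> I0 aw mw; have [m0|m0] := ltP 0 (gmass l w).
  apply: le_trans (energy_scaling_sub aw m0 erefl); rewrite mulr_ge0 ?invr_ge0 ?(ltW p0)//.
  rewrite mulr_ge0 ?gpot_ge0// subr_ge0.
  have r1 : 1 <= mu / gmass l w by rewrite ler_pdivlMr// mul1r.
  have e1 : 1 `^ (p / 2 - 1) = 1 :> R by rewrite powR1.
  by rewrite -[X in X <= _]e1; apply: le_powR => //; rewrite subr_ge0 ler_pdivlMr// mul1r ltW.
(* Zero mass cannot be rescaled; there the potential vanishes, being controlled by the mass. *)
have mE : gmass l w = 0 by apply/eqP; rewrite eq_le m0 gmass_ge0.
have [B B0 hB] := adm_bounded l0 aw.
have [_] := gpot_bound l0 p2 aw hB; rewrite mE mulr0 => P0.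
have := gkin_ge0 l0 w; have := gpot_ge0 l p w.
rewrite /defect /renergy mE mulr0 subr0 => P1 k0.
have -> : gpot l p w = 0 by apply/eqP; rewrite eq_le P0.
by rewrite mul0r subr0 divr_ge0.
Qed.

(** A smaller mass would give r > 1, hence a factor r^(p/2-1) - 1 > 0, so the potential would be 0;
    but then the defect is at least -(I/mu) times the mass, which is positive. This replaces strict
    subadditivity. *)
Lemma defect_le0_mass w : I < 0 -> admissible l w -> 0 < gmass l w ->
  gmass l w <= mu -> defect w <= 0 -> gmass l w = mu.
Proof.
move=> I0 aw m0 mw d0; apply/eqP; rewrite eq_le mw/= leNgt; apply/negP => mlt.
have h := le_trans (energy_scaling_sub aw m0 erefl) d0.
have t1 : 1 < (mu / gmass l w) `^ (p / 2 - 1).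
  have r1 : 1 < mu / gmass l w by rewrite ltr_pdivlMr// mul1r.
  have e1 : 1 `^ (p / 2 - 1) = 1 :> R by rewrite powR1.
  rewrite -[X in X < _]e1; apply: gt0_ltr_powR => //.
  - by rewrite subr_gt0 ltr_pdivlMr// mul1r.
  - by rewrite nnegrE.
  - by rewrite nnegrE ltW// (lt_trans _ r1).
have P0 : gpot l p w = 0.
  apply/eqP; rewrite eq_le gpot_ge0 andbT.
  move: h; rewrite pmulr_lle0 ?invr_gt0// pmulr_rle0// subr_gt0//.
have : 0 < defect w; last by rewrite ltNge d0.
rewrite /defect /renergy P0 mul0r subr0.
have := gkin_ge0 l0 w => k0.
have : 0 < - I / mu * gmass l w by rewrite mulr_gt0// divr_gt0// oppr_gt0.
lra.
Qed.

Lemma minimizing_sequence : I < 0 ->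
  (forall e : R, 0 < e -> exists v, [/\ admissible l v, gmass l v = mu & renergy l p v < I + e]) ->
  exists (K m : R) (A : {fset edge}) (vn : nat -> edge -> R -> R), 0 < m /\
    forall n, [/\ admissible l (vn n), gmass l (vn n) = mu, gkin l (vn n) <= K,
      renergy l p (vn n) < I + n.+1%:R^-1 & m <= \sum_(e <- A) edge_mass l (vn n e)].
Proof.
move=> I0 I_app; have [C hC] := coercive l0 p2 p4 mu0.
(* An energy below I/2 with nonnegative kinetic part forces a potential of at least -I p/2. *)
pose delta := - I / 2 * p; have d0 : 0 < delta by rewrite mulr_gt0// divr_gt0// oppr_gt0.
pose K := 4 * (I + 1 + C).
have [m m0 hm] := nonvanishing l0 p2 mu K d0.
(* Translations move an edge to the origin but keep its type k, so the mass may end up on any of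
   these three edges. *)
pose A := [fset ((0, 0, k) : edge) | k in 'I_3]%fset.
exists K, m, A.
suff : forall n, exists v, [/\ admissible l v, gmass l v = mu, gkin l v <= K,
      renergy l p v < I + n.+1%:R^-1 & m <= \sum_(e <- A) edge_mass l (v e)].
  by move=> /choice[vn hvn]; exists vn.
move=> n; have e0 : 0 < Num.min n.+1%:R^-1 (- I / 2).
  by rewrite lt_min invr_gt0 ltr0n divr_gt0// oppr_gt0.
have [v [av mv ev]] := I_app _ e0.
have ev1 : renergy l p v < I + n.+1%:R^-1.
  by apply: lt_le_trans ev _; rewrite lerD2l ge_min lexx.
have ev2 : renergy l p v < I / 2.
  apply: lt_le_trans ev _; apply: (@le_trans _ _ (I + - I / 2)).
    by rewrite lerD2l ge_min lexx orbT.
  lra.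
have kv : gkin l v <= K.
  have := hC v av; rewrite mv lexx => /(_ isT) h.
  have n1 : n.+1%:R^-1 <= 1 :> R by rewrite invf_le1 ?ltr0n// ler1n.
  have : renergy l p v < I + 1 by apply: lt_le_trans ev1 _; rewrite lerD2l.
  move=> ev3; rewrite /K mulrC -ler_pdivrMr//.
  by rewrite -lerBlDr; apply: le_trans h _; exact: ltW.
have pv : delta <= gpot l p v.
  rewrite /delta -ler_pdivlMr//; have := gkin_ge0 l0 v; move: ev2; rewrite /renergy; lra.
have [|[[a b] k] he] := hm v av _ kv pv; first by rewrite mv.
have [a1 e1 e2 e3] := translate_admissible l0 p2 a b av.
exists (translate a b v); split.
- exact: a1.
- by rewrite e1.
- by rewrite e2.
- by rewrite /renergy e2 e3.
- apply: le_trans he _.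
  have kA : ((0, 0, k) : edge) \in A by apply/imfsetP; exists k.
  rewrite (big_fsetD1 _ kA)/= /translate /shift_edge/= !add0r lerDl.
  by apply: sumr_ge0 => e _; exact: edge_mass_ge0.
Qed.

Lemma exists_minimizer : I < 0 ->
  (forall e : R, 0 < e -> exists v, [/\ admissible l v, gmass l v = mu & renergy l p v < I + e]) ->
  exists v, [/\ admissible l v, gmass l v = mu & renergy l p v = I].
Proof.
move=> I0 I_app; have [K [m [A [vn [m0 hvn]]]]] := minimizing_sequence I0 I_app.
have an n : admissible l (vn n) by have [] := hvn n.
have mn n : gmass l (vn n) = mu by have [] := hvn n.
have mn' n : gmass l (vn n) <= mu by rewrite mn.
have kn n : gkin l (vn n) <= K by have [] := hvn n.
have en n : renergy l p (vn n) < I + n.+1%:R^-1 by have [] := hvn n.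
have An n : m <= \sum_(e <- A) edge_mass l (vn n e) by have [] := hvn n.
(* An ultrafilter refining the eventual filter: bounded sequences converge along it, and so does
   everything that tends to 0 in the usual sense. *)
have [U [UU subU]] := ultraFilterLemma eventually_filter.
have PU : ProperFilter U by exact: ultra_proper.
pose S := Num.sqrt (2 / l * mu + 2 * l * K).
have hS n e x : `|vn n e (clamp l x)| <= S.
  have ci := clamp_itv x l0.
  rewrite -sqrtr_sqr ler_wsqrtr//; apply: le_trans (adm_sup l0 e (an n) l0 (lexx l) ci) _.
  apply: lerD; apply: ler_wpM2l.
  - by rewrite divr_ge0// ltW.
  - by rewrite -(mn n); exact: edge_mass_le_gmass.
  - by rewrite mulr_ge0// ltW.
  - exact: kn.
have /choice[v' hv'] (ex : edge * R) : exists c : R, vn n ex.1 (clamp l ex.2) @[n --> U] --> c.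
  exact: ultra_bounded_cvg (fun n => hS n ex.1 ex.2).
pose v e x := v' (e, x).
have cvn e (x : R) : 0 <= x <= l -> vn n e x @[n --> U] --> v e x.
  by move=> hx; have := hv' (e, x); rewrite /= clamp_id.
have K0 : 0 <= K by apply: le_trans (kn 0%N); exact: gkin_ge0.
have cv e : continuous (v e).
  apply: (@hoelder_continuous _ _ K) => x y.
  have c2 : (vn n e (clamp l x) - vn n e (clamp l y)) ^+ 2 @[n --> U] --> (v e x - v e y) ^+ 2.
    by apply: cvgM; apply: cvgB; [exact: (hv' (e, x))|exact: (hv' (e, y))|
      exact: (hv' (e, x))|exact: (hv' (e, y))].
  apply: cvg_le_cst c2 _ => n.
  apply: le_trans (adm_hoelder l0 e (an n) (clamp_itv x l0) (clamp_itv y l0)) _.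
  by apply: ler_pM => //; [exact: gkin_ge0|exact: clamp_lipschitz].
have [av [mv kv]] := limit_admissible l0 cv an mn' kn cvn.
have mv0 : 0 < gmass l v.
  by apply: lt_le_trans m0 _; exact: (mass_limit_ge l0 cv an mn' kn cvn An).
have Imu : 0 <= - (I / mu) by rewrite -mulNr divr_ge0// ?oppr_ge0 ltW.
(* The defect of v_n tends to 0 because its mass is exactly [mu]. Up to small errors it dominates
   the sum of the defects of v and w_n, and the latter is nonnegative. *)
have dv : defect v <= 0.
  apply/ler_addgt0Pl => e e0; rewrite addr0.
  (* The total error is e1 from the energy splitting, e1 from the minimizing sequence and -(I/mu) e1
     from the mass splitting. The bound e1 <= gmass l v keeps the mass of w_n at most [mu]. *)
  pose e1 := Num.min (e / (2 - I / mu)) (gmass l v).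
  have c0 : 0 < 2 - I / mu by lra.
  have e10 : 0 < e1 by rewrite lt_min mv0 divr_gt0.
  have e1e : e1 * (2 - I / mu) <= e by rewrite -ler_pdivlMr// ge_min lexx.
  have e1m : e1 <= gmass l v by rewrite ge_min lexx orbT.
  have h1 := mass_split l0 p2 cv an mn' kn cvn e10.
  have h2 := renergy_split l0 p2 p4 cv an mn' kn cvn e10.
  have h3 : \forall n \near U, n.+1%:R^-1 <= e1.
    apply: subU; near=> n; apply: ltW; near: n.
    exact: near_infty_natSinv_lt (PosNum e10).
  have [n [[g1 g2] g3]] := filter_ex (filterI (filterI (h1 PU) (h2 PU)) h3).
  set w := (fun e x => vn n e x - v e x) in g1 g2.
  have aw : admissible l w by exact: (admB l0 p2 (an n) av).
  rewrite mn in g1.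
  have dw : 0 <= defect w.
    apply: defect_ge0; [exact: ltW|exact: aw|].
    by rewrite -(lerD2l (gmass l v)); apply: le_trans g1 _; rewrite addrC lerD2r.
  have tmu : I / mu * mu = I by rewrite divfK ?gt_eqF.
  exact: defect_arith g2 (en n) g3 g1 dw tmu Imu e1e.
have mE := defect_le0_mass I0 av mv0 mv dv.
exists v; split=> //; apply/eqP; rewrite eq_le I_lb// andbT.
by move: dv; rewrite /defect mE divfK ?gt_eqF// subr_le0.
Unshelve. all: by end_near.
Qed.

End Minimizer.

(** * Wide tents and the sign of the infimum *)

Lemma dyadic_mid (R : realType) (l : R) (k i : nat) :
  dyadic l k.+1 i.*2.+1 = (dyadic l k i + dyadic l k i.+1) / 2.
Proof.
rewrite !dyadicS dyadic_double exprS; field.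
by rewrite expf_neq0// pnatr_eq0.
Qed.

Section Tent.
Context {R : realType} (l : R) (l0 : 0 < l) (M : nat) (M0 : (0 < M)%N).

Let N := (4 * M)%N.

(** The truncated subtraction of [nat] makes the height vanish far from the origin. *)
Definition tent_height (m n : int) : nat := (4 * M - (`|m| + `|n|))%N.

Definition tent_vertex (z : vertex) : nat :=
  match z with va m n => tent_height m n | vb m n => tent_height m n end.

Definition tent (e : edge) (x : R) : R :=
  (tent_vertex (source e))%:R +
  ((tent_vertex (target e))%:R - (tent_vertex (source e))%:R) * (x / l).

Definition tent_support : {fset edge} :=
  [fset ((Posz (val q.1.1) - Posz N.+1, Posz (val q.1.2) - Posz N.+1, q.2) : edge)
    | q in {: 'I_(2 * N + 3) * 'I_(2 * N + 3) * 'I_3}]%fset.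

(** There are at most 3 (8M + 3)^2 edges and 8M + 3 <= 11M, whence 363 = 3 * 11^2. *)
Lemma card_tent_support : (#|` tent_support| <= 363 * M ^ 2)%N.
Proof.
apply: leq_trans (leq_imfset_card _ _ _) _.
rewrite -cardE !card_prod !card_ord /N; nia.
Qed.

Lemma tent_vertex_support (e : edge) : e \notin tent_support ->
  tent_vertex (source e) = 0%N /\ tent_vertex (target e) = 0%N.
Proof.
move: e => [[m n] k] he.
have : ~ ((`|m| <= N.+1)%N /\ (`|n| <= N.+1)%N).
  move=> [hm hn]; move/negP: he; apply.
  have im : (`|(m + Posz N.+1)%R| < 2 * N + 3)%N by lia.
  have i_n : (`|(n + Posz N.+1)%R| < 2 * N + 3)%N by lia.
  apply/imfsetP; exists (Ordinal im, Ordinal i_n, k) => //=.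
  congr (_, _, _); lia.
move=> h; rewrite /source /target /tent_vertex /tent_height /=.
by split; [rewrite /N in h; lia|case: (val k) => [|[|?]]; rewrite /N in h; lia].
Qed.

Lemma tent_vertex_lip (e : edge) :
  (((tent_vertex (target e))%:R - (tent_vertex (source e))%:R) ^+ 2 <= 1 :> R).
Proof.
move: e => [[m n] k].
have h : (tent_vertex (target (m, n, k)) <= tent_vertex (source (m, n, k)) + 1)%N /\
    (tent_vertex (source (m, n, k)) <= tent_vertex (target (m, n, k)) + 1)%N.
  rewrite /source /target /tent_vertex /tent_height /=.
  by case: (val k) => [|[|?]]; lia.
move: h; set a := tent_vertex _; set b := tent_vertex _ => -[h1 h2].
have g1 : a%:R <= b%:R + 1 :> R by rewrite natr1 ler_nat -addn1.
have g2 : b%:R <= a%:R + 1 :> R by rewrite natr1 ler_nat -addn1.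
by rewrite -[leRHS](expr1n _ 2) ler_sqr_norm || nra.
Qed.

Lemma tent_vertex_le z : (tent_vertex z <= N)%N.
Proof. by case: z => m n /=; rewrite /tent_height /N leq_subr. Qed.

Lemma tent_continuous e : continuous (tent e).
Proof.
rewrite /tent; apply: continuousDr; first exact: cst_continuous.
apply: continuous_scale => x; apply: cvgM; [exact: cvg_id|exact: cvg_cst].
Qed.

Lemma tent0 e : tent e 0 = (tent_vertex (source e))%:R.
Proof. by rewrite /tent mul0r mulr0 addr0. Qed.

Lemma tentl e : tent e l = (tent_vertex (target e))%:R.
Proof. by rewrite /tent divff ?gt_eqF// mulr1 addrC subrK. Qed.

(** The tent is affine on each edge, so only level 0, the chord of the whole edge, contributes;
    neighbouring heights differ by at most 1. *)
Lemma tent_kin (q : edge * nat) : kin_family l tent q <= if q.2 == 0%N then l^-1 else 0.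
Proof.
case: q => e [|k]; rewrite /kin_family /=.
  by rewrite tent0 tentl ler_pdivrMr// mulVf ?gt_eqF//; exact: tent_vertex_lip.
rewrite big1// => i _; rewrite dyadic_mid /tent.
rewrite [X in X ^+ 2](_ : _ = 0) ?expr0n ?mul0r//.
by field; rewrite gt_eqF.
Qed.

Lemma tent_bounds e x : 0 <= x <= l -> 0 <= tent e x <= N%:R.
Proof.
move=> /andP[x0 xl]; rewrite /tent.
set a := (tent_vertex (source e))%:R; set b := (tent_vertex (target e))%:R.
have a0 : 0 <= a :> R by []. have b0 : 0 <= b :> R by [].
have aN : a <= N%:R :> R by rewrite ler_nat tent_vertex_le.
have bN : b <= N%:R :> R by rewrite ler_nat tent_vertex_le.
have s0 : 0 <= x / l by rewrite divr_ge0// ltW.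
have s1 : x / l <= 1 by rewrite ler_pdivrMr// mul1r.
move: (x / l) s0 s1 => s s0 s1; apply/andP; split; nra.
Qed.

Lemma tent_out e : e \notin tent_support -> tent e = fun=> 0.
Proof.
move=> /tent_vertex_support[h1 h2]; apply/funext => x.
by rewrite /tent h1 h2 subrr mul0r addr0.
Qed.

Lemma tent_mass e : edge_mass l (tent e) <= l * N%:R ^+ 2.
Proof.
rewrite mulrC -(edge_int_cst l0); apply: le_edge_int.
- exact/edge_integrable_cont/continuous_sqr/tent_continuous.
- by apply: edge_integrable_cont; exact: cst_continuous.
- move=> x /(tent_bounds e)/andP[h1 h2].
  by rewrite ler_sqr ?nnegrE// (le_trans h1).
Qed.

Lemma tent_admissible (C : R) : (363%N)%:R = C -> [/\ admissible l tent,
  gmass l tent <= 16 * C * l * M%:R ^+ 4 & gkin l tent <= C * M%:R ^+ 2 / l].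
Proof.
move=> hC; have big_bound (A : {fset edge}) (F : edge -> R) (c : R) : 0 <= c ->
    (#|` A| <= 363 * M ^ 2)%N -> (forall e, F e <= c) ->
    \sum_(e <- A) F e <= C * M%:R ^+ 2 * c.
  move=> c0 cA Fc; apply: (@le_trans _ _ (\sum_(e <- A) c)).
    by apply: ler_sum => e _.
  rewrite big_const_seq count_predT iter_addr_0 -[c *+ _]mulr_natl; apply: ler_wpM2r => //.
  by rewrite -hC -natrX -natrM ler_nat.
have [sm em] : summable_ge0 (mass_family l tent) /\
    gmass l tent = \sum_(e <- tent_support) mass_family l tent e.
  apply: tsum_fin => [e|e he]; first exact: edge_mass_ge0.
  rewrite /mass_family tent_out// /edge_mass edge_int_cst//.
  by rewrite expr0n mul0r.
pose A' := [fset (e, 0%N) | e in tent_support]%fset.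
have [sk ek] : summable_ge0 (kin_family l tent) /\
    gkin l tent = \sum_(q <- A') kin_family l tent q.
  apply: tsum_fin => [q|q hq]; first exact: dyadic_incr_ge0.
  apply/eqP; rewrite eq_le dyadic_incr_ge0// andbT.
  case: q hq => e [|k] hq; last exact: (tent_kin (e, k.+1)).
  have he : e \notin tent_support.
    by apply: contra hq => he; apply/imfsetP; exists e.
  by rewrite /kin_family tent_out//= subrr expr0n mul0r.
split.
- split => //; first exact: tent_continuous.
  by exists (fun z => (tent_vertex z)%:R) => e; rewrite tent0 tentl.
- rewrite em; apply: le_trans (big_bound _ _ (l * N%:R ^+ 2) _ card_tent_support tent_mass) _.
    by rewrite mulr_ge0 ?exprn_ge0 ?(ltW l0).
  by rewrite /N natrM le_eqVlt; apply/orP; left; apply/eqP; ring.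
- rewrite ek /A' big_imfset/=; last by move=> ? ? _ _ [].
  apply: big_bound => //; first by rewrite invr_ge0 ltW.
    exact: card_tent_support.
  by move=> e; exact: (tent_kin (e, 0%N)).
Qed.

(** For 0 <= m, n < M the height is at least 2M, and on the M^2 edges of type 0 there both ends have
    the same height, so the tent is constant. *)
Lemma tent_pot (p : R) : 2 < p -> l * M%:R ^+ 2 * (2 * M%:R) `^ p <= gpot l p tent.
Proof.
move=> p2; have [at_ _ _] := tent_admissible erefl; have sp := adm_pot l0 p2 at_.
pose D := [fset ((Posz (val q.1), Posz (val q.2), ord0) : edge) | q in {: 'I_M * 'I_M}]%fset.
apply: le_trans (fsum_le_tsum D sp).
rewrite big_imfset/=; last first.
  by move=> [i j] [i' j'] _ _ [] /val_inj -> /val_inj ->.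
apply: (@le_trans _ _ (\sum_(q : 'I_M * 'I_M) (2 * M%:R) `^ p * l)).
  rewrite sumr_const card_prod card_ord -[X in _ <= X]mulr_natl natrM.
  by rewrite le_eqVlt; apply/orP; left; apply/eqP; ring.
rewrite big_enum/=; apply: ler_sum => -[i j] _.
rewrite -(edge_int_cst l0); apply: le_edge_int.
- by apply: edge_integrable_cont; exact: cst_continuous.
- apply: edge_integrable_pow => //; first exact: tent_continuous.
  by apply: le_trans (ltW p2).
- move=> x _; rewrite /tent /source /target/= subrr mul0r addr0.
  rewrite ger0_norm//; apply: le_powR.
  + by apply: le_trans (ltW p2).
  + by rewrite mulr_ge0.
  + rewrite -natrM ler_nat /tent_height; have := ltn_ord i; have := ltn_ord j; lia.
Qed.

End Tent.

Lemma energy_negative (R : realType) (l p mu : R) : 0 < l -> 2 < p -> p < 4 -> 0 < mu ->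
  exists v : edge -> R -> R, [/\ admissible l v, gmass l v = mu & renergy l p v < 0].
Proof.
move=> l0 p2 p4 mu0; have p0 : 0 < p by apply: lt_trans p2.
have [C hC] : exists C : R, (363%N)%:R = C by eexists.
have C0 : 0 < C by rewrite -hC ltr0n.
(* The mass bound 16 C l M^4 makes [a / M^2] a lower bound for the factor [c] that normalizes the
   tent to mass [mu]. *)
pose a := Num.sqrt (mu / (16 * C * l)).
have aC : 0 < 16 * C * l by rewrite !mulr_gt0.
have a0 : 0 < a by rewrite sqrtr_gt0 divr_gt0.
(* After a factor c^2/p is taken out, the kinetic side is at most of order M^2 and the potential
   side at least of order M^(6-p); [T] is the value that M^(4-p) has to exceed. *)
pose T := p * C / (2 * l ^+ 2 * 2 `^ p * a `^ (p - 2)).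
have T0 : 0 < T.
  by rewrite divr_gt0 ?mulr_gt0 ?powR_gt0 ?exprn_gt0.
have q0 : 0 < 4 - p by rewrite subr_gt0.
pose M := (Num.truncn ((T + 1) `^ (4 - p)^-1)).+1.
pose x : R := M%:R; have x0 : 0 < x by rewrite ltr0n.
have Mx : (T + 1) `^ (4 - p)^-1 < x.
  by have /andP[] := truncn_itv (powR_ge0 (T + 1) (4 - p)^-1).
have Ty : T < x `^ (4 - p).
  apply: (@lt_le_trans _ _ (T + 1)); first by rewrite ltrDl.
  have -> : T + 1 = ((T + 1) `^ (4 - p)^-1) `^ (4 - p).
    by rewrite -powRrM mulVf ?gt_eqF// powRr1// addr_ge0// ltW.
  by apply: le_powR; [exact: ltW|exact: powR_ge0|exact: ltW].
have M0 : (0 < M)%N by [].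
have [at_ mt kt] := tent_admissible l0 M0 hC; have pt := tent_pot l0 M0 p2.
set v := tent l M in at_ mt kt pt.
have P0 : 0 < gpot l p v.
  apply: lt_le_trans pt; rewrite !mulr_gt0 ?exprn_gt0// powR_gt0//.
  by rewrite mulr_gt0.
have m0 : 0 < gmass l v.
  rewrite lt_def gmass_ge0 andbT; apply/eqP => mE.
  have [B B0 hB] := adm_bounded l0 at_.
  have [_] := gpot_bound l0 p2 at_ hB; rewrite mE mulr0.
  by apply/negP; rewrite -ltNge.
pose c := Num.sqrt (mu / gmass l v).
have c0 : 0 < c by rewrite sqrtr_gt0 divr_gt0.
have [a1 e1 e2 e3] := admZ l0 p2 c at_.
exists (fun e y => c * v e y); split=> //.
  by rewrite e1 sqr_sqrtr ?divfK ?gt_eqF// divr_ge0// ltW.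
rewrite /renergy e2 e3 (gtr0_norm c0) powR_split ?(ltW c0)//.
have ca : a / x ^+ 2 <= c.
  have x20 : 0 < x ^+ 2 by rewrite exprn_gt0.
  have ax0 : 0 <= a / x ^+ 2 by rewrite divr_ge0// ltW.
  rewrite -(ger0_norm ax0) -sqrtr_sqr ler_wsqrtr//.
  rewrite expr_div_n sqr_sqrtr; last by rewrite divr_ge0// ltW.
  rewrite -exprM -[leLHS]mulrA -invfM ler_wpM2l ?(ltW mu0)//.
  by rewrite lef_pV2 ?posrE// !mulr_gt0 ?exprn_gt0.
have cp : (a / x ^+ 2) `^ (p - 2) <= c `^ (p - 2).
  by apply: le_powR => //; [rewrite subr_ge0 ltW|rewrite divr_ge0 ?exprn_ge0 ?(ltW x0) ?(ltW a0)].
have xE : (a / x ^+ 2) `^ (p - 2) * x `^ p = a `^ (p - 2) * x `^ (4 - p).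
  rewrite powRM ?invr_ge0 ?exprn_ge0 ?(ltW x0) ?(ltW a0)//.
  have -> : (x ^+ 2)^-1 `^ (p - 2) = x `^ (- (2 * (p - 2))).
    by rewrite -powR_mulrn ?(ltW x0)// -powRN -powRrM mulNr.
  rewrite -mulrA -powRD; last by rewrite (gt_eqF x0)/= implybT.
  by congr (_ * _ `^ _); ring.
have key : p * (C * x ^+ 2 / l) / 2 < c `^ (p - 2) * gpot l p v.
  apply: (@lt_le_trans _ _ ((a / x ^+ 2) `^ (p - 2) * (l * x ^+ 2 * (2 * x) `^ p))).
    rewrite powRM ?(ltW x0)//.
    have -> : (a / x ^+ 2) `^ (p - 2) * (l * x ^+ 2 * (2 `^ p * x `^ p)) =
      l * x ^+ 2 * 2 `^ p * ((a / x ^+ 2) `^ (p - 2) * x `^ p) by ring.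
    rewrite xE; move: Ty; rewrite /T ltr_pdivrMr; last first.
      by rewrite !mulr_gt0 ?powR_gt0 ?exprn_gt0.
    move=> Ty; rewrite ltr_pdivrMr//.
    have -> : p * (C * x ^+ 2 / l) = x ^+ 2 / l * (p * C) by ring.
    apply: (@lt_le_trans _ _ (x ^+ 2 / l *
      (x `^ (4 - p) * (2 * l ^+ 2 * 2 `^ p * a `^ (p - 2))))).
      by rewrite ltr_pM2l// divr_gt0// exprn_gt0.
    by rewrite le_eqVlt; apply/orP; left; apply/eqP; field; rewrite gt_eqF.
  apply: ler_pM => //; first exact: powR_ge0.
  by rewrite !mulr_ge0 ?exprn_ge0 ?powR_ge0 ?(ltW l0) ?(ltW x0).
have -> : c ^+ 2 * gkin l v / 2 - c `^ (p - 2) * c ^+ 2 * gpot l p v / p =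
  c ^+ 2 / p * (p * gkin l v / 2 - c `^ (p - 2) * gpot l p v).
  by field; rewrite gt_eqF.
rewrite pmulr_rlt0; last by rewrite divr_gt0// exprn_gt0.
rewrite subr_lt0; apply: le_lt_trans key.
by rewrite ler_wpM2r ?invr_ge0// ler_wpM2l// ltW.
Qed.

(** * Hat functions *)

Lemma sum_delta (R : pzRingType) (n i : nat) (F : nat -> R) : (i < n)%N ->
  \sum_(0 <= j < n) F j * (j == i)%:R = F i.
Proof.
move=> h; rewrite big_mkord (bigD1 (Ordinal h))//= eqxx mulr1 big1 ?addr0// => j.
by rewrite -val_eqE/= => /negbTE ->; rewrite mulr0.
Qed.

Section Hat.
Context {R : realType} (l : R) (l0 : 0 < l) (k i : nat) (i0 : (0 < i)%N) (ik : (i < 2 ^ k)%N).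

Let h : R := l / 2 ^+ k.
Let c := dyadic l k i.

Let h0 : 0 < h. Proof. by rewrite divr_gt0// exprn_gt0. Qed.

Definition hat (x : R) : R := Num.max 0 (1 - `|x - dyadic l k i| / (l / 2 ^+ k)).

Lemma hat_itv x : 0 <= hat x <= 1.
Proof.
by rewrite /hat le_max lexx/= ge_max ler01/= gerBl divr_ge0// ltW.
Qed.

Lemma hat_continuous : continuous hat.
Proof.
have cg : continuous (fun x : R => 1 - `|x - dyadic l k i| / (l / 2 ^+ k)).
  move=> x; apply: cvgB; first exact: cvg_cst.
  apply: cvgM; last exact: cvg_cst.
  by apply: cvg_norm; apply: cvgB; [exact: cvg_id|exact: cvg_cst].
by move=> x; apply: (@continuous_max R R (fun=> 0 : R) _ x); [exact: cvg_cst|exact: cg].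
Qed.

Lemma hat_out x : h <= `|x - c| -> hat x = 0.
Proof.
by move=> hx; apply/max_idPl; rewrite subr_le0 ler_pdivlMr// mul1r.
Qed.

Let dyadicE j : dyadic l k j - c = (j%:R - i%:R) * h.
Proof. by rewrite /c /dyadic /h; ring. Qed.

Lemma hat_dyadic j : hat (dyadic l k j) = (j == i)%:R.
Proof.
have [->|ji] := eqVneq j i.
  by rewrite /hat subrr normr0 mul0r subr0; apply/max_idPr.
apply: hat_out; rewrite dyadicE normrM (gtr0_norm h0) ler_peMl ?(ltW h0)//.
rewrite -[j%:R]/((j%:Z)%:~R) -[i%:R]/((i%:Z)%:~R) -intrB -intr_norm.
by rewrite -[1]/(1%:~R) ler_int; lia.
Qed.

Lemma hat_vertex : hat 0 = 0 /\ hat l = 0.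
Proof.
have := hat_dyadic 0; have := hat_dyadic (2 ^ k).
rewrite dyadic0 dyadic_max => -> ->.
by rewrite eq_sym (gtn_eqF i0)// (gtn_eqF ik).
Qed.

Lemma hat_right z : 0 <= z - c <= h -> hat z = 1 - (z - c) / h.
Proof.
move=> /andP[z0 zh]; rewrite /hat (ger0_norm z0); apply/max_idPr.
by rewrite subr_ge0 ler_pdivrMr// mul1r.
Qed.

Lemma hat_left z : - h <= z - c <= 0 -> hat z = 1 + (z - c) / h.
Proof.
move=> /andP[z0 zh]; rewrite /hat (ler0_norm zh) mulNr opprK; apply/max_idPr.
by rewrite -lerBlDl sub0r ler_pdivlMr// mulN1r.
Qed.

(* On dyadic cells finer than level [k] the hat is affine. *)
Lemma hat_midpoint m j : (k <= m)%N ->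
  2 * hat (dyadic l m.+1 j.*2.+1) = hat (dyadic l m j) + hat (dyadic l m j.+1).
Proof.
move=> km; rewrite dyadic_mid.
set x := dyadic l m j; set y := dyadic l m j.+1.
have cE : c = dyadic l m (i * 2 ^ (m - k)).
  rewrite /c /dyadic natrM natrX -{2}(subnKC km) exprD; field.
  by rewrite !expf_neq0// pnatr_eq0.
have hE : h = (2 ^ (m - k))%:R * (l / 2 ^+ m).
  rewrite /h natrX -{2}(subnKC km) exprD; field.
  by rewrite !expf_neq0// pnatr_eq0.
set d := l / 2 ^+ m in hE; have d0 : 0 < d by rewrite divr_gt0// exprn_gt0.
have xy : y = x + d by rewrite /y dyadicS.
pose u : int := j%:Z - (i * 2 ^ (m - k))%:Z.
pose w : nat := (2 ^ (m - k))%N.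
have w0 : (0 < w)%N by rewrite expn_gt0.
have xc : x - c = u%:~R * d.
  by rewrite cE /x /dyadic /u intrB /d; ring.
have yc : y - c = (u + 1)%:~R * d.
  by rewrite xy addrAC xc intrD; ring.
have mc : (x + y) / 2 - c = ((x - c) + (y - c)) / 2 by field.
have ud (a : int) : a%:~R * d <= h = (a <= w%:Z) /\ h <= a%:~R * d = (w%:Z <= a).
  by rewrite hE -/w !ler_pM2r// -[w%:R]/((w%:Z)%:~R) !ler_int.
have ud' (a : int) : a%:~R * d <= - h = (a <= - w%:Z) /\ - h <= a%:~R * d = (- w%:Z <= a).
  by rewrite hE -/w -mulNr !ler_pM2r// -[w%:R]/((w%:Z)%:~R) -intrN !ler_int.
have du (a : int) : (0 <= a%:~R * d) = (0 <= a) /\ (a%:~R * d <= 0) = (a <= 0).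
  by rewrite pmulr_lge0// pmulr_lle0// ler0z lerz0.
have [wu|uw] := leP w%:Z u.
  have h1 : h <= x - c by rewrite xc (ud u).2.
  have h2 : h <= y - c by rewrite xy; move: h1; lra.
  rewrite !hat_out ?mulr0 ?addr0//; do ?by apply: le_trans (ler_norm _).
  by apply: le_trans (ler_norm _); rewrite mc; lra.
have [u0|u0] := leP 0 u.
  have h1 : 0 <= x - c by rewrite xc (du u).1.
  have h2 : y - c <= h by rewrite yc (ud _).1; lia.
  have hx : 0 <= x - c <= h by apply/andP; split; move: h1 h2 xy d0; lra.
  have hy : 0 <= y - c <= h by apply/andP; split; move: h1 h2 xy d0; lra.
  have hm : 0 <= (x + y) / 2 - c <= h.
    by rewrite mc; apply/andP; split; move: h1 h2 xy d0; lra.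
  by rewrite (hat_right hx) (hat_right hy) (hat_right hm) mc; field; rewrite gt_eqF.
have [wu|{}uw] := leP (- w%:Z) u.
  have h1 : - h <= x - c by rewrite xc (ud' u).2.
  have h2 : y - c <= 0 by rewrite yc (du _).2; lia.
  have hx : - h <= x - c <= 0 by apply/andP; split; move: h1 h2 xy d0; lra.
  have hy : - h <= y - c <= 0 by apply/andP; split; move: h1 h2 xy d0; lra.
  have hm : - h <= (x + y) / 2 - c <= 0.
    by rewrite mc; apply/andP; split; move: h1 h2 xy d0; lra.
  by rewrite (hat_left hx) (hat_left hy) (hat_left hm) mc; field; rewrite gt_eqF.
have h2 : y - c <= - h by rewrite yc (ud' _).1; lia.
have hN z : z - c <= - h -> hat z = 0.
  by move=> hz; apply: hat_out; rewrite -normrN; apply: le_trans (ler_norm _); lra.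
by rewrite !hN ?mulr0 ?addr0// ?mc; move: h2 xy d0; lra.
Qed.

(** Increments finer than level k see only second differences at cell midpoints, and those of the
    hat vanish. *)
Lemma hat_incr_fine m (f : R -> R) (s : R) : (k < m)%N ->
  dyadic_incr l m (fun x => f x + s * hat x) = dyadic_incr l m f.
Proof.
case: m => // m km; rewrite /=; apply: eq_bigr => j _; congr (_ ^+ 2 * _).
have := hat_midpoint j km.
move: (hat _) (hat _) (hat _) => a b d hm.
have -> : b = 2 * d - a by rewrite hm addrK.
by ring.
Qed.

(** Only the two cells around the node change: the difference of the function gains s on cell i - 1
    and loses s on cell i. *)
Lemma hat_energy (f : R -> R) (s : R) :
  dyadic_energy l k (fun x => f x + s * hat x) = dyadic_energy l k f +
  (2 * s * (2 * f (dyadic l k i) - f (dyadic l k i.-1) - f (dyadic l k i.+1)) +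
   2 * s ^+ 2) / (l / 2 ^+ k).
Proof.
have i1 : i.-1.+1 = i by rewrite prednK.
pose D j := f (dyadic l k j.+1) - f (dyadic l k j).
have E j : (f (dyadic l k j.+1) + s * hat (dyadic l k j.+1) -
   (f (dyadic l k j) + s * hat (dyadic l k j))) ^+ 2 * (2 ^+ k / l) =
  D j ^+ 2 * (2 ^+ k / l) +
  ((2 * s * D j + s ^+ 2) * (2 ^+ k / l) * (j == i.-1)%:R +
   (- 2 * s * D j + s ^+ 2) * (2 ^+ k / l) * (j == i)%:R).
  rewrite !hat_dyadic -{1}i1 eqSS /D.
  have [->|ji] := eqVneq j i.
    have -> : (i == i.-1) = false by apply/negbTE; rewrite neq_ltn ltn_predL i0 orbT.
    by rewrite !mulr0n !mulr1n; ring.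
  have [->|ji'] := eqVneq j i.-1; first by rewrite !mulr0n !mulr1n; ring.
  by rewrite !mulr0n; ring.
rewrite /dyadic_energy (eq_bigr _ (fun j _ => E j)) !big_split/=.
rewrite !sum_delta//; last by rewrite i1 ltnW.
rewrite /D i1; congr (_ + _); field.
by rewrite expf_neq0 ?pnatr_eq0//= gt_eqF.
Qed.

Lemma hat_int : edge_int l hat <= 2 * (l / 2 ^+ k).
Proof.
have ch := @continuous_integrable R hat _ _ hat_continuous.
have i1 : 1 <= i%:R :> R by rewrite ler1n.
have ik1 : i%:R + 1 <= 2 ^+ k :> R by rewrite natr1 -natrX ler_nat.
have cE : c = i%:R * h by rewrite /c /dyadic /h; ring.
have lE : l = 2 ^+ k * h by rewrite /h mulrCA divff ?mulr1// expf_neq0// pnatr_eq0.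
rewrite /edge_int (@Rintegral_subset _ `[c - h, c + h]); last 2 first.
- move=> x /=; rewrite !in_itv/= => /andP[x1 x2]; apply/andP; split.
    by apply: le_trans x1; rewrite cE subr_ge0 ler_peMl// ltW.
  apply: le_trans x2 _; rewrite cE [leRHS]lE -[X in _ + X]mul1r -mulrDl.
  by rewrite ler_wpM2r// ltW.
- move=> x _; rewrite /= in_itv/= => /negP hx; apply: hat_out.
  rewrite leNgt; apply: contra hx; rewrite ltr_distl => /andP[x1 x2].
  by apply/andP; split; lra.
apply: (@le_trans _ _ (\int[lebesgue_measure]_(x in `[(c - h)%R, (c + h)%R]) 1)%R).
  apply: le_Rintegral => //.
  - by apply: continuous_integrable; exact: cst_continuous.
  - by move=> x _; have /andP[] := hat_itv x.
rewrite Rintegral_cst//= lebesgue_measure_itv/= lte_fin.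
have -> : c - h < c + h by move: h0; lra.
by rewrite /= mul1r -/h; lra.
Qed.

End Hat.

(** * Variation of a minimizer along hats *)

Lemma tsum_modify (R : realType) (J : choiceType) (A : {fset J}) (f g : J -> R) :
  summable_ge0 f -> summable_ge0 g -> (forall j, j \notin A -> g j = f j) ->
  tsum g = tsum f + \sum_(j <- A) (g j - f j).
Proof.
move=> sf sg fg; rewrite (tsum_split A sf).2 (tsum_split A sg).2 sumrB.
have -> : fset_out A g = fset_out A f.
  by apply/funext => j; rewrite /fset_out; case: ifPn => // /fg.
by ring.
Qed.

Section Spike.
Context {R : realType} (l p : R) (l0 : 0 < l) (p2 : 2 < p) (p4 : p < 4).
Context (k i : nat) (i0 : (0 < i)%N) (ik : (i < 2 ^ k)%N) (e : edge).
Implicit Types v : edge -> R -> R.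

Let h : R := l / 2 ^+ k.
Let h0 : 0 < h. Proof. by rewrite divr_gt0// exprn_gt0. Qed.

(** As 0 < i < 2^k, the hat vanishes at both ends of the edge, so the extension by 0 is compatible
    at the vertices. *)
Definition spike (f : edge) (x : R) : R := if f == e then hat l k i x else 0.

Lemma spike_admissible : admissible l spike.
Proof.
have out f : f != e -> spike f = fun=> 0.
  by move=> fe; apply/funext => x; rewrite /spike (negbTE fe).
have inn : spike e = hat l k i by apply/funext => x; rewrite /spike eqxx.
split.
- move=> f; have [->|/out ->] := eqVneq f e; last exact: cst_continuous.
  by rewrite inn; exact: hat_continuous.
- exists (fun=> 0) => f; have [h1 h2] := hat_vertex l0 i0 ik.
  by rewrite /spike h1 h2; case: ifP.
- apply: (tsum_fin (A := [fset e]%fset) _ _).1 => [f|f]; first exact: edge_mass_ge0.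
  rewrite inE => /out fe; rewrite /mass_family fe /edge_mass edge_int_cst//.
  by rewrite expr0n mul0r.
- apply: (tsum_fin (A := [fset (e, val j) | j in 'I_k.+1]%fset) _ _).1 => [q|[f m] hq].
    exact: dyadic_incr_ge0.
  have z0 : dyadic_incr l m (fun=> 0 : R) = 0.
    by have := dyadic_incrZ l m 0 (fun=> 0 : R); rewrite expr2 !mul0r.
  rewrite /kin_family /=; have [fe|/out ->//] := eqVneq f e.
  rewrite fe inn; have km : (k < m)%N.
    rewrite ltnNge; apply: contra hq => mk; have mk' : (m < k.+1)%N by rewrite ltnS.
    by apply/imfsetP; exists (Ordinal mk') => //=; rewrite fe.
  rewrite -[RHS]z0 -(hat_incr_fine l0 i0 ik (fun=> 0) 1 km).
  by congr dyadic_incr; apply/funext => x; rewrite add0r mul1r.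
Qed.

Definition perturb (s : R) v f x := v f x + s * spike f x.

Lemma perturb_admissible s v : admissible l v -> admissible l (perturb s v).
Proof.
move=> av; have [as_ _ _ _] := admZ l0 p2 s spike_admissible.
exact: (admD l0 p2 av as_).
Qed.

Lemma perturb_out s v f : f != e -> perturb s v f = v f.
Proof.
by move=> fe; apply/funext => x; rewrite /perturb /spike (negbTE fe) mulr0 addr0.
Qed.

Lemma perturb_in s v : perturb s v e = fun x => v e x + s * hat l k i x.
Proof. by apply/funext => x; rewrite /perturb /spike eqxx. Qed.

Definition second_diff (f : R -> R) : R :=
  2 * f (dyadic l k i) - f (dyadic l k i.-1) - f (dyadic l k i.+1).

(** The increments up to level k add up to the dyadic energy of level k and the finer ones are
    unchanged, so the expansion in s is exact. *)
Lemma perturb_kin s v : admissible l v -> gkin l (perturb s v) =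
  gkin l v + (2 * s * second_diff (v e) + 2 * s ^+ 2) / h.
Proof.
move=> av; have [_ _ _ sv] := av; have [_ _ _ sp] := perturb_admissible s av.
pose A := [fset (e, val j) | j in 'I_k.+1]%fset.
rewrite /gkin (tsum_modify (A := A) sv sp); last first.
  move=> [f m] hq; rewrite /kin_family /=.
  have [fe|fe] := eqVneq f e; last by rewrite perturb_out.
  rewrite fe perturb_in hat_incr_fine// ltnNge; apply: contra hq => mk.
  have mk' : (m < k.+1)%N by rewrite ltnS.
  by apply/imfsetP; exists (Ordinal mk') => //=; rewrite fe.
congr (_ + _); rewrite /A big_imfset/=; last by move=> ? ? _ _ [] /val_inj.
rewrite big_enum/= sumrB /kin_family/= perturb_in.
rewrite -(big_mkord xpredT (fun j => dyadic_incr l j (fun x => v e x + s * hat l k i x))).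
rewrite -(big_mkord xpredT (fun j => dyadic_incr l j (v e))) -!dyadic_energyE//.
by rewrite hat_energy// /second_diff -/h addrAC subrr add0r.
Qed.

Let d (s : R) := `|s| * (2 * h).

Let hi := edge_integrable_cont l (hat_continuous (l := l) (k := k) (i := i)).

Let hat_dom (s : R) : `|s| * edge_int l (hat l k i) <= d s.
Proof. by rewrite ler_wpM2l//; exact: hat_int. Qed.

Lemma perturb_mass s v (B : R) : admissible l v -> `|s| <= 1 ->
  (forall x : R, 0 <= x <= l -> `|v e x| <= B) ->
  `|gmass l (perturb s v) - gmass l v| <= (2 * B + 1) * d s.
Proof.
move=> av s1 vB; have [cv _ sv _] := av; have [cp _ sp _] := perturb_admissible s av.
have B0 : 0 <= B.
  by apply: le_trans (normr_ge0 (v e 0)) (vB _ _); rewrite lexx ltW.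
rewrite /gmass (tsum_modify (A := [fset e]%fset) sv sp); last first.
  by move=> f; rewrite inE => fe; rewrite /mass_family perturb_out.
rewrite addrAC subrr add0r big_seq_fset1 /mass_family.
apply: (@le_trans _ _ ((2 * B + 1) * (`|s| * edge_int l (hat l k i)))); last first.
  by rewrite ler_wpM2l// addr_ge0// mulr_ge0.
rewrite mulrA -edge_intZ//.
have isq (f : R -> R) : continuous f -> edge_integrable l (fun x => f x ^+ 2).
  by move=> cf; exact/edge_integrable_cont/continuous_sqr.
have ih := edge_integrableZ ((2 * B + 1) * `|s|) hi.
have key x : 0 <= x <= l -> `|perturb s v e x ^+ 2 - v e x ^+ 2| <=
    (2 * B + 1) * `|s| * hat l k i x.
  move=> hx; rewrite perturb_in.
  have /andP[z0 z1] := hat_itv l0 k i x.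
  have -> : (v e x + s * hat l k i x) ^+ 2 - v e x ^+ 2 =
    s * (hat l k i x * (2 * v e x + s * hat l k i x)) by ring.
  rewrite !normrM (ger0_norm z0) -mulrA [leRHS]mulrC -mulrA ler_wpM2l//.
  rewrite ler_wpM2l//.
  have := ler_normD (2 * v e x) (s * hat l k i x).
  rewrite !normrM (ger0_norm z0) (ger0_norm (ler0n _ 2)).
  have : `|s| * hat l k i x <= 1 by rewrite mulr_ile1.
  have := vB x hx; lra.
rewrite ler_norml; apply/andP; split.
  rewrite lerBrDl -lerBrDr opprK -edge_intD//; last exact: isq.
  apply: le_edge_int; [exact: isq| |move=> x /key].
    by apply: edge_integrableD => //; exact: isq.
  by rewrite ler_norml => /andP[+ _]; lra.
rewrite lerBlDl -edge_intD//; last exact: isq.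
apply: le_edge_int; [exact: isq| |move=> x /key].
  by apply: edge_integrableD => //; exact: isq.
by rewrite ler_norml => /andP[_]; lra.
Qed.

Lemma perturb_pot s v (B : R) : admissible l v -> `|s| <= 1 ->
  (forall x : R, 0 <= x <= l -> `|v e x| <= B) ->
  gpot l p v <= gpot l p (perturb s v) +
    (1 + 15 * (B + 1) `^ (p - 2) * (B + 1)) * d s.
Proof.
move=> av s1 vB; have [cv _ _ _] := av; have [cp _ _ _] := perturb_admissible s av.
have sv := adm_pot l0 p2 av; have sp := adm_pot l0 p2 (perturb_admissible s av).
have B0 : 0 <= B.
  by apply: le_trans (normr_ge0 (v e 0)) (vB _ _); rewrite lexx ltW.
have p0 : 0 <= p by apply: le_trans (ltW p2).
pose C := 1 + 15 * (B + 1) `^ (p - 2) * (B + 1).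
have C0 : 0 <= C by rewrite !addr_ge0// !mulr_ge0 ?powR_ge0// addr_ge0.
rewrite -/C /gpot (tsum_modify (A := [fset e]%fset) sp sv); last first.
  by move=> f; rewrite inE => fe; rewrite /pot_family perturb_out.
rewrite lerD2l big_seq_fset1 /pot_family lerBlDl.
apply: (@le_trans _ _ (edge_pot l p (perturb s v e) + C * (`|s| * edge_int l (hat l k i)))); last first.
  by rewrite lerD2l ler_wpM2l.
rewrite mulrA -edge_intZ// -edge_intD; last 2 first.
- exact: edge_integrable_pow.
- exact: edge_integrableZ.
apply: le_edge_int.
- exact: edge_integrable_pow.
- by apply: edge_integrableD; [exact: edge_integrable_pow|exact: edge_integrableZ].
move=> x hx; rewrite perturb_in.
have /andP[z0 z1] := hat_itv l0 k i x.
set z := hat l k i x in z0 z1 *; set y := v e x + s * z.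
have sz1 : `|s| * z <= 1 by rewrite mulr_ile1.
have yB : `|y| <= B + 1.
  apply: le_trans (ler_normD _ _) _; rewrite normrM (ger0_norm z0).
  by apply: lerD => //; exact: vB.
(* The old value is written as the new value [y] minus [s * z], so that the power inequality bounds
   the old potential by the new one. *)
apply: (@le_trans _ _ ((`|y| + `|s| * z) `^ p)).
  apply: le_powR => //; have -> : v e x = y - s * z by rewrite /y addrK.
  by apply: le_trans (ler_normB _ _) _; rewrite normrM (ger0_norm z0).
apply: le_trans (powR_add_le p2 p4 _ _ yB _) _ => //.
- by rewrite mulr_ge0.
- by apply: le_trans sz1 _; rewrite lerDr.
have sz0 : 0 <= `|s| * z by rewrite mulr_ge0.
have h1 : (`|s| * z) `^ p <= `|s| * z.
  have [->|sN0] := eqVneq (`|s| * z) 0.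
    by rewrite powR0// gt_eqF// (lt_trans _ p2).
  by apply: ge1r_powR; [rewrite lt_def sN0 sz0|apply: le_trans (ltW p2); rewrite ler1n].
have h2 : 15 * (B + 1) `^ (p - 2) * (`|y| * (`|s| * z)) <=
    15 * (B + 1) `^ (p - 2) * ((B + 1) * (`|s| * z)).
  by rewrite ler_wpM2l ?mulr_ge0 ?powR_ge0// ler_wpM2r.
rewrite /C; move: h1 h2; set c1 := 15 * _; move: c1 => c1 h1 h2.
have -> : (1 + c1 * (B + 1)) * `|s| * z = `|s| * z + c1 * ((B + 1) * (`|s| * z)) by ring.
by move: h1 h2; lra.
Qed.

End Spike.

(* [d] bounds the size of the perturbation, [D] is the second difference. *)
Lemma euler_lagrange_arith (R : realFieldType) (D s h d C1 C2 I mu p t K0 P0 P M : R) :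
  0 < p -> 0 < mu -> 0 < h -> 0 <= P0 -> 0 <= P -> 0 <= C2 -> 0 <= d ->
  K0 / 2 - P0 / p = I -> I <= 0 -> `|M - mu| <= C1 * d -> C1 * d <= mu ->
  1 - C1 * d / mu <= t -> P0 <= P + C2 * d ->
  (t - 1) * P / p <= (K0 + (2 * s * D + 2 * s ^+ 2) / h) / 2 - P / p - I / mu * M ->
  - (((C1 / mu) * (P0 / p) + C2 / p - I * (C1 / mu)) * d) <= (s * D + s ^+ 2) / h.
Proof.
move=> p0 mu0 h0 P00 P1 C20 d0 EI I0 HM C1d ht HP H.
set eps := C1 * d / mu in ht.
have e1 : eps <= 1 by rewrite ler_pdivrMr// mul1r.
have e0 : 0 <= eps by rewrite divr_ge0// ?(ltW mu0)//; apply: le_trans HM.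
have tP : P0 - eps * P0 - C2 * d <= t * P.
  apply: (@le_trans _ _ ((1 - eps) * P)); last by rewrite ler_wpM2r.
  apply: (@le_trans _ _ ((1 - eps) * (P0 - C2 * d))).
    have : 0 <= eps * (C2 * d) by apply: mulr_ge0 => //; exact: mulr_ge0.
    by lra.
  by rewrite ler_wpM2l; lra.
have IM : - (I / mu * M) <= - I - I * eps.
  have -> : I / mu * M = I + I / mu * (M - mu) by field; rewrite gt_eqF.
  have : I / mu * (C1 * d) <= I / mu * (M - mu).
    rewrite ler_wnM2l//; first by rewrite mulr_le0_ge0// invr_ge0 ltW.
    by apply: le_trans (ler_norm _) HM.
  have -> : I / mu * (C1 * d) = I * eps by rewrite /eps; field; rewrite gt_eqF.
  by lra.
have tPp : (P0 - eps * P0 - C2 * d) / p <= t * P / p by rewrite ler_wpM2r// invr_ge0 ltW.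
have -> : ((C1 / mu) * (P0 / p) + C2 / p - I * (C1 / mu)) * d =
    (eps * P0 + C2 * d) / p - I * eps by rewrite /eps; field; rewrite !gt_eqF.
have E1 : (P0 - eps * P0 - C2 * d) / p = P0 / p - (eps * P0 + C2 * d) / p by field; rewrite gt_eqF.
have E2 : (t - 1) * P / p = t * P / p - P / p by field; rewrite gt_eqF.
have E3 : (K0 + (2 * s * D + 2 * s ^+ 2) / h) / 2 = K0 / 2 + (s * D + s ^+ 2) / h.
  by field; rewrite gt_eqF.
rewrite E2 E3 in H; rewrite E1 in tPp.
move: H IM tPp EI; set x1 := I * eps; set x2 := I / mu * M; set x3 := _ / h.
set x4 := t * P / p; set x5 := P / p; set x6 := P0 / p; set x7 := (_ + _) / p.
by lra.
Qed.

(** Take s = t and s = -t, divide by t and let t tend to 0: the quadratic term disappears and the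
    two signs give the absolute value. *)
Lemma second_diff_arith (R : realFieldType) (D h C s0 : R) : 0 < s0 -> 0 < h ->
  (forall s : R, `|s| <= s0 -> - (C * (`|s| * (2 * h))) <= (s * D + s ^+ 2) / h) ->
  `|D| <= 2 * C * h ^+ 2.
Proof.
move=> s00 h0 H; apply/ler_addgt0Pr => e e0.
pose t := Num.min s0 e.
have t0 : 0 < t by rewrite lt_min s00.
have ts : t <= s0 by rewrite ge_min lexx.
have te : t <= e by rewrite ge_min lexx orbT.
have key (s : R) : `|s| = t -> - (s * D) <= t * (2 * C * h ^+ 2 + e).
  move=> st; have := H s; rewrite st => /(_ ts).
  rewrite ler_pdivlMr// -real_normK ?num_real// st => h1.
  have : t * t <= t * e by rewrite ler_wpM2l// ltW.
  by rewrite expr2 in h1; move: h1; lra.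
rewrite -(ler_pM2l t0) -{1}(gtr0_norm t0) -normrM.
rewrite ler_norml; apply/andP; split.
  by have := key t (gtr0_norm t0); lra.
have := key (- t); rewrite normrN (gtr0_norm t0) => /(_ erefl); lra.
Qed.

Lemma pos_of_near (R : realFieldType) (x y M : R) : 0 < y -> `|M - y| <= x -> x <= y / 2 -> 0 < M.
Proof. by move=> y0; rewrite ler_norml => /andP[+ _]; lra. Qed.

(** For 2 < p < 4 the exponent p/2 - 1 lies between 0 and 1, so a ratio below 1 can only increase
    when raised to it, and the ratio itself is at least 1 - eps. *)
Lemma scaling_factor_ge (R : realType) (p mu M eps : R) : 2 < p -> p < 4 -> 0 < mu -> 0 < M ->
  `|M - mu| <= eps * mu -> 1 - eps <= (mu / M) `^ (p / 2 - 1).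
Proof.
move=> p2 p4 mu0 M0 HM; have e0 : 0 <= eps.
  by rewrite -(pmulr_lge0 _ mu0); apply: le_trans HM.
have q0 : 0 <= p / 2 - 1 by lra.
have q1 : p / 2 - 1 <= 1 by lra.
have [r1|r1] := leP 1 (mu / M).
  apply: (@le_trans _ _ (1 `^ (p / 2 - 1))); first by rewrite powR1 gerBl.
  by apply: le_powR => //; rewrite ler01.
have r0 : 0 < mu / M by rewrite divr_gt0.
apply: (@le_trans _ _ (mu / M)); last first.
  rewrite -[X in X <= _]powRr1 ?(ltW r0)//.
  by apply: ger_powR => //; rewrite r0 ltW.
rewrite ler_pdivlMr//.
have : M - mu <= eps * mu by apply: le_trans (ler_norm _) HM.
have : 1 * M > mu by move: r1; rewrite ltr_pdivrMr.
move=> h1 h2; have : eps * mu <= eps * M by rewrite ler_wpM2l//; move: h1; lra.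
by move: h2; lra.
Qed.

(* Testing minimality against hats supported in two dyadic cells gives the
   Euler-Lagrange equation in finite-difference form. *)
Lemma minimizer_second_diff (R : realType) (l p mu I : R) (v : edge -> R -> R) :
  0 < l -> 2 < p -> p < 4 -> 0 < mu ->
  (forall w, admissible l w -> gmass l w = mu -> I <= renergy l p w) -> I <= 0 ->
  admissible l v -> gmass l v = mu -> renergy l p v = I ->
  exists2 C : R, 0 <= C & forall e k i, (0 < i)%N -> (i < 2 ^ k)%N ->
    `|second_diff l k i (v e)| <= C * (l / 2 ^+ k) ^+ 2.
Proof.
move=> l0 p2 p4 mu0 I_lb I0 av mv ev.
have [B B0 vB] := adm_bounded l0 av.
pose C1 := 2 * B + 1; pose C2 := 1 + 15 * (B + 1) `^ (p - 2) * (B + 1).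
have p0 : 0 < p by apply: lt_trans p2.
have C10 : 0 < C1 by rewrite ltr_wpDl// mulr_ge0.
have C20 : 0 <= C2 by rewrite !addr_ge0// !mulr_ge0 ?powR_ge0// addr_ge0.
have P0 := gpot_ge0 l p v.
exists (2 * ((C1 / mu) * (gpot l p v / p) + C2 / p - I * (C1 / mu))).
  rewrite mulr_ge0// subr_ge0; apply: (@le_trans _ _ 0).
    by rewrite mulr_le0_ge0// divr_ge0// ltW.
  by rewrite addr_ge0// ?mulr_ge0// ?invr_ge0// ltW.
move=> e k i i0 ik; set h := l / 2 ^+ k.
have h0 : 0 < h by rewrite divr_gt0// exprn_gt0.
(* The bound 1 serves the perturbation estimates; the other one keeps the change of mass below mu/2,
   so that the perturbed function can be rescaled. *)
pose s0 := Num.min 1 (mu / (2 * (C1 * (2 * h)))).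
have q0 : 0 < 2 * (C1 * (2 * h)) by rewrite !mulr_gt0.
have s00 : 0 < s0 by rewrite lt_min ltr01 divr_gt0.
apply: (second_diff_arith s00 h0) => s hs.
have s1 : `|s| <= 1 by apply: le_trans hs _; rewrite ge_min lexx.
have C1d : C1 * (`|s| * (2 * h)) <= mu / 2.
  have : `|s| <= mu / (2 * (C1 * (2 * h))) by apply: le_trans hs _; rewrite ge_min lexx orbT.
  by rewrite ler_pdivlMr//; lra.
have HM := perturb_mass l0 p2 i0 ik av s1 (fun x hx => vB e x hx).
have HP := perturb_pot l0 p2 p4 i0 ik av s1 (fun x hx => vB e x hx).
have HK := perturb_kin l0 p2 i0 ik e s av.
have aw := perturb_admissible l0 p2 i0 ik e s av.
rewrite -/h -/C1 -/C2 mv in HM HP HK; set w := perturb _ _ _ _ _ _ in HM HP HK aw.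
have M0 : 0 < gmass l w := pos_of_near mu0 HM C1d.
(* [w] need not have mass [mu]; the scaling inequality still compares it with [I], at the price of a
   factor close to 1. *)
have := energy_scaling_sub l0 p2 mu0 I_lb aw M0 erefl.
rewrite /defect /renergy HK.
have d0 : 0 <= `|s| * (2 * h) by rewrite mulr_ge0// mulr_ge0// ltW.
have C1d' : C1 * (`|s| * (2 * h)) <= mu.
  by apply: le_trans C1d _; rewrite ler_pdivrMr// ler_peMr// ?(ltW mu0)// ler1n.
have ht : 1 - C1 * (`|s| * (2 * h)) / mu <= (mu / gmass l w) `^ (p / 2 - 1).
  by apply: (scaling_factor_ge p2 p4 mu0 M0); rewrite divfK ?gt_eqF.
exact: (euler_lagrange_arith p0 mu0 h0 P0 (gpot_ge0 l p w) C20 d0 ev I0 HM C1d' ht HP).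
Qed.

(** * Regularity from second differences *)

Lemma primitive_compact_support (R : realType) (b : R -> R) (u v : R) : continuous b ->
  (forall x : R, ~~ (u <= x <= v) -> b x = 0) -> exists F : R -> R,
    (forall x : R, is_derive x (1 : R) F (b x)) /\ forall x : R, x <= u -> F x = 0.
Proof.
move=> cb b0.
have ib : lebesgue_measure.-integrable setT (EFin \o b).
  have -> : EFin \o b = (EFin \o b) \_ `[u, v].
    apply/funext => x; rewrite patchE; case: ifPn => //= /negP xab.
    by rewrite b0//; apply/negP => xuv; apply: xab; rewrite inE/= in_itv.
  apply/integrable_restrict => //; rewrite setTI; exact: continuous_integrable.
pose F x := (\int[lebesgue_measure]_(t in `]-oo, x]) b t)%R.
exists F; split => [x|x xu].
  have [h1 h2] : derivable F x 1 /\ derive1 F x = b x.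
    apply: (@continuous_FTC1 R b -oo%O x (x + 1)).
    - by rewrite ltrDl.
    - by apply: integrableS ib.
    - by rewrite ltNyr.
    - exact: cb.
  apply: DeriveDef; first exact: h1.
  by rewrite -derive1E.
(* The hypothesis makes [b] vanish strictly to the left of u; at x = u the end point is dropped as a
   null set. *)
have [->|xu'] := eqVneq x u.
  rewrite /F -Rintegral_itv_bndo_bndc; last exact: integrableS ib.
  rewrite (@Rintegral_subset _ set0)// ?Rintegral_set0// => t /=.
  by rewrite in_itv/= => tx _; rewrite b0// negb_and -ltNge tx.
rewrite /F (@Rintegral_subset _ set0)// ?Rintegral_set0// => t /=.
rewrite in_itv/= => tx _; rewrite b0// negb_and -ltNge (le_lt_trans tx)//.
by rewrite lt_neqAle xu' xu.
Qed.

(** [g] is multiplied by a trapezoid equal to 1 on [u, v] and to 0 outside [u - 1, v + 1]; the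
    product is integrable on the line, and its primitive is differentiable everywhere, end points
    included. *)
Lemma continuous_primitive_itv (R : realType) (g : R -> R) (u v : R) : continuous g ->
  exists F : R -> R, exists b : R -> R,
  [/\ continuous b, forall x : R, u <= x <= v -> b x = g x &
      forall x : R, is_derive x (1 : R) F (b x)].
Proof.
move=> cg; pose d (x : R) := Num.max 0 (Num.max (u - x) (x - v)).
pose w (x : R) := Num.max 0 (1 - d x).
have cd : continuous d.
  move=> x; apply: (@continuous_max R R (fun=> 0 : R) (fun x => Num.max (u - x) (x - v)) x).
    exact: cvg_cst.
  apply: (@continuous_max R R (fun y => u - y) (fun y => y - v) x).
    by apply: cvgB; [exact: cvg_cst|exact: cvg_id].
  by apply: cvgB; [exact: cvg_id|exact: cvg_cst].
have cw : continuous w.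
  move=> x; apply: (@continuous_max R R (fun=> 0 : R) (fun x => 1 - d x) x); first exact: cvg_cst.
  by apply: cvgB; [exact: cvg_cst|exact: cd].
have cb : continuous (fun x => g x * w x).
  by move=> x; apply: cvgM; [exact: cg|exact: cw].
have b0 (x : R) : ~~ (u - 1 <= x <= v + 1) -> g x * w x = 0.
  move=> hx; rewrite (_ : w x = 0) ?mulr0//; apply/max_idPl.
  rewrite subr_le0 /d !le_max; move: hx; rewrite negb_and -!ltNge => /orP[] h.
    by apply/orP; right; apply/orP; left; lra.
  by apply/orP; right; apply/orP; right; lra.
have [F [dF _]] := primitive_compact_support cb b0.
exists F, (fun x => g x * w x); split => // x /andP[ux xv].
have d0 : d x = 0 by apply/max_idPl; rewrite ge_max !subr_le0 ux xv.
by rewrite /w d0 subr0 (max_idPr ler01) mulr1.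
Qed.

Lemma le_geometric_half (R : realType) (a b c : R) :
  (forall k, a <= b + c / 2 ^+ k) -> a <= b.
Proof.
move=> h; rewrite -subr_le0.
have ab : (fun=> a - b) @ \oo --> a - b by exact: cvg_cst.
have H : \forall k \near \oo, a - b <= c / 2 ^+ k by apply: nearW => k; rewrite lerBlDl.
exact: ler_cvg_to ab (geometric_half_cvg c) H.
Qed.

(** The intervals of centre u k and radius 2 c / 2^k are nested; L is the supremum of their left
    ends. *)
Lemma geometric_limit (R : realType) (u : nat -> R) (c : R) :
  (forall k, `|u k.+1 - u k| <= c / 2 ^+ k) ->
  exists L : R, forall k, `|L - u k| <= 2 * c / 2 ^+ k.
Proof.
move=> hu; pose e k := 2 * c / 2 ^+ k.
have eS k : e k = e k.+1 + c / 2 ^+ k.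
  by rewrite /e exprS; field; rewrite expf_neq0 ?pnatr_eq0.
have aS k : u k - e k <= u k.+1 - e k.+1.
  by have := hu k; rewrite ler_norml (eS k) => /andP[+ _]; lra.
have bS k : u k.+1 + e k.+1 <= u k + e k.
  by have := hu k; rewrite ler_norml (eS k) => /andP[_]; lra.
have e0 k : 0 <= e k.
  have : 0 <= c / 2 ^+ k by apply: le_trans (hu k).
  by rewrite /e -mulrA => h; rewrite mulr_ge0.
have am k n : u k - e k <= u (k + n)%N - e (k + n)%N.
  by elim: n => [|n IH]; rewrite ?addn0// addnS (le_trans IH).
have bm k n : u (k + n)%N + e (k + n)%N <= u k + e k.
  by elim: n => [|n IH]; rewrite ?addn0// addnS (le_trans (bS _)).
have ab k n : u k - e k <= u n + e n.
  have := am k n; have := bm n k; rewrite addnC; have := e0 (k + n)%N; lra.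
pose A := range (fun k => u k - e k).
have A0 : A !=set0 by exists (u 0%N - e 0%N); exists 0%N.
have Aub n : ubound A (u n + e n) by move=> _ [k _ <-]; exact: ab.
exists (sup A) => k; rewrite -/(e k) ler_norml; apply/andP; split.
  rewrite lerBrDl; apply: ub_le_sup; last by exists k.
  by exists (u 0%N + e 0%N); exact: Aub.
rewrite lerBlDl; apply: ge_sup; first exact: A0.
exact: Aub.
Qed.

Section Regularity.
Context {R : realType} (l C : R) (l0 : 0 < l) (C0 : 0 <= C) (f : R -> R).
Hypothesis cf : continuous f.
Hypothesis f2 : forall k i, (0 < i)%N -> (i < 2 ^ k)%N ->
  `|second_diff l k i f| <= C * (l / 2 ^+ k) ^+ 2.

Let h k : R := l / 2 ^+ k.
Let h0 k : 0 < h k. Proof. by rewrite divr_gt0// exprn_gt0. Qed.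
Let hS k : h k = 2 * h k.+1.
Proof. by rewrite /h exprS; field; rewrite expf_neq0 ?pnatr_eq0. Qed.

(** Bisection rather than truncation: successive cells are nested, and x = l stays in the last cell,
    so the index is always below 2^k. *)
Fixpoint cell (x : R) k : nat :=
  if k is k'.+1 then
    let i := cell x k' in if x < dyadic l k i.*2.+1 then i.*2 else i.*2.+1
  else 0%N.

Lemma cellP x k : 0 <= x <= l ->
  (cell x k < 2 ^ k)%N /\ dyadic l k (cell x k) <= x <= dyadic l k (cell x k).+1.
Proof.
move=> hx; elim: k => [|k [IH1 IH2]] /=.
  by rewrite dyadic0 -{3}(expn0 2) dyadic_max.
move/andP: IH2 => [a b]; case: ltP => hm.
  split; first by rewrite expnS; lia.
  by rewrite dyadic_double a (ltW hm).
split; first by rewrite expnS; lia.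
by rewrite hm/= -doubleS dyadic_double.
Qed.

Definition slope k i : R := (f (dyadic l k i.+1) - f (dyadic l k i)) / (l / 2 ^+ k).

Lemma slope_step k i : (i.+1 < 2 ^ k)%N -> `|slope k i.+1 - slope k i| <= C * h k.
Proof.
move=> ik; have := f2 (ltn0Sn i) ik; rewrite -/(h k) /second_diff/=.
have -> : slope k i.+1 - slope k i = - ((2 * f (dyadic l k i.+1) - f (dyadic l k i) -
    f (dyadic l k i.+2)) / h k).
  by rewrite /slope -/(h k); field; rewrite gt_eqF.
rewrite normrN normrM normfV (gtr0_norm (h0 k)) ler_pdivrMr//.
by rewrite -mulrA -expr2.
Qed.

Lemma slope_lip k i j : (i <= j < 2 ^ k)%N ->
  `|slope k j - slope k i| <= C * h k * (j - i)%:R.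
Proof.
move=> /andP[ij]; rewrite -(subnKC ij); move: (j - i)%N => n {ij}.
elim: n => [|n IH] hn; first by rewrite addn0 !subrr normr0 subnn mulr0.
rewrite addnS in hn; have := IH (ltnW hn); rewrite addnS subSn ?leq_addr// -natr1.
have := slope_step hn; set a := slope k _; set b := slope k _; set c := slope k i.
rewrite !addKn => h1 h2.
have := ler_normD (a - b) (b - c); rewrite addrA subrK; lra.
Qed.

Lemma slope_half k i :
  slope k i = (slope k.+1 i.*2 + slope k.+1 i.*2.+1) / 2.
Proof.
rewrite /slope -doubleS !dyadic_double -/(h k) -/(h k.+1) hS.
by field; rewrite gt_eqF.
Qed.

(** The slope of a cell is the mean of those of its two halves, so a half differs from it by half
    the difference of neighbouring slopes. *)
Lemma slope_cell x k : 0 <= x <= l ->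
  `|slope k.+1 (cell x k.+1) - slope k (cell x k)| <= C * l / 2 ^+ k.
Proof.
move=> hx; have [ck _] := cellP k hx.
have hk : ((cell x k).*2.+1 < 2 ^ k.+1)%N by rewrite expnS; lia.
have := slope_step hk; rewrite (slope_half k) /=.
have -> : C * l / 2 ^+ k = C * h k by rewrite /h mulrA.
set a := slope _ _; set b := slope _ _ => hab.
have E : C * h k = 2 * (C * h k.+1) by rewrite (hS k); ring.
have Ch : 0 <= C * h k.+1 by rewrite mulr_ge0// ltW.
have hab' : `|(a - b) / 2| <= C * h k.
  by rewrite normrM normfV (ger0_norm (ler0n _ 2)) ler_pdivrMr// E; lra.
case: ifP => _.
  by rewrite -/b (_ : b - _ = - ((a - b) / 2)) ?normrN//; field.
by rewrite -/a (_ : a - _ = (a - b) / 2)//; field.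
Qed.

(** Two of the three units C h come from the limit along the nested cells, the third from points
    that are a common end of two cells. *)
Lemma slope_limit : exists g : R -> R, forall (x : R) k i, 0 <= x <= l -> (i < 2 ^ k)%N ->
  dyadic l k i <= x <= dyadic l k i.+1 -> `|g x - slope k i| <= 3 * C * h k.
Proof.
have [g hg] : exists g : R -> R, forall x : R, 0 <= x <= l -> forall k,
    `|g x - slope k (cell x k)| <= 2 * (C * l) / 2 ^+ k.
  have /choice[g hg] : forall x : R, exists L : R, 0 <= x <= l -> forall k,
      `|L - slope k (cell x k)| <= 2 * (C * l) / 2 ^+ k.
    move=> x; have [hx|] := boolP (0 <= x <= l); last by exists 0.
    by have [L hL] := geometric_limit (fun k => slope_cell k hx); exists L.
  by exists g.
exists g => x k i hx ik /andP[xi1 xi2].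
have [ck /andP[c1 c2]] := cellP k hx; have := hg x hx k.
have -> : 2 * (C * l) / 2 ^+ k = 2 * C * h k by rewrite /h; ring.
move=> gk; suff : `|slope k (cell x k) - slope k i| <= C * h k.
  set s := slope k _ in gk *; set t := slope k _.
  by have := ler_normD (g x - s) (s - t); rewrite addrA subrK; lra.
have dl m n : dyadic l k m <= dyadic l k n -> (m <= n)%N.
  by rewrite /dyadic ler_pM2r ?invr_gt0 ?exprn_gt0// ler_pM2l// ler_nat.
have i1 := dl _ _ (le_trans xi1 c2); have i2 := dl _ _ (le_trans c1 xi2).
have Ch : 0 <= C * h k by rewrite mulr_ge0// ltW.
have [ic|ci] := leqP i (cell x k).
  have := @slope_lip k i (cell x k); rewrite ic ck => /(_ isT) => H.
  by apply: le_trans H _; rewrite ler_piMr// lern1; lia.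
have := @slope_lip k (cell x k) i; rewrite (ltnW ci) ik => /(_ isT).
rewrite distrC => H; apply: le_trans H _; rewrite ler_piMr// lern1; lia.
Qed.

Lemma slope_limit_lip (g : R -> R) :
  (forall (x : R) k i, 0 <= x <= l -> (i < 2 ^ k)%N ->
    dyadic l k i <= x <= dyadic l k i.+1 -> `|g x - slope k i| <= 3 * C * h k) ->
  forall x y : R, 0 <= x <= l -> 0 <= y <= l -> `|g x - g y| <= C * `|x - y|.
Proof.
move=> hg x y hx hy.
(* Seven units C h: three for replacing [g] by a slope at each point, one for counting the cells
   between the two points. *)
apply: (@le_geometric_half _ _ _ (7 * C * l)) => k.
have -> : 7 * C * l / 2 ^+ k = 7 * C * h k by rewrite /h; ring.
have [ck c12] := cellP k hx; have [dk d12] := cellP k hy.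
have gx := hg x k _ hx ck c12; have gy := hg y k _ hy dk d12.
suff : `|slope k (cell x k) - slope k (cell y k)| <= C * `|x - y| + C * h k.
  move: gx gy; set s := slope k _; set t := slope k _ => h1 h2 h3.
  have := ler_normD (g x - s) (s - t); have := ler_normB (g x - t) (g y - t).
  by rewrite addrA subrK opprB addrA subrK; lra.
move: ck dk c12 d12; move: {gx gy} (cell x k) (cell y k) => i j.
rewrite -mulrDr; wlog ij : i j x y hx hy / (i <= j)%N.
  move=> W; have [ij|/ltnW ji] := leqP i j; first exact: W.
  by move=> h1 h2 h3 h4; rewrite distrC (distrC x); apply: W.
move=> ik jk /andP[_ x2] /andP[y1 _]; rewrite distrC.
apply: le_trans (slope_lip _) _; first by rewrite ij jk.
rewrite -mulrA ler_wpM2l//.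
apply: (@le_trans _ _ (y - x + h k)); last by rewrite lerD2r distrC ler_norm.
have : (j - i)%:R * h k = dyadic l k j - dyadic l k i.
  by rewrite natrB// /dyadic /h; ring.
rewrite mulrC => ->; move: x2; rewrite dyadicS -/(h k); lra.
Qed.

(** F is the primitive of the limit slope with the value of [f] at 0. On a cell of length h the
    increments of F and [f] differ by at most 3 C h^2; over l / h cells the discrepancy is O(h), so
    it vanishes in the limit. *)
Lemma regularity : exists F g : R -> R,
  [/\ continuous g, forall x : R, is_derive x (1 : R) F (g x),
      forall x : R, 0 <= x <= l -> F x = f x &
      forall x y : R, 0 <= x <= l -> 0 <= y <= l -> `|g x - g y| <= C * `|x - y|].
Proof.
have [g0 hg] := slope_limit.
have lip := slope_limit_lip hg.
pose g1 x := g0 (clamp l x).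
have g1E x : 0 <= x <= l -> g1 x = g0 x by move=> hx; rewrite /g1 clamp_id.
have cg1 : continuous g1.
  move=> x; apply/cvgrPdist_le => e e0; near=> y.
  apply: le_trans (lip _ _ (clamp_itv _ l0) (clamp_itv _ l0)) _.
  apply: (@le_trans _ _ (C * `|x - y|)); first by rewrite ler_wpM2l// clamp_lipschitz.
  apply: (@le_trans _ _ ((C + 1) * `|x - y|)); first by rewrite ler_wpM2r// lerDl.
  rewrite mulrC -ler_pdivlMr ?ltr_wpDl//; apply: ltW; near: y.
  by apply: cvgr_dist_lt; rewrite ?divr_gt0 ?ltr_wpDl//; exact: cvg_id.
have [F0 [g [cg gE dF0]]] := continuous_primitive_itv 0 l cg1.
exists (fun x => F0 x + (f 0 - F0 0)), g; split => //.
- by move=> x; rewrite -[g x]addr0; apply: is_deriveD.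
- have cF0 : continuous F0.
    by move=> x; apply: differentiable_continuous; apply/derivable1_diffP; have [] := dF0 x.
  have incr k i : (i < 2 ^ k)%N -> `|(F0 (dyadic l k i.+1) - F0 (dyadic l k i)) -
      (f (dyadic l k i.+1) - f (dyadic l k i))| <= 3 * C * h k * h k.
    move=> ik; have dd : dyadic l k i < dyadic l k i.+1 by rewrite dyadicS ltrDl h0.
    have [c] := is_derive_MVT dF0 dd; rewrite in_itv/= => /andP[c1 c2] ->.
    have /andP[d1 d2] := dyadic_bounds (ltW l0) (ltnW ik).
    have /andP[d3 d4] := dyadic_bounds (ltW l0) ik.
    have hc : 0 <= c <= l by rewrite (le_trans d1 (ltW c1)) (le_trans (ltW c2) d4).
    rewrite gE// g1E// {1}dyadicS addrAC subrr add0r -/(h k).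
    have -> : f (dyadic l k i.+1) - f (dyadic l k i) = slope k i * h k.
      by rewrite /slope -/(h k) divfK// gt_eqF.
    rewrite -mulrBl normrM (gtr0_norm (h0 k)) ler_wpM2r ?(ltW (h0 k))//.
    by apply: hg => //; rewrite !ltW.
  have dy k i : (i <= 2 ^ k)%N -> `|(F0 (dyadic l k i) - F0 0) - (f (dyadic l k i) - f 0)| <=
      i%:R * (3 * C * h k * h k).
    elim: i => [|i IH] ik; first by rewrite dyadic0 !subrr normr0 mul0r.
    have := IH (ltnW ik); have := incr k i ik; rewrite -natr1.
    set a := F0 (dyadic l k i.+1); set b := F0 _; set c := f _; set d := f _ => h1 h2.
    have := ler_normD (a - b - (c - d)) (b - F0 0 - (d - f 0)).
    have -> : a - b - (c - d) + (b - F0 0 - (d - f 0)) = a - F0 0 - (c - f 0) by ring.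
    by lra.
  move=> x hx; have [i [hi icv]] := dyadic_floor_cvg l0 hx.
  suff : `|F0 x - F0 0 - (f x - f 0)| <= 0 by rewrite normr_le0 => /eqP H; lra.
  have cv : `|F0 (dyadic l k (i k)) - F0 0 - (f (dyadic l k (i k)) - f 0)| @[k --> \oo]
      --> `|F0 x - F0 0 - (f x - f 0)|.
    apply: cvg_norm; apply: cvgB; apply: cvgB; try exact: cvg_cst.
      by apply: continuous_cvg => //; exact: cF0.
    by apply: continuous_cvg => //; exact: cf.
  apply: (ler_cvg_to cv (geometric_half_cvg (3 * C * l * l))).
  apply: nearW => k; have [ik _] := hi k; apply: le_trans (dy k _ ik) _.
  have -> : 3 * C * l * l / 2 ^+ k = (2 ^ k)%:R * (3 * C * h k * h k).
    by rewrite natrX /h; field; rewrite expf_neq0 ?pnatr_eq0.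
  by rewrite ler_wpM2r ?ler_nat// !mulr_ge0// ltW.
- by move=> x y hx hy; rewrite !gE// !g1E//; exact: lip.
Unshelve. all: by end_near.
Qed.

End Regularity.

(** On each cell the increments of F and of a primitive H of g^2 are given by the mean value theorem
    at two different points; the Lipschitz bound on [g] compares the two values. *)
Lemma int_sqr_derivative_le (R : realType) (l C K : R) (F g : R -> R) : 0 < l ->
  continuous g -> (forall x : R, is_derive x (1 : R) F (g x)) ->
  (forall x y : R, 0 <= x <= l -> 0 <= y <= l -> `|g x - g y| <= C * `|x - y|) ->
  (forall k, dyadic_energy l k F <= K) ->
  edge_int l (fun x => g x ^+ 2) <= K.
Proof.
move=> l0 cg dF lip hK.
have [H [b [cb bE dH]]] := continuous_primitive_itv 0 l (continuous_sqr cg).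
have -> : edge_int l (fun x => g x ^+ 2) = H l - H 0.
  rewrite -(Rintegral_is_derive l0 dH cb); apply: eq_Rintegral => x.
  by rewrite inE/= in_itv/= => /bE.
have C0 : 0 <= C.
  have h : 0 <= C * `|0 - l|.
    by apply: le_trans (lip 0 l _ _); rewrite ?lexx ?(ltW l0).
  by move: h; rewrite sub0r normrN pmulr_lge0 ?normr_gt0 ?gt_eqF.
apply: (@le_geometric_half _ _ _ (H l - H 0 + C ^+ 2 * l ^+ 3)) => k.
(* [t] is both the relative mesh and the Young parameter: the error per cell is t^-1 (C l t)^2 (l
   t), and the 1/t cells add up to C^2 l^3 t. *)
pose t : R := (2 ^+ k)^-1; have t0 : 0 < t by rewrite invr_gt0 exprn_gt0.
have ht : l / 2 ^+ k = l * t by [].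
suff key : (1 - t) * (H l - H 0) <= K + C ^+ 2 * l ^+ 3 * t by rewrite -/t; move: key; lra.
have cellb i : (i < 2 ^ k)%N -> (1 - t) * (H (dyadic l k i.+1) - H (dyadic l k i)) <=
    (F (dyadic l k i.+1) - F (dyadic l k i)) ^+ 2 * (2 ^+ k / l) + C ^+ 2 * l ^+ 3 * t ^+ 2.
  move=> ik; have dd : dyadic l k i < dyadic l k i.+1.
    by rewrite dyadicS ltrDl divr_gt0// exprn_gt0.
  have [x] := is_derive_MVT dF dd; rewrite in_itv/= => /andP[x1 x2] ->.
  have [y] := is_derive_MVT dH dd; rewrite in_itv/= => /andP[y1 y2] ->.
  have /andP[d1 d2] := dyadic_bounds (ltW l0) (ltnW ik).
  have /andP[d3 d4] := dyadic_bounds (ltW l0) ik.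
  have hx : 0 <= x <= l by rewrite (le_trans d1 (ltW x1)) (le_trans (ltW x2) d4).
  have hy : 0 <= y <= l by rewrite (le_trans d1 (ltW y1)) (le_trans (ltW y2) d4).
  have dE : dyadic l k i.+1 - dyadic l k i = l * t by rewrite dyadicS addrAC subrr add0r.
  rewrite bE// dE.
  have -> : (g x * (l * t)) ^+ 2 * (2 ^+ k / l) = g x ^+ 2 * (l * t).
    by rewrite /t; field; rewrite expf_neq0 ?pnatr_eq0//= gt_eqF.
  have lt0 : 0 < l * t by rewrite mulr_gt0.
  have xy : `|g x - g y| <= C * (l * t).
    apply: le_trans (lip x y hx hy) _; rewrite ler_wpM2l// -dE ler_norml.
    by apply/andP; split; move: x1 x2 y1 y2; lra.
  have := young_sqr (g x - g y) (g y) t0; rewrite subrK => Y.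
  have sq : (g x - g y) ^+ 2 <= C ^+ 2 * l ^+ 2 * t ^+ 2.
    rewrite -!exprMn -mulrA -real_normK ?num_real// ler_sqr ?nnegrE//.
    by rewrite mulr_ge0// ltW.
  have tinv : (t^-1 - 1) * (g x - g y) ^+ 2 <= C ^+ 2 * l ^+ 2 * t.
    apply: (@le_trans _ _ (t^-1 * (g x - g y) ^+ 2)).
      by rewrite ler_wpM2r ?sqr_ge0// gerBl.
    rewrite ler_pdivrMl//; apply: le_trans sq _; rewrite le_eqVlt; apply/orP; left.
    by apply/eqP; ring.
  rewrite [leLHS]mulrA; apply: (@le_trans _ _ ((g x ^+ 2 + C ^+ 2 * l ^+ 2 * t) * (l * t))).
    by rewrite ler_wpM2r ?(ltW lt0)//; apply: le_trans Y _; rewrite lerD2l.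
  by rewrite le_eqVlt; apply/orP; left; apply/eqP; ring.
have -> : H l - H 0 = \sum_(0 <= i < 2 ^ k) (H (dyadic l k i.+1) - H (dyadic l k i)).
  by rewrite telescope_sumr// dyadic_max dyadic0.
apply: (@le_trans _ _ (dyadic_energy l k F + C ^+ 2 * l ^+ 3 * t)); last by rewrite lerD2r.
have -> : C ^+ 2 * l ^+ 3 * t = \sum_(0 <= i < 2 ^ k) (C ^+ 2 * l ^+ 3 * t ^+ 2).
  rewrite sumr_const_nat subn0 -[RHS]mulr_natr natrX /t; field.
  by rewrite expf_neq0 ?pnatr_eq0.
rewrite /dyadic_energy -big_split/= mulr_sumr !big_mkord.
by apply: ler_sum => i _; exact: cellb.
Qed.

(** * Integral estimates and the energy of a modulus *)

Lemma locally_integrable_itv (R : realType) (l x y : R) (f : R -> R) : 0 < x -> y < l ->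
  locally_integrable `]0, l[ f -> lebesgue_measure.-integrable `[x, y] (EFin \o f).
Proof.
move=> x0 yl [mf _ hf].
have sub : (`[x, y] `<=` `]0, l[)%classic.
  move=> t /=; rewrite !in_itv/= => /andP[xt ty].
  by rewrite (lt_le_trans x0)//= (le_lt_trans ty).
apply/integrableP; split; last exact: (hf _ sub (segment_compact (a := x) (b := y))).
by apply/measurable_EFinP; apply: measurable_funS mf.
Qed.

(** At a Lebesgue point the derivative of the primitive of [d] is [d], and this primitive vanishes
    nearby. As [d] is only locally integrable, this is done on compact intervals exhausting ]0,
    l[. *)
Lemma ae_zero_of_integrals (R : realType) (l : R) (d : R -> R) : 0 < l ->
  locally_integrable `]0, l[ d ->
  (forall x y : R, 0 < x -> x < y -> y < l -> (\int[lebesgue_measure]_(t in `[x, y]) d t)%R = 0) ->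
  {ae lebesgue_measure, forall t : R, `]0, l[%classic t -> d t = 0}.
Proof.
move=> l0 ld d0.
(* The shift by 3 makes [a n, l - a n] nondegenerate already for n = 0. *)
pose a n : R := l / n.+3%:R.
have a0 n : 0 < a n by rewrite divr_gt0.
have al n : a n < l - a n.
  have : l / n.+3%:R <= l / 3 by rewrite ler_wpM2l ?(ltW l0)// lef_pV2 ?posrE// ler_nat.
  by rewrite -/(a n); move: l0; lra.
have la n : l - a n < l by rewrite gtrBl.
have int n := locally_integrable_itv (a0 n) (la n) ld.
have iT n : lebesgue_measure.-integrable setT (EFin \o d \_ `[a n, l - a n]).
  by rewrite -restrict_EFin; apply/integrable_restrict => //; rewrite setTI; exact: int.
have Hn n : {ae lebesgue_measure, forall t : R, lebesgue_pt (d \_ `[a n, l - a n]) t}.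
  apply: lebesgue_differentiation; apply: integrable_locally_restrict => //.
have /ae_foralln := Hn; apply: filterS => t Ht; rewrite /= in_itv/= => /andP[t0 tl].
have [n [nt tn]] : exists n, a n < t /\ t < l - a n.
  pose m : R := Num.min t (l - t); have m0 : 0 < m by rewrite lt_min t0 subr_gt0.
  have ml0 : 0 < m / l by rewrite divr_gt0.
  have [n hn] := ltr_add_invr ml0.
  rewrite add0r in hn; exists n; have an : a n < m.
    rewrite ltr_pdivlMr// in hn; apply: le_lt_trans hn.
    by rewrite /a mulrC ler_wpM2r ?(ltW l0)// lef_pV2 ?posrE// ler_nat; lia.
  by split; move: an; rewrite lt_min => /andP[]; lra.
have tt1 : t < t + 1 by rewrite ltrDl.
have iS : lebesgue_measure.-integrable `]-oo, (t : R) + 1] (EFin \o d \_ `[a n, l - a n]).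
  by apply: integrableS (iT n).
have [|_] := FTC1_lebesgue_pt tt1 iS _ (Ht n); first by rewrite ltNyr.
rewrite patchE mem_set/=; last by rewrite in_itv/= !ltW.
move=> <-; rewrite derive1E.
rewrite (@near_eq_derive R R R _ (fun=> 0 : R) t 1); first by rewrite derive_cst.
near=> y; have ny : a n < y by near: y; exact: lt_nbhsr.
have yn : y < l - a n by near: y; exact: lt_nbhsl.
rewrite -[RHS](d0 (a n) y)//; last by apply: lt_trans yn _.
rewrite [LHS](@Rintegral_subset _ `[a n, y]); last 2 first.
- by move=> x /=; rewrite !in_itv/= => /andP[].
- move=> x; rewrite /= !in_itv/= => xy hx; rewrite patchE memNset//= in_itv/=.
  by move=> /andP[ax _]; apply: hx; rewrite ax.
apply: eq_Rintegral => x; rewrite inE/= in_itv/= => /andP[x1 x2].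
by rewrite patchE mem_set//= in_itv/= x1 (le_trans x2)// ltW.
Unshelve. all: by end_near.
Qed.

Lemma integrable_of_sqr (R : realType) (x y : R) (r : R -> R) :
  measurable_fun `[x, y] r ->
  lebesgue_measure.-integrable `[x, y] (EFin \o (fun t => r t ^+ 2)) ->
  lebesgue_measure.-integrable `[x, y] (EFin \o r).
Proof.
move=> mr ir.
have i1 : lebesgue_measure.-integrable `[x, y] (EFin \o (fun t => 1 + r t ^+ 2)).
  rewrite (_ : _ \o _ = (fun t => (1 : R)%:E + (r t ^+ 2)%:E)%E)//.
  apply: integrableD => //.
  exact: (continuous_integrable x y (@cst_continuous _ _ (1 : R))).
apply: (le_integrable _ _ _ i1) => //; first exact/measurable_EFinP.
move=> t _; rewrite /= lee_fin [leRHS]ger0_norm ?addr_ge0 ?sqr_ge0//.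
rewrite -[r t ^+ 2]real_normK ?num_real//; move: `|r t| => z.
by have := sqr_ge0 (z - 1); have := sqr_ge0 z; lra.
Qed.

(** Nonnegativity of the integral of (r - m)^2, where m is the mean of [r]. *)
Lemma cauchy_schwarz_itv (R : realType) (x y : R) (r : R -> R) : x < y ->
  measurable_fun `[x, y] r ->
  lebesgue_measure.-integrable `[x, y] (EFin \o (fun t => r t ^+ 2)) ->
  (\int[lebesgue_measure]_(t in `[x, y]) r t)%R ^+ 2 <=
  (y - x) * (\int[lebesgue_measure]_(t in `[x, y]) (r t ^+ 2))%R.
Proof.
move=> xy mr i2; have i1 := integrable_of_sqr mr i2.
set S := (\int[lebesgue_measure]_(t in `[x, y]) r t)%R.
have yx : 0 < y - x by rewrite subr_gt0.
pose m := S / (y - x).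
have ic (c : R) : lebesgue_measure.-integrable `[x, y] (EFin \o (fun=> c)).
  exact: (continuous_integrable x y (@cst_continuous _ _ c)).
have iZ : lebesgue_measure.-integrable `[x, y] (EFin \o (fun t => 2 * m * r t)).
  rewrite (_ : _ \o _ = (fun t => (2 * m)%:E * (r t)%:E)%E)//.
  by apply: integrableZl.
have iB : lebesgue_measure.-integrable `[x, y] (EFin \o (fun t => r t ^+ 2 - 2 * m * r t)).
  rewrite (_ : _ \o _ = (fun t => (r t ^+ 2)%:E - (2 * m * r t)%:E)%E)//.
  by apply: integrableB.
have : 0 <= (\int[lebesgue_measure]_(t in `[x, y]) (r t - m) ^+ 2)%R.
  by apply: Rintegral_ge0 => t _; rewrite sqr_ge0.
have -> : (\int[lebesgue_measure]_(t in `[x, y]) (r t - m) ^+ 2)%R =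
    (\int[lebesgue_measure]_(t in `[x, y]) (r t ^+ 2 - 2 * m * r t + m ^+ 2))%R.
  by apply: eq_Rintegral => t _; ring.
rewrite RintegralD// RintegralB// RintegralZl// -/S Rintegral_cst//.
rewrite [fine _](_ : _ = y - x); last first.
  by rewrite /= lebesgue_measure_itv/= lte_fin xy.
set Q := (\int[_]_(_ in _) _)%R => h.
have := mulr_ge0 (ltW yx) h; have -> : (y - x) * (Q - 2 * m * S + m ^+ 2 * (y - x)) = (y - x) * Q - S ^+ 2.
  by rewrite /m; field; rewrite gt_eqF.
by rewrite subr_ge0.
Qed.

(** The reverse triangle inequality for a + ib and c + id; expanded, it is Cauchy-Schwarz in the
    plane, whose gap is (a d - b c)^2. *)
Lemma modulus_lipschitz (R : rcfType) (a b c d : R) :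
  (Num.sqrt (a ^+ 2 + b ^+ 2) - Num.sqrt (c ^+ 2 + d ^+ 2)) ^+ 2 <=
  (a - c) ^+ 2 + (b - d) ^+ 2.
Proof.
have n0 (x y : R) : 0 <= x ^+ 2 + y ^+ 2 by rewrite addr_ge0 ?sqr_ge0.
rewrite sqrrB !sqr_sqrtr// -sqrtrM//.
have h : a * c + b * d <= Num.sqrt ((a ^+ 2 + b ^+ 2) * (c ^+ 2 + d ^+ 2)).
  apply: le_trans (ler_norm _) _; rewrite -sqrtr_sqr ler_sqrt ?mulr_ge0//.
  rewrite -subr_ge0 [leRHS](_ : _ = (a * d - b * c) ^+ 2) ?sqr_ge0//; ring.
by move: h; set s := Num.sqrt _; rewrite -mulr_natl; lra.
Qed.

Lemma Rintegral_itv_diff (R : realType) (l x y : R) (s : R -> R) :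
  lebesgue_measure.-integrable `[0, l] (EFin \o s) -> 0 <= x -> x < y -> y <= l ->
  (\int[lebesgue_measure]_(t in `[x, y]) s t = \int[lebesgue_measure]_(t in `[0%R, y]) s t -
    \int[lebesgue_measure]_(t in `[0%R, x]) s t)%R.
Proof.
move=> is_ x0 xy yl.
have i1 : lebesgue_measure.-integrable `[0, y] (EFin \o s).
  by apply: integrableS is_ => // t /=; rewrite !in_itv/= => /andP[-> /le_trans ->].
rewrite (Rintegral_itvB i1) ?bnd_simp ?(ltW xy)// Rintegral_itv_obnd_cbnd//.
apply: integrableS i1 => // t /=; rewrite !in_itv/= => /andP[xt ->].
by rewrite (le_trans x0) ?(ltW xt).
Qed.

Section ModulusEnergy.
Context {R : realType} (l : R) (a b ra rb : R -> R) (l0 : 0 < l).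
Hypothesis (ca : continuous a) (cb : continuous b).
Hypothesis (mra : measurable_fun `[0, l] ra) (mrb : measurable_fun `[0, l] rb).
Hypothesis ir : edge_integrable l (fun t => ra t ^+ 2 + rb t ^+ 2).
Hypothesis aE : forall x y : R, 0 < x -> x < y -> y < l ->
  (\int[lebesgue_measure]_(t in `[x, y]) ra t)%R = a y - a x.
Hypothesis bE : forall x y : R, 0 < x -> x < y -> y < l ->
  (\int[lebesgue_measure]_(t in `[x, y]) rb t)%R = b y - b x.

Let s (t : R) : R := ra t ^+ 2 + rb t ^+ 2.
Let v (x : R) : R := Num.sqrt (a x ^+ 2 + b x ^+ 2).

Lemma modulus_continuous : continuous v.
Proof.
move=> x; apply: (@continuous_comp _ _ _ (fun t => a t ^+ 2 + b t ^+ 2) Num.sqrt).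
  by apply: cvgD; [exact: continuous_sqr ca x|exact: continuous_sqr cb x].
exact: sqrt_continuous.
Qed.

Let sub (x y : R) : 0 <= x -> y <= l -> (`[x, y] `<=` `[0, l])%classic.
Proof.
move=> x0 yl t /=; rewrite !in_itv/= => /andP[xt ty].
by rewrite (le_trans x0)//= (le_trans ty).
Qed.

Let is_ (x y : R) : 0 <= x -> y <= l -> lebesgue_measure.-integrable `[x, y] (EFin \o s).
Proof. by move=> x0 yl; apply: integrableS ir => //; exact: sub. Qed.

Lemma modulus_incr_interior (x y : R) : 0 < x -> x < y -> y < l ->
  (v y - v x) ^+ 2 <= (y - x) * (\int[lebesgue_measure]_(t in `[x, y]) s t)%R.
Proof.
move=> x0 xy yl; apply: le_trans (modulus_lipschitz _ _ _ _) _.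
have sxy := sub (ltW x0) (ltW yl).
have ma : measurable_fun `[x, y] ra by apply: measurable_funS mra.
have mb : measurable_fun `[x, y] rb by apply: measurable_funS mrb.
have ixy := is_ (ltW x0) (ltW yl).
have ia : lebesgue_measure.-integrable `[x, y] (EFin \o (fun t => ra t ^+ 2)).
  apply: (le_integrable _ _ _ ixy) => //; first exact/measurable_EFinP/measurable_funX.
  move=> t _; rewrite /= lee_fin !ger0_norm ?addr_ge0 ?sqr_ge0//.
  by rewrite lerDl sqr_ge0.
have ib : lebesgue_measure.-integrable `[x, y] (EFin \o (fun t => rb t ^+ 2)).
  apply: (le_integrable _ _ _ ixy) => //; first exact/measurable_EFinP/measurable_funX.
  move=> t _; rewrite /= lee_fin !ger0_norm ?addr_ge0 ?sqr_ge0//.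
  by rewrite lerDr sqr_ge0.
rewrite -(aE x0 xy yl) -(bE x0 xy yl) /s RintegralD// mulrDr.
by apply: lerD; exact: cauchy_schwarz_itv.
Qed.

(** The integral formulas for increments hold only inside ]0, l[; the ends are moved inwards by
    [e k], and continuity of the modulus gives the closed case. *)
Lemma modulus_incr (x y : R) : 0 <= x -> x < y -> y <= l ->
  (v y - v x) ^+ 2 <= (y - x) * (\int[lebesgue_measure]_(t in `[x, y]) s t)%R.
Proof.
move=> x0 xy yl; pose e k : R := (y - x) / 4 / 2 ^+ k.
have e0 k : 0 < e k by rewrite !divr_gt0 ?exprn_gt0 ?subr_gt0.
have e4 k : e k <= (y - x) / 4.
  rewrite ler_pdivrMr ?exprn_gt0// ler_peMr ?divr_ge0 ?subr_ge0 ?(ltW xy)//.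
  by rewrite exprn_ege1// ler1n.
have ecv : e k @[k --> \oo] --> 0 by exact: geometric_half_cvg.
have cv : (v (y - e k) - v (x + e k)) ^+ 2 @[k --> \oo] --> (v y - v x) ^+ 2.
  have c1 : v (y - e k) - v (x + e k) @[k --> \oo] --> v y - v x.
    apply: cvgB; apply: continuous_cvg; try exact: modulus_continuous.
      by rewrite -[X in _ --> X]subr0; apply: cvgB => //; exact: cvg_cst.
    by rewrite -[X in _ --> X]addr0; apply: cvgD => //; exact: cvg_cst.
  by rewrite expr2; under eq_fun do rewrite expr2; apply: cvgM.
apply: (cvg_le_cst (U := \oo) _ cv) => k.
have xe : 0 < x + e k by rewrite ltr_wpDl.
have xy' : x + e k < y - e k by have := e4 k; move: xy; lra.
have ye : y - e k < l by rewrite ltrBlDr; apply: le_lt_trans yl _; rewrite ltrDl.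
apply: le_trans (modulus_incr_interior xe xy' ye) _.
apply: ler_pM.
- by rewrite subr_ge0 ltW.
- by apply: Rintegral_ge0 => t _; rewrite addr_ge0 ?sqr_ge0.
- by have := e0 k; lra.
have i1 := is_ x0 yl; have i2 := is_ (ltW xe) (ltW ye).
apply: fine_le; [exact: integrable_fin_num|exact: integrable_fin_num|].
apply: ge0_subset_integral => //.
- by move/integrableP: i1 => [].
- by move=> t _; rewrite lee_fin addr_ge0 ?sqr_ge0.
- move=> t /=; rewrite !in_itv/= => /andP[h1 h2]; apply/andP; split.
    by apply: le_trans h1; rewrite lerDl ltW.
  by apply: le_trans h2 _; rewrite gerBl ltW.
Qed.

Lemma modulus_energy k : dyadic_energy l k v <= edge_int l s.
Proof.
pose S (z : R) := (\int[lebesgue_measure]_(t in `[0%R, z]) s t)%R.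
have S0 : 0 <= S 0 by apply: Rintegral_ge0 => t _; rewrite addr_ge0 ?sqr_ge0.
apply: (@le_trans _ _ (S l - S 0)); last by rewrite gerBl.
have -> : S l - S 0 = \sum_(0 <= i < 2 ^ k) (S (dyadic l k i.+1) - S (dyadic l k i)).
  by rewrite telescope_sumr// dyadic_max dyadic0.
rewrite /dyadic_energy !big_mkord; apply: ler_sum => i _.
have dd : dyadic l k i < dyadic l k i.+1.
  by rewrite dyadicS ltrDl divr_gt0// exprn_gt0.
have /andP[d1 d2] := dyadic_bounds (ltW l0) (ltnW (ltn_ord i)).
have /andP[d3 d4] := dyadic_bounds (ltW l0) (ltn_ord i).
rewrite /S -(Rintegral_itv_diff ir d1 dd d4).
have h0 : 0 < 2 ^+ k / l by rewrite divr_gt0// exprn_gt0.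
apply: le_trans (ler_wpM2r (ltW h0) (modulus_incr d1 dd d4)) _.
rewrite {1}dyadicS addrAC subrr add0r mulrAC -{1}[2 ^+ k / l]invf_div divff ?mul1r//.
by rewrite gt_eqF// divr_gt0// exprn_gt0.
Qed.

End ModulusEnergy.

(** * From complex functions in H^1 to admissible functions *)

Lemma clamp_continuous (R : realType) (l : R) : 0 < l -> continuous (clamp l).
Proof.
move=> l0 x; apply/cvgrPdist_lt => e e0; near=> y.
apply: le_lt_trans (clamp_lipschitz _ _ l0) _; near: y.
by apply: cvgr_dist_lt => //; exact: cvg_id.
Unshelve. all: by end_near.
Qed.

Lemma cabsE (R : realType) (z : complex R) :
  cabs z = Num.sqrt (complex.Re z ^+ 2 + complex.Im z ^+ 2).
Proof. by case: z. Qed.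

Lemma cabs_ge0 (R : realType) (z : complex R) : 0 <= cabs z.
Proof. by rewrite cabsE sqrtr_ge0. Qed.

Lemma cabs_powR2 (R : realType) (z : complex R) :
  cabs z `^ 2 = complex.Re z ^+ 2 + complex.Im z ^+ 2.
Proof. by rewrite (powR_mulrn 2 (cabs_ge0 z)) cabsE sqr_sqrtr// addr_ge0 ?sqr_ge0. Qed.

Lemma within_continuous_ReIm (R : realType) (l : R) (w : R -> complex R) : 0 < l ->
  {within `[0, l], continuous (w : R -> GRing.regular (complex R))} ->
  continuous (fun x => complex.Re (w (clamp l x))) /\
  continuous (fun x => complex.Im (w (clamp l x))).
Proof.
move=> l0 /subspace_continuousP cw.
have key (e x : R) : 0 < e -> \forall y \near x, cabs (w (clamp l x) - w (clamp l y)) < e.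
  move=> e0; have := cw (clamp l x); rewrite /= in_itv/= (clamp_itv x l0) => /(_ isT).
  move=> /cvgrPdist_lt /(_ (e%:C)%C); rewrite ltcR => /(_ e0).
  move=> H; have {H} : \forall y \near x, `[0, l]%classic (clamp l y) ->
      `|(w (clamp l x) : GRing.regular (complex R)) - w (clamp l y)| < (e%:C)%C.
    exact: (clamp_continuous l0 H).
  apply: filterS => y; rewrite /= in_itv/= (clamp_itv y l0) => /(_ isT).
  by rewrite /Num.norm/= ltcR.
split=> x; apply/cvgrPdist_lt => e e0; have := key e x e0; apply: filterS => y;
  apply: le_lt_trans; rewrite cabsE -sqrtr_sqr ler_sqrt ?addr_ge0 ?sqr_ge0//.
  by case: (w _) (w _) => [a b] [c d] /=; rewrite lerDl sqr_ge0.
by case: (w _) (w _) => [a b] [c d] /=; rewrite lerDr sqr_ge0.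
Qed.

Lemma within_continuous_real (R : realType) (l : R) (f : R -> R) : continuous f ->
  {within `[0, l], continuous ((fun x => (f x)%:C%C) : R -> GRing.regular (complex R))}.
Proof.
move=> cf; apply: continuous_subspaceT => x; apply/cvgrPdist_lt => -[e e'].
rewrite ltcE/= => /andP[/eqP-> e0].
have /cvgrPdist_lt/(_ e e0) := cf x; apply: filterS => y.
by rewrite /Num.norm/= subr0 expr0n/= addr0 sqrtr_sqr ltcR.
Qed.

Lemma esum_pairs (R : realType) (J K : choiceType) (f : J * K -> R) :
  (forall q, 0 <= f q) ->
  (\esum_(q in [set: J * K]) (f q)%:E = \esum_(j in [set: J]) \esum_(k in [set: K]) (f (j, k))%:E)%E.
Proof.
move=> f0; rewrite esum_esum; last by move=> j k _ _; rewrite lee_fin.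
have -> : [set: J] `*`` (fun=> [set: K]) = [set: J * K] by apply/seteqP; split.
by apply: eq_esum => -[j k].
Qed.

Lemma tsum_nat_bound (R : realType) (f : nat -> R) (C : R) : (forall k, 0 <= f k) ->
  (forall n, \sum_(0 <= k < n) f k <= C) -> summable_ge0 f /\ tsum f <= C.
Proof.
move=> f0 fC; apply: tsum_bound => // A.
have [n An] : exists n, forall k, k \in A -> (k < n)%N.
  by exists (\max_(k <- A) k).+1 => k kA; rewrite ltnS; apply: leq_bigmax_seq.
apply: le_trans (fC n); rewrite /index_iota subn0.
rewrite [leRHS](bigID (mem A))/= -[X in _ <= X + _]big_filter.
have -> : \sum_(k <- A) f k = \sum_(k <- [seq k <- iota 0 n | k \in A]) f k.
  apply: perm_big; apply: uniq_perm; rewrite ?filter_uniq ?iota_uniq ?fset_uniq//.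
  by move=> k; rewrite mem_filter mem_iota/= add0n; apply/idP/andP => [kA|[]//]; rewrite kA An.
by rewrite lerDl sumr_ge0.
Qed.

Lemma tsum_pairs_bound (R : realType) (J : choiceType) (f : J * nat -> R) (S : J -> R) :
  (forall q, 0 <= f q) -> (forall j n, \sum_(0 <= k < n) f (j, k) <= S j) ->
  summable_ge0 S -> summable_ge0 f /\ tsum f <= tsum S.
Proof.
move=> f0 fS sS.
have fj j := tsum_nat_bound (fun k => f0 (j, k)) (fS j).
have h : (\esum_(q in [set: J * nat]) (f q)%:E <= (tsum S)%:E)%E.
  rewrite esum_pairs// -esum_tsum//; apply: le_esum => j _.
  by rewrite esum_tsum ?lee_fin; have [] := fj j.
have sf : summable_ge0 f by split => //; apply: le_lt_trans h _; rewrite ltry.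
by split => //; rewrite -lee_fin -esum_tsum.
Qed.

(** Regroups the kinetic energy edge by edge, which is the form in which it is compared with
    integrals of derivatives. *)
Lemma tsum_pairs_slice (R : realType) (J : choiceType) (f : J * nat -> R) : summable_ge0 f ->
  [/\ forall j, summable_ge0 (fun k => f (j, k)),
      summable_ge0 (fun j => tsum (fun k => f (j, k))) &
      tsum (fun j => tsum (fun k => f (j, k))) = tsum f].
Proof.
move=> sf; have [f0 fb] := sf.
have sj j : summable_ge0 (fun k => f (j, k)).
  apply: (tsum_nat_bound (C := tsum f) _ _).1 => // n.
  have := fsum_le_tsum [fset (j, val k) | k in 'I_n]%fset sf.
  rewrite big_imfset/=; last by move=> k k' _ _ [] /val_inj.
  by rewrite big_enum/= big_mkord.
have E : (\esum_(j in [set: J]) (tsum (fun k => f (j, k)))%:E = (tsum f)%:E)%E.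
  by rewrite -esum_tsum// esum_pairs//; apply: eq_esum => j _; rewrite esum_tsum.
split=> //; last by rewrite /tsum -[X in fine X]/(\esum_(j in _) _)%E E.
by split=> [j|]; [exact: tsum_ge0|rewrite E ltry].
Qed.

Lemma poweR_half_sqr (R : realType) (x : \bar R) : (0 <= x)%E ->
  ((x `^ 2^-1) ^+ 2 = x)%E.
Proof.
move=> x0; rewrite poweR12_sqrt//; case: x x0 => [r||]//=.
by rewrite lee_fin => r0; rewrite -EFinM -expr2 sqr_sqrtr.
Qed.

Lemma poweR_half_lty (R : realType) (x : \bar R) : (x `^ 2^-1 < +oo)%E -> (x < +oo)%E.
Proof.
case: x => [r||]//; first by move=> _; rewrite ltry.
by rewrite poweRE invr_eq0 pnatr_eq0.
Qed.

Section GraphIntegral.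
Context {R : realType} (l : R).
Implicit Types (h : edge -> R -> R).

Lemma gintegral_tsum h (H : edge -> R) : summable_ge0 H ->
  (forall e, (\int[lebesgue_measure]_(x in `[0%R, l]) (h e x)%:E = (H e)%:E)%E) ->
  gintegral l h = (tsum H)%:E.
Proof. by move=> sH hH; rewrite -esum_tsum//; apply: eq_esum => e _. Qed.

Lemma gintegral_lty h : (forall e x, 0 <= h e x) -> (gintegral l h < +oo)%E ->
  [/\ forall e, (\int[lebesgue_measure]_(x in `[0%R, l]) (h e x)%:E = (edge_int l (h e))%:E)%E,
      summable_ge0 (fun e => edge_int l (h e)) &
      gintegral l h = (tsum (fun e => edge_int l (h e)))%:E].
Proof.
move=> h0 hl.
have i0 e : (0 <= \int[lebesgue_measure]_(x in `[0%R, l]) (h e x)%:E)%E.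
  by apply: integral_ge0 => x _; rewrite lee_fin.
have E e : (\int[lebesgue_measure]_(x in `[0%R, l]) (h e x)%:E = (edge_int l (h e))%:E)%E.
  rewrite fineK// ge0_fin_numE//; apply: le_lt_trans hl; apply: esum_ge.
  exists [set e]; first by split; [exact: finite_set1|].
  by rewrite fsbig_set1.
have E' : (gintegral l h = \esum_(e in [set: edge]) (edge_int l (h e))%:E)%E.
  by apply: eq_esum => e _.
have sh : summable_ge0 (fun e => edge_int l (h e)).
  split=> [e|]; first by apply: Rintegral_ge0 => x _.
  by rewrite -E'.
by split=> //; rewrite E' esum_tsum.
Qed.

End GraphIntegral.

Lemma weak_derivativeP (R : realType) (l : R) (u : gfun R) e : weakly_differentiable l u ->
  is_weak_derivative l (u e) (weak_derivative l u e).
Proof. by move=> /(_ e) [g hg]; apply: xgetPex; exists g. Qed.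

(** Test functions are real, so the complex relation splits into two real ones, to which the
    fundamental theorem applies. *)
Lemma weak_derivative_ReIm (R : realType) (l : R) (u g : R -> complex R) (x y : R) :
  0 < l -> {within `[0, l], continuous (u : R -> GRing.regular (complex R))} ->
  is_weak_derivative l u g -> 0 < x -> x < y -> y < l ->
  (\int[lebesgue_measure]_(t in `[x, y]) complex.Re (g t))%R =
    complex.Re (u (clamp l y)) - complex.Re (u (clamp l x)) /\
  (\int[lebesgue_measure]_(t in `[x, y]) complex.Im (g t))%R =
    complex.Im (u (clamp l y)) - complex.Im (u (clamp l x)).
Proof.
move=> l0 cu [_ [g1 g2] hg] x0 xy yl; have [c1 c2] := within_continuous_ReIm l0 cu.
have ReM (z : complex R) (r : R) : complex.Re (z * real_complex R r) = complex.Re z * r.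
  by case: z => a b /=; rewrite mulr0 subr0.
have ImM (z : complex R) (r : R) : complex.Im (z * real_complex R r) = complex.Im z * r.
  by case: z => a b /=; rewrite mulr0 add0r.
split.
  apply: (weak_FTC x0 xy yl c1 g1) => phi tphi.
  have := congr1 (@complex.Re R) (hg phi tphi); rewrite /cintegral/=.
  under [in X in _ = X -> _]eq_Rintegral do rewrite ReM.
  move=> <-; apply: eq_Rintegral => t; rewrite inE/= in_itv/= => /andP[t0 tl].
  by rewrite ReM clamp_id// !ltW.
apply: (weak_FTC x0 xy yl c2 g2) => phi tphi.
have := congr1 (@complex.Im R) (hg phi tphi); rewrite /cintegral/=.
under [in X in _ = X -> _]eq_Rintegral do rewrite ImM.
move=> <-; apply: eq_Rintegral => t; rewrite inE/= in_itv/= => /andP[t0 tl].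
by rewrite ImM clamp_id// !ltW.
Qed.

Definition modulus (R : realType) (l : R) (u : gfun R) (e : edge) (x : R) : R :=
  cabs (u e (clamp l x)).

Section Competitor.
Context {R : realType} (l p : R) (l0 : 0 < l) (p2 : 2 < p) (u : gfun R) (hu : sobolevH1 l u).

Let v := modulus l u.

Lemma modulus_edge_continuous e : continuous (v e).
Proof.
have [[cu _] _ _ _] := hu; have [c1 c2] := within_continuous_ReIm l0 (cu e).
have -> : v e = fun x => Num.sqrt (complex.Re (u e (clamp l x)) ^+ 2 +
                                   complex.Im (u e (clamp l x)) ^+ 2).
  by apply/funext => x; rewrite /v /modulus cabsE.
exact: modulus_continuous c1 c2.
Qed.

Lemma gpow_modulus q e : edge_int l (fun x => v e x `^ q) = edge_int l (fun x => cabs (u e x) `^ q).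
Proof.
by apply: eq_Rintegral => x; rewrite inE/= in_itv/= => hx; rewrite /v /modulus clamp_id.
Qed.

Lemma modulus_mass : summable_ge0 (mass_family l v) /\
  gpow_integral l 2 u = (gmass l v)%:E.
Proof.
have [_ [_ ul] _ _] := hu; have {}ul := poweR_half_lty ul.
rewrite /gpow_integral.
have [_ s1 ->] := gintegral_lty (fun e x => powR_ge0 (cabs (u e x)) 2) ul.
rewrite /gmass; have -> // : mass_family l v = fun e => edge_int l (fun x => cabs (u e x) `^ 2).
apply/funext => e; rewrite -gpow_modulus; apply: eq_Rintegral => x _.
by rewrite (powR_mulrn 2)// cabs_ge0.
Qed.

(** On each edge every dyadic energy of |u| is at most the integral of |u'|^2, and the partial sums
    of the kinetic family are exactly these dyadic energies. *)
Lemma modulus_kin : exists k : R, [/\ gpow_integral l 2 (weak_derivative l u) = k%:E,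
  summable_ge0 (kin_family l v) & gkin l v <= k].
Proof.
have [[cu _] _ wu [mg gl]] := hu; have {}gl := poweR_half_lty gl.
rewrite /gpow_integral.
have [E1 s1 ->] := gintegral_lty (fun e x => powR_ge0 (cabs (weak_derivative l u e x)) 2) gl.
set S := fun e => edge_int l _ in s1 *.
have [s2 h2] : summable_ge0 (kin_family l v) /\ tsum (kin_family l v) <= tsum S.
  apply: tsum_pairs_bound => //; first by move=> q; exact: dyadic_incr_ge0.
  move=> e [|n]; first by rewrite big_nil; case: s1.
  rewrite /kin_family/= -dyadic_energyE//.
  have [c1 c2] := within_continuous_ReIm l0 (cu e).
  have W := weak_derivativeP e wu.
  have -> : v e = fun x => Num.sqrt (complex.Re (u e (clamp l x)) ^+ 2 +
                                   complex.Im (u e (clamp l x)) ^+ 2).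
    by apply/funext => x; rewrite /v /modulus cabsE.
  have -> : S e = edge_int l (fun t => complex.Re (weak_derivative l u e t) ^+ 2 +
                                       complex.Im (weak_derivative l u e t) ^+ 2).
    by apply: eq_Rintegral => x _; exact: cabs_powR2.
  have [m1 m2] := mg e.
  apply: modulus_energy => //.
  - apply/integrableP; split.
      by apply/measurable_EFinP; apply: measurable_funD; exact: measurable_funX.
    apply: (@le_lt_trans _ _ (S e)%:E); last by rewrite ltry.
    rewrite le_eqVlt /S -E1; apply/orP; left; apply/eqP; apply: eq_integral => t _.
    by rewrite cabs_powR2/= ger0_norm// addr_ge0 ?sqr_ge0.
  - by move=> x y x0 xy yl; exact: (weak_derivative_ReIm l0 (cu e) W x0 xy yl).1.
  - by move=> x y x0 xy yl; exact: (weak_derivative_ReIm l0 (cu e) W x0 xy yl).2.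
by exists (tsum S).
Qed.

Lemma modulus_admissible : admissible l v.
Proof.
split; first exact: modulus_edge_continuous.
- have [[_ [w hw]] _ _ _] := hu; exists (@cabs R \o w) => e.
  have [h1 h2] := hw e; rewrite /v /modulus/= !clamp_id ?lexx ?(ltW l0)//.
  by rewrite h1 h2.
- exact: modulus_mass.1.
- by have [k []] := modulus_kin.
Qed.

Lemma modulus_pot : gpow_integral l p u = (gpot l p v)%:E.
Proof.
have av := modulus_admissible.
apply: (gintegral_tsum (adm_pot l0 p2 av)) => e.
have ip := edge_integrable_pow l0 (@modulus_edge_continuous e) (le_trans (ler0n _ 2) (ltW p2)).
rewrite /pot_family /edge_pot /edge_int /Rintegral fineK; last exact: integrable_fin_num.
apply: eq_integral => x; rewrite inE/= in_itv/= => hx.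
by rewrite ger0_norm ?cabs_ge0// /v /modulus clamp_id.
Qed.

Lemma modulus_energy_le (mu : R) : (graph_norm l 2 u ^+ 2 = mu%:E)%E ->
  gmass l v = mu /\ ((renergy l p v)%:E <= energy l p u)%E.
Proof.
have [_ mE] := modulus_mass; have [k [kE _ hk]] := modulus_kin.
rewrite /graph_norm mE poweR_half_sqr ?lee_fin ?gmass_ge0// => -[<-]; split=> //.
rewrite /energy kE modulus_pot -!EFinM -EFinB lee_fin /renergy.
by rewrite [2^-1 * _]mulrC [p^-1 * _]mulrC lerB// ler_wpM2r.
Qed.

End Competitor.

(** * From a regular admissible function back to H^1 *)

Lemma Rintegral_itv_oo_cc (R : realType) (a b : R) (f : R -> R) :
  lebesgue_measure.-integrable `[a, b] (EFin \o f) ->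
  (\int[lebesgue_measure]_(x in `]a, b[) f x = \int[lebesgue_measure]_(x in `[a, b]) f x)%R.
Proof.
move=> i1; have i2 : lebesgue_measure.-integrable `]a, b] (EFin \o f).
  by apply: integrableS i1 => //; apply: subset_itvr; rewrite bnd_simp.
rewrite -Rintegral_itv_obnd_cbnd// -Rintegral_itv_bndo_bndc//.
by apply: integrableS i2 => //; apply: subset_itvl; rewrite bnd_simp.
Qed.

Lemma integral_itv_oo_cc (R : realType) (a b : R) (f : R -> \bar R) :
  measurable_fun `[a, b] f ->
  (\int[lebesgue_measure]_(x in `]a, b[) f x = \int[lebesgue_measure]_(x in `[a, b]) f x)%E.
Proof.
move=> m1; have m2 : measurable_fun `]a, b] f.
  by apply: measurable_funS m1 => //; apply: subset_itvr; rewrite bnd_simp.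
rewrite -integral_itv_obnd_cbnd// -integral_itv_bndo_bndc//.
by apply: measurable_funS m2 => //; apply: subset_itvl; rewrite bnd_simp.
Qed.

Lemma continuous_locally_integrable (R : realType) (a b : R) (f : R -> R) : continuous f ->
  locally_integrable `]a, b[ f.
Proof.
move=> cf; apply: open_integrable_locally; first exact: itv_open.
apply: integrableS (continuous_integrable a b cf) => //; exact: subset_itv_oo_cc.
Qed.

(** The derivative of F phi integrates to 0 over [0, l], because phi vanishes at both ends. *)
Lemma test_function_parts (R : realType) (l : R) (F g phi : R -> R) : 0 < l ->
  (forall x : R, is_derive x (1 : R) F (g x)) -> continuous g -> test_function l phi ->
  (\int[lebesgue_measure]_(x in `]0%R, l[) (F x * derive1 phi x))%R =
  - (\int[lebesgue_measure]_(x in `]0%R, l[) (g x * phi x))%R.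
Proof.
move=> l0 dF cg [sphi [_ supp]].
have dphi (x : R) : is_derive x (1 : R) phi (derive1 phi x).
  by rewrite derive1E; apply: DeriveDef => //; exact: (sphi 0%N x).
have cont (f df : R -> R) : (forall x : R, is_derive x (1 : R) f (df x)) -> continuous f.
  by move=> df' x; apply: differentiable_continuous; apply/derivable1_diffP; have [] := df' x.
have cF := cont _ _ dF; have cphi := cont _ _ dphi.
have cdphi : continuous (derive1 phi).
  by move=> x; apply: differentiable_continuous; apply/derivable1_diffP; exact: (sphi 1%N x).
have p0 (x : R) : ~ (0 < x < l) -> phi x = 0.
  move=> hx; apply/eqP; apply: contrapT => /negP h; apply: hx.
  by have /= := supp x (@subset_closure _ _ x h); rewrite in_itv.
have c1 : continuous (fun x => F x * derive1 phi x).
  by move=> x; apply: cvgM; [exact: cF|exact: cdphi].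
have c2 : continuous (fun x => g x * phi x).
  by move=> x; apply: cvgM; [exact: cg|exact: cphi].
rewrite !Rintegral_itv_oo_cc; try exact: continuous_integrable.
apply/eqP; rewrite -addr_eq0 -RintegralD//; try exact: continuous_integrable.
have dM (x : R) : is_derive x (1 : R) (fun x => F x * phi x) (F x * derive1 phi x + g x * phi x).
  by rewrite [g x * _]mulrC; exact: (is_deriveM (dF x) (dphi x)).
have cM : continuous (fun x => F x * derive1 phi x + g x * phi x).
  by move=> x; apply: cvgD; [exact: c1|exact: c2].
by rewrite (Rintegral_is_derive l0 dM cM) (p0 l) ?(p0 0) ?mulr0 ?subrr// ltxx// andbF.
Qed.

Section Realize.
Context {R : realType} (l p : R) (l0 : 0 < l) (p2 : 2 < p) (v F g : edge -> R -> R).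
Hypothesis av : admissible l v.
Hypothesis cg : forall e, continuous (g e).
Hypothesis dF : forall e (x : R), is_derive x (1 : R) (F e) (g e x).
Hypothesis Fv : forall e (x : R), 0 <= x <= l -> F e x = v e x.
Hypothesis gkin_slice : forall e, edge_int l (fun x => g e x ^+ 2) <=
  tsum (fun k => kin_family l v (e, k)).

Let u : gfun R := fun e x => (v e x)%:C%C.

Let cv e : continuous (v e). Proof. by have [] := av. Qed.

Let cabs_u e x : cabs (u e x) = `|v e x|.
Proof. by rewrite cabsE /= expr0n addr0 sqrtr_sqr. Qed.

Lemma realize_weak e : is_weak_derivative l (u e) (fun x => (g e x)%:C%C).
Proof.
have z : continuous (fun _ : R => 0 : R) by move=> x; exact: cvg_cst.
split.
- by split; [exact: (continuous_locally_integrable 0 l (@cv e))|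
             exact: (continuous_locally_integrable 0 l z)].
- by split; [exact: (continuous_locally_integrable 0 l (@cg e))|
             exact: (continuous_locally_integrable 0 l z)].
move=> phi tphi; apply/eqP; rewrite eq_complex; apply/andP; split; apply/eqP => /=.
  under eq_Rintegral do rewrite mulr0 subr0.
  under [in RHS]eq_Rintegral do rewrite mulr0 subr0.
  rewrite -(test_function_parts l0 (dF e) (@cg e) tphi); apply: eq_Rintegral => x.
  by rewrite inE/= in_itv/= => /andP[x0 xl]; rewrite Fv// !ltW.
under eq_Rintegral do rewrite mulr0 mul0r addr0.
under [in RHS]eq_Rintegral do rewrite mulr0 mul0r addr0.
by rewrite Rintegral_cst// mul0r oppr0.
Qed.

Let wu : weakly_differentiable l u.
Proof. by move=> e; eexists; exact: realize_weak. Qed.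

Let cu e : {within `[0, l], continuous (u e : R -> GRing.regular (complex R))}.
Proof. exact: within_continuous_real. Qed.

Lemma realize_measurable e : cmeasurable `[0, l] (weak_derivative l u e).
Proof.
have [_ [[m1 _ _] [m2 _ _]] _] := weak_derivativeP e wu.
by split; [exact: (measurable_fun_itv_cc m1)|exact: (measurable_fun_itv_cc m2)].
Qed.

(** Nothing is known of the representative chosen by [weak_derivative] except its integrals over
    compact subintervals; these agree with those of [g], hence the two functions agree almost
    everywhere. *)
Lemma realize_int e :
  (\int[lebesgue_measure]_(x in `[0%R, l]) (cabs (weak_derivative l u e x) `^ 2)%:E =
   (edge_int l (fun x => (g e x ^+ 2)%R))%:E)%E.
Proof.
have W := weak_derivativeP e wu; have [_ [l1 l2] _] := W.
have [m1 m2] := realize_measurable e.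
have cgl := continuous_locally_integrable 0 l (@cg e).
have ae1 := @ae_zero_of_integrals R l _ l0 (locally_integrableB l1 cgl).
have ae2 := @ae_zero_of_integrals R l _ l0 l2.
have sqE : (edge_int l (fun x => g e x ^+ 2))%:E =
    (\int[lebesgue_measure]_(x in `[0%R, l]) (g e x ^+ 2)%:E)%E.
  rewrite /edge_int /Rintegral fineK//; apply: integrable_fin_num => //.
  exact/continuous_integrable/continuous_sqr.
have mh : measurable_fun `[0%R, l] (fun x => (cabs (weak_derivative l u e x) `^ 2)%:E).
  rewrite (_ : (fun x => _) = (fun x => (complex.Re (weak_derivative l u e x) ^+ 2 +
      complex.Im (weak_derivative l u e x) ^+ 2)%:E)); last first.
    by apply/funext => x; rewrite cabs_powR2.
  apply/measurable_EFinP.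
  by apply: measurable_funD; exact: measurable_funX.
have mg : measurable_fun `[0%R, l] (fun x => (g e x ^+ 2)%:E).
  apply/measurable_EFinP; apply: measurable_funTS; apply: continuous_measurable_fun.
  exact: continuous_sqr.
(* The comparison is available on the open interval only; the two end points are a null set. *)
rewrite sqE -integral_itv_oo_cc// -[RHS]integral_itv_oo_cc//.
apply: ae_eq_integral => //.
- by apply: measurable_funS mh => //; exact: subset_itv_oo_cc.
- by apply: measurable_funS mg => //; exact: subset_itv_oo_cc.
have {}ae1 := ae1 _; have {}ae2 := ae2 _.
have h1 : forall x y : R, 0 < x -> x < y -> y < l -> (\int[lebesgue_measure]_(t in `[x, y])
    ((fun x0 : R => complex.Re (weak_derivative l u e x0)) \- g e) t)%R = 0.
  move=> x y x0 xy yl; rewrite RintegralB//; last 2 first.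
  - exact: locally_integrable_itv x0 yl l1.
  - exact: continuous_integrable.
  rewrite (weak_derivative_ReIm l0 (@cu e) W x0 xy yl).1 /u/=.
  rewrite (Rintegral_is_derive xy (dF e) (@cg e)).
  have hx : 0 <= x <= l by rewrite (ltW x0) ltW// (lt_trans xy).
  have hy : 0 <= y <= l by rewrite (ltW (lt_trans x0 xy)) ltW.
  by rewrite !clamp_id// !Fv// subrr.
have h2 : forall x y : R, 0 < x -> x < y -> y < l -> (\int[lebesgue_measure]_(t in `[x, y])
    complex.Im (weak_derivative l u e t))%R = 0.
  by move=> x y x0 xy yl; rewrite (weak_derivative_ReIm l0 (@cu e) W x0 xy yl).2 subrr.
have : \forall x \ae (@lebesgue_measure R), `]0, l[%classic x ->
    (cabs (weak_derivative l u e x) `^ 2)%:E = (g e x ^+ 2)%:E; last by [].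
move: (ae1 h1) (ae2 h2) => {}ae1 {}ae2; apply: filterS2 ae1 ae2 => [|x hx1 hx2 hx].
  exact: (ae_filter_ringOfSetsType (@lebesgue_measure R)).
rewrite cabs_powR2 hx2// expr0n addr0; congr (_ ^+ 2)%:E.
by apply/eqP; rewrite -subr_eq0; apply/eqP; exact: hx1.
Qed.

Lemma realize_kin : exists k : R,
  gpow_integral l 2 (weak_derivative l u) = k%:E /\ k <= gkin l v.
Proof.
have [_ _ _ sk] := av; have [_ s2 E2] := tsum_pairs_slice sk.
have [s3 h3] : summable_ge0 (fun e => edge_int l (fun x => g e x ^+ 2)) /\
    tsum (fun e => edge_int l (fun x => g e x ^+ 2)) <=
    tsum (fun e => tsum (fun k => kin_family l v (e, k))).
  apply: le_tsum => // e; rewrite gkin_slice andbT.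
  by apply: Rintegral_ge0 => x _; rewrite sqr_ge0.
exists (tsum (fun e => edge_int l (fun x => g e x ^+ 2))); split; last by rewrite /gkin -E2.
exact: gintegral_tsum s3 realize_int.
Qed.

Lemma realize_pow q : 0 < q -> summable_ge0 (fun e => edge_int l (fun x => `|v e x| `^ q)) ->
  gpow_integral l q u = (tsum (fun e => edge_int l (fun x => `|v e x| `^ q)))%:E.
Proof.
move=> q0 sq; apply: (gintegral_tsum sq) => e.
have iq := edge_integrable_pow l0 (@cv e) (ltW q0).
rewrite /edge_int /Rintegral fineK; last exact: integrable_fin_num.
by apply: eq_integral => x _; rewrite cabs_u.
Qed.

Lemma realize_mass : gpow_integral l 2 u = (gmass l v)%:E.
Proof.
have E : mass_family l v = fun e => edge_int l (fun x => `|v e x| `^ 2).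
  apply/funext => e; apply: eq_Rintegral => x _.
  by rewrite (powR_mulrn 2)// real_normK// num_real.
by have [_ _ sm _] := av; rewrite realize_pow// /gmass -?E.
Qed.

Lemma realize_sobolev : sobolevH1 l u.
Proof.
split.
- split; first exact: cu.
  have [_ [w hw] _ _] := av; exists (fun z => (w z)%:C%C) => e.
  by have [h1 h2] := hw e; rewrite /u h1 h2.
- split; last by rewrite /graph_norm realize_mass poweR_EFin ltry.
  move=> e; split => /=; last exact: measurable_cst.
  by apply: measurable_funTS; apply: continuous_measurable_fun; exact: cv.
- exact: wu.
- split; first exact: realize_measurable.
  by have [k [kE _]] := realize_kin; rewrite /graph_norm kE poweR_EFin ltry.
Qed.

(** An inequality is enough: [u] has the prescribed mass, so its energy cannot lie below the infimum
    over H^1 either. *)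
Lemma realize_energy : sobolevH1mass l (gmass l v) u /\ (energy l p u <= (renergy l p v)%:E)%E.
Proof.
split; first split; first exact: realize_sobolev.
  by rewrite /graph_norm poweR_half_sqr realize_mass// lee_fin gmass_ge0.
have [k [kE hk]] := realize_kin.
have p0 : 0 < p by apply: lt_trans p2.
rewrite /energy kE (realize_pow p0 (adm_pot l0 p2 av)) -!EFinM -EFinB lee_fin /renergy.
by rewrite [2^-1 * _]mulrC [p^-1 * _]mulrC lerB// ler_wpM2r.
Qed.

End Realize.

(** * The ground state *)

Lemma exists_regular_minimizer (R : realType) (l p mu : R) : 0 < l -> 2 < p -> p < 4 -> 0 < mu ->
  exists v F g : edge -> R -> R, 
  [/\ admissible l v, gmass l v = mu,
      forall w, admissible l w -> gmass l w = mu -> renergy l p v <= renergy l p w,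
      [/\ forall e, continuous (g e), forall e (x : R), is_derive x (1 : R) (F e) (g e x) &
          forall e (x : R), 0 <= x <= l -> F e x = v e x] &
      forall e, edge_int l (fun x => g e x ^+ 2) <= tsum (fun k => kin_family l v (e, k))].
Proof.
move=> l0 p2 p4 mu0.
(* The infimum is taken over admissible real functions; coercivity bounds it below and a tent makes
   it negative. It is compared with the infimum over H^1 only at the very end. *)
pose S := [set E | exists w, [/\ admissible l w, gmass l w = mu & E = renergy l p w]].
have [w0 [aw0 mw0 ew0]] := energy_negative l0 p2 p4 mu0.
have [c hc] := coercive l0 p2 p4 mu0.
have S0 : S !=set0 by exists (renergy l p w0), w0.
have Slb : lbound S (- c).
  move=> _ [w [aw mw ->]]; apply: le_trans (hc w aw _); last by rewrite mw.
  by rewrite -[leLHS]add0r lerD2r divr_ge0// gkin_ge0.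
have hS : has_inf S by split; [exact: S0|exists (- c)].
have I_lb w : admissible l w -> gmass l w = mu -> inf S <= renergy l p w.
  by move=> aw mw; apply: ge_inf; [exists (- c)|exists w].
have I0 : inf S < 0 by apply: le_lt_trans ew0; exact: I_lb.
have I_app (e : R) : 0 < e -> exists w,
    [/\ admissible l w, gmass l w = mu & renergy l p w < inf S + e].
  by move=> e0; have [_ [w [aw mw ->]] he] := inf_adherent e0 hS; exists w.
have [v [av mv ev]] := exists_minimizer l0 p2 p4 mu0 I_lb I0 I_app.
have [C C0 hC] := minimizer_second_diff l0 p2 p4 mu0 I_lb (ltW I0) av mv ev.
have [cv _ _ sk] := av.
have reg e := regularity l0 C0 (cv e) (hC e).
have [F /choice[g hFg]] := choice reg.
exists v, F, g; split; first exact: av.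
- exact: mv.
- by move=> w aw mw; rewrite ev; exact: I_lb.
- by split=> e; have [] := hFg e.
move=> e; have [cg dF Fv lip] := hFg e.
apply: (int_sqr_derivative_le l0 cg dF lip) => k.
rewrite dyadic_energyE//; have [sl _ _] := tsum_pairs_slice sk.
have := fsum_le_tsum [fset val j | j in 'I_k.+1]%fset (sl e).
rewrite big_imfset/=; last by move=> i j _ _ /val_inj.
rewrite big_enum/= big_mkord; apply: le_trans; apply: ler_sum => j _.
by rewrite /kin_family/= (eq_dyadic_incr _ l0 Fv).
Qed.

Theorem theorem1p1 (R : realType) (l p : R) (hl : 0 < l) (hp2 : 2 < p)
    (hp4 : p < 4) (mu : R) (hmu : 0 < mu) :
  exists u : gfun R, is_ground_state l p mu u.
Proof.
have [v [F [g [av mv vmin [cg dF Fv] hg]]]] := exists_regular_minimizer hl hp2 hp4 hmu.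
have [] := realize_energy hl hp2 av cg dF Fv hg; rewrite mv.
set u := (X in sobolevH1mass _ _ X) => hu eu.
exists u; split=> //; apply/eqP; rewrite eq_le; apply/andP; split.
  (* The energy of u is at most that of v, which is at most that of |w|, which is at most that of
     w. *)
  apply: le_ereal_inf_tmp => _ [w [sw mw] <-].
  have [mE hE] := modulus_energy_le hl hp2 sw mw.
  apply: le_trans eu (le_trans _ hE); rewrite lee_fin.
  by apply: vmin mE; exact: modulus_admissible.
by apply: ereal_inf_lbound; exists u.
Qed.
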